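(* Let $f\in\mathcal{W}(1)$ with logarithmic inverse coefficients $\Gamma_1,\Gamma_2,\Gamma_3$, and let $H_{2,1}(F_{f^{-1}}/2)=\Gamma_1\Gamma_3-\Gamma_2^2$. Then $$\left|H_{2,1}\!\left(\frac{F_{f^{-1}}}{2}\right)\right|\le\frac{1}{81}.$$ The inequality is sharp.
   Context: Let $\mathbb{D}=\{z\in\mathbb{C}:|z|<1\}$ and let $\mathcal{A}$ be the class of holomorphic functions $f$ on $\mathbb{D}$ with $f(0)=0$ and $f'(0)=1$, written $f(z)=z+\sum_{n\ge 2}a_nz^n$. $\mathcal{W}(1)$ is the class of all $f\in\mathcal{A}$ with $\mathrm{Re}\,\{f'(z)+z f''(z)\}>0$ for all $z\in\mathbb{D}$. It is known that every $f\in\mathcal{W}(1)$ is univalent in $\mathbb{D}$, so its inverse $f^{-1}$ is defined on $|w|<1/4$. The logarithmic inverse coefficients $\Gamma_n$ of $f$ are defined by $F_{f^{-1}}(w)=\log\frac{f^{-1}(w)}{w}=2\sum_{n=1}^\infty\Gamma_nw^n$, $|w|<1/4$ (branch of the logarithm vanishing at $w=0$); in particular $\Gamma_1=-\frac12a_2$, $\Gamma_2=-\frac12\left(a_3-\frac32a_2^2\right)$, $\Gamma_3=-\frac12\left(a_4-4a_2a_3+\frac{10}{3}a_2^3\right)$. The second Hankel determinant of the logarithmic inverse coefficients is $H_{2,1}(F_{f^{-1}}/2)=\Gamma_1\Gamma_3-\Gamma_2^2=\frac14\left(\frac{13}{12}a_2^4+a_2a_4-a_2^2a_3-a_3^2\right)$.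 The inequality being sharp means that equality is attained by some $f\in\mathcal{W}(1)$. *)

(* Defs.v *)
From Stdlib Require Export Reals.
From Coquelicot Require Export Coquelicot.

Open Scope R_scope.

(* The complex derivative is Coquelicot's [is_derive] over the field [C]
   (not over [R]). *)
Definition is_Cderive (f : C -> C) (z l : C) : Prop :=
  @is_derive C_AbsRing C_NormedModule f z l.

Definition holomorphic_on_disc (f : C -> C) : Prop :=
  forall z : C, Cmod z < 1 -> exists l : C, is_Cderive f z l.

(* Functions on the disc are total functions [C -> C] of which only the values
   on the disc are ever constrained. *)
Definition class_A (f : C -> C) : Prop :=
  holomorphic_on_disc f /\ f (RtoC 0) = RtoC 0 /\ is_Cderive f (RtoC 0) (RtoC 1).

(* [f1] and [f2] are f' and f'' on the disc; both exist for any holomorphic f. *)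
Definition class_W1 (f : C -> C) : Prop :=
  class_A f /\
  exists f1 f2 : C -> C,
    forall z : C, Cmod z < 1 ->
      is_Cderive f z (f1 z) /\
      is_Cderive f1 z (f2 z) /\
      0 < Re (f1 z + z * f2 z)%C.

(* Coquelicot has no complex exponential. *)
Definition Cexp (z : C) : C :=
  (exp (Re z) * cos (Im z), exp (Re z) * sin (Im z)).

(* [g] is the inverse of the univalent map [f] of the unit disc, on |w| < 1/4. *)
Definition is_inverse (f g : C -> C) : Prop :=
  forall w : C, Cmod w < 1 / 4 ->
    Cmod (g w) < 1 /\
    forall z : C, Cmod z < 1 -> (f z = w <-> z = g w).

(* [F w = log (g w / w)] on |w| < 1/4, for the branch with [F 0 = 0]; the
   quotient has a removable singularity at 0. *)
Definition is_log_quotient (g F : C -> C) : Prop :=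
  F (RtoC 0) = RtoC 0 /\
  forall w : C, Cmod w < 1 / 4 ->
    @continuous C_UniformSpace C_UniformSpace F w /\
    (w <> RtoC 0 -> Cexp (F w) = (g w / w)%C).

(* F(w) = 2 * (Gamma 1 * w + Gamma 2 * w^2 + ...); [Gamma 0] is not used. *)
Definition is_log_inverse_coeffs (f : C -> C) (Gamma : nat -> C) : Prop :=
  exists g F : C -> C,
    is_inverse f g /\
    is_log_quotient g F /\
    forall w : C, Cmod w < 1 / 4 ->
      @is_pseries C_AbsRing C_NormedModule
        (fun n => match n with
                  | O => RtoC 0
                  | S _ => (RtoC 2 * Gamma n)%C
                  end) w (F w).

Definition H21 (Gamma : nat -> C) : C :=
  (Gamma 1%nat * Gamma 3%nat - Gamma 2%nat * Gamma 2%nat)%C.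

(* Main.v *)
Require Import Defs.
From Stdlib Require Import Lra Lia Psatz FunctionalExtensionality List.
Import ListNotations.

(** The bound.  For [f] in W(1) the function [p = f' + z f''] has positive real part,
    [p 0 = 1] and coefficients [c_n = (n + 1)^2 a_(n+1)].  Positivity of [Re p] on
    circles of radius [r < 1] makes the Toeplitz form of the numbers [c_n r^n / 2]
    nonnegative ([caratheodory_toeplitz]): it is a mean of
    [Re p |x_0 + x_1 e + x_2 e^2 + x_3 e^3|^2].  Evaluating the form at well-chosen
    vectors gives, for [g_n = c_n / 2] and [s = 1 - |g_1|^2], the three Schur inequalities
    [0 <= s], [|g_2 - g_1^2| <= s] and a bound on [g_3].  Expressed through these
    parameters, [4 (Gamma_1 Gamma_3 - Gamma_2^2)] is estimated by the triangle inequality,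
    and what remains is a real inequality in [|g_1|] and [|g_2 - g_1^2|]
    ([hankel_form_bound]).  The determinant is homogeneous of weight four in the
    [c_n r^n], so [r] can be sent to [1].

    The Gammas.  With [F = log (g w / w)] one has [g w = w exp (F w)], and comparing
    the expansions of both sides of [f (w exp (F w)) = w] up to [w^4] expresses
    [a_2], [a_3], [a_4] through the Gammas ([H21_in_coefs]).

    Sharpness.  Equality holds for [p = (1 + z^2) / (1 - z^2)], that is
    [f z = z + sum 2 z^(2n+1) / (2n+1)^2] over [n >= 1], where [a_2 = a_4 = 0] and [a_3 = 2/9].
    Since [|f z / z - 1| <= 1/2], preimages of the disc [|w| < 1/4] lie in [|z| < 1/2],
    where [f z - z] is a contraction: this produces the inverse, its derivative, and
    [F = - log (f z / z)] at [z = g w] ([extremal_sharp]).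

    Both parts need that functions with a continuous complex derivative on a disc
    are sums of power series.  This is Cauchy's formula ([cauchy_formula]), obtained by
    differentiating under the integral sign while the circle shrinks to a point. *)

Open Scope C_scope.

Notation Ccontinuous := (@continuous C_UniformSpace C_UniformSpace).
Notation is_Cseries := (@is_series C_AbsRing C_NormedModule).
Notation is_Cpseries := (@is_pseries C_AbsRing C_NormedModule).

(** * Elementary facts about complex numbers *)

Lemma C_eq (z w : C) : Re z = Re w -> Im z = Im w -> z = w.
Proof. destruct z, w; unfold Re, Im; simpl; intros; subst; reflexivity. Qed.

Lemma im_le_Cmod (z : C) : (Rabs (Im z) <= Cmod z)%R.
Proof.
  eapply Rle_trans; [apply Rmax_r | apply Rmax_Cmod].
Qed.

Lemma Cmod_le_Re_Im (z : C) : (Cmod z <= Rabs (Re z) + Rabs (Im z))%R.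
Proof.
  replace z with (RtoC (Re z) + RtoC (Im z) * Ci) at 1
    by (apply C_eq; unfold Re, Im; simpl; ring).
  eapply Rle_trans; [apply Cmod_triangle|].
  rewrite Cmod_mult, !Cmod_R.
  replace (Cmod Ci) with 1%R; [lra|].
  unfold Cmod, Ci; simpl.
  replace (0 * (0 * 1) + 1 * (1 * 1))%R with 1%R by ring.
  now rewrite sqrt_1.
Qed.

Lemma Cmod_sym (z w : C) : Cmod (z - w) = Cmod (w - z).
Proof. rewrite <- Cmod_opp. f_equal. ring. Qed.

Lemma Cmod_triangle_rev (z w : C) : (Cmod z - Cmod w <= Cmod (z - w))%R.
Proof.
  pose proof (Cmod_triangle (z - w) w) as H.
  replace (z - w + w) with z in H by ring. lra.
Qed.

Lemma pow_n_Cpow (z : C) (n : nat) : @pow_n C_Ring z n = z ^ n.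
Proof. induction n as [|n IH]; simpl; [reflexivity|]. now rewrite IH. Qed.

(** * Limits, continuity and derivatives in terms of the modulus *)

(** The uniform structure of [C] is that of a product; the next lemmas replace its
    square balls by round ones. *)
Lemma locally_C (z : C) (P : C -> Prop) :
  @locally C_UniformSpace z P <->
  exists d : R, (0 < d)%R /\ forall w : C, (Cmod (w - z) < d)%R -> P w.
Proof.
  split.
  - intros H.
    apply (@locally_norm_le_locally C_AbsRing C_NormedModule) in H.
    destruct H as [d Hd]. exists d. split; [apply cond_pos|].
    intros w Hw. apply Hd. exact Hw.
  - intros [d [Hd H]].
    apply (@locally_le_locally_norm C_AbsRing C_NormedModule).
    exists (mkposreal d Hd). intros w Hw. apply H. exact Hw.
Qed.

Lemma continuous_C_eps {U : UniformSpace} (f : U -> C) (x : U) :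
  @continuous U C_UniformSpace f x <->
  forall eps : R, (0 < eps)%R -> locally x (fun y => (Cmod (f y - f x) < eps)%R).
Proof.
  unfold continuous.
  rewrite (@filterlim_locally_ball_norm C_AbsRing U C_NormedModule (locally x) _ f (f x)).
  split; intros H.
  - intros eps He. exact (H (mkposreal eps He)).
  - intros eps. exact (H eps (cond_pos eps)).
Qed.

Lemma Ccontinuous_eps (f : C -> C) (z : C) :
  Ccontinuous f z <->
  forall eps : R, (0 < eps)%R -> exists d : R, (0 < d)%R /\
    forall w, (Cmod (w - z) < d)%R -> (Cmod (f w - f z) < eps)%R.
Proof.
  rewrite continuous_C_eps. split; intros H eps He.
  - now apply locally_C, H.
  - now apply locally_C, H.
Qed.

Lemma is_Cderive_eps (f : C -> C) (z l : C) :
  is_Cderive f z l <->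
  forall eps : R, (0 < eps)%R -> exists d : R, (0 < d)%R /\
    forall w, (Cmod (w - z) < d)%R ->
      (Cmod (f w - f z - l * (w - z)) <= eps * Cmod (w - z))%R.
Proof.
  split.
  - intros [_ H] eps He.
    destruct (H z (fun P HP => HP) (mkposreal eps He)) as [d Hd].
    exists d. split; [apply cond_pos|].
    intros w Hw. specialize (Hd w Hw).
    rewrite (Cmult_comm l). exact Hd.
  - intros H. split.
    + apply is_linear_scal_l.
    + intros x Hx eps.
      apply (@is_filter_lim_locally_unique C_AbsRing (AbsRing_NormedModule C_AbsRing)) in Hx.
      subst x.
      destruct (H eps (cond_pos eps)) as [d [Hd Hw]].
      exists (mkposreal d Hd). intros w Hb. specialize (Hw w Hb).
      rewrite (Cmult_comm l) in Hw. exact Hw.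
Qed.

Lemma is_Cseries_eps (u : nat -> C) (l : C) :
  is_Cseries u l <->
  forall eps : R, (0 < eps)%R -> exists N : nat, forall n, (N <= n)%nat ->
    (Cmod (sum_n (G := C_AbelianMonoid) u n - l) < eps)%R.
Proof.
  unfold is_series.
  rewrite (@filterlim_locally_ball_norm C_AbsRing nat C_NormedModule eventually _ _ l).
  split; intros H.
  - intros eps He. exact (H (mkposreal eps He)).
  - intros eps. exact (H eps (cond_pos eps)).
Qed.

Lemma is_Cpseries_series (a : nat -> C) (z l : C) :
  is_Cpseries a z l <-> is_Cseries (fun n => a n * z ^ n) l.
Proof.
  unfold is_pseries.
  split; intros H; (eapply is_series_ext; [|exact H]); intros n.
  - exact (eq_trans (f_equal (fun t => t * a n) (pow_n_Cpow z n)) (Cmult_comm _ _)).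
  - exact (eq_trans (Cmult_comm _ _) (f_equal (fun t => t * a n) (eq_sym (pow_n_Cpow z n)))).
Qed.

(** * Continuity and differentiability rules *)

Section ContinuityRules.
Context {U : UniformSpace}.
Implicit Types (f g : U -> C) (x : U).

Lemma continuous_C_components f x :
  @continuous U C_UniformSpace f x <->
  @continuous U R_UniformSpace (fun y => Re (f y)) x /\
  @continuous U R_UniformSpace (fun y => Im (f y)) x.
Proof.
  split.
  - intros H. split.
    + apply (continuous_comp f (fun z : C => fst z)); [exact H|].
      destruct (f x) as [a b]. apply (@continuous_fst R_UniformSpace R_UniformSpace).
    + apply (continuous_comp f (fun z : C => snd z)); [exact H|].
      destruct (f x) as [a b]. apply (@continuous_snd R_UniformSpace R_UniformSpace).
  - intros [Hr Hi]. apply continuous_C_eps. intros eps He.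
    assert (He2 : (0 < eps / 2)%R) by lra.
    assert (Lr := proj1 (filterlim_locally _ _) Hr (mkposreal _ He2)).
    assert (Li := proj1 (filterlim_locally _ _) Hi (mkposreal _ He2)).
    generalize (filter_and _ _ Lr Li). apply filter_imp.
    intros y [H1 H2].
    eapply Rle_lt_trans; [apply Cmod_le_Re_Im|].
    change (Rabs (Re (f y) - Re (f x)) < eps / 2)%R in H1.
    change (Rabs (Im (f y) - Im (f x)) < eps / 2)%R in H2.
    change (Re (f y - f x)) with (Re (f y) - Re (f x))%R.
    change (Im (f y - f x)) with (Im (f y) - Im (f x))%R.
    lra.
Qed.

Lemma continuous_Rplus (f g : U -> R) x :
  continuous f x -> continuous g x -> continuous (fun y => (f y + g y)%R) x.
Proof. apply (@continuous_plus U R_AbsRing R_NormedModule). Qed.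

Lemma continuous_Ropp (f : U -> R) x :
  continuous f x -> continuous (fun y => (- f y)%R) x.
Proof. apply (@continuous_opp U R_AbsRing R_NormedModule). Qed.

Lemma continuous_Rmult (f g : U -> R) x :
  continuous f x -> continuous g x -> continuous (fun y => (f y * g y)%R) x.
Proof. apply (@continuous_mult U R_AbsRing). Qed.

Lemma continuous_Cplus f g x :
  @continuous U C_UniformSpace f x -> @continuous U C_UniformSpace g x ->
  @continuous U C_UniformSpace (fun y => f y + g y) x.
Proof.
  rewrite !continuous_C_components. intros [H1 H2] [H3 H4]. simpl.
  split; now apply continuous_Rplus.
Qed.

Lemma continuous_Copp f x :
  @continuous U C_UniformSpace f x ->
  @continuous U C_UniformSpace (fun y => - f y) x.
Proof.
  rewrite !continuous_C_components. intros [H1 H2].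
  split; now apply continuous_Ropp.
Qed.

Lemma continuous_Cminus f g x :
  @continuous U C_UniformSpace f x -> @continuous U C_UniformSpace g x ->
  @continuous U C_UniformSpace (fun y => f y - g y) x.
Proof. intros. apply continuous_Cplus; [|apply continuous_Copp]; assumption. Qed.

Lemma continuous_Cmult f g x :
  @continuous U C_UniformSpace f x -> @continuous U C_UniformSpace g x ->
  @continuous U C_UniformSpace (fun y => f y * g y) x.
Proof.
  rewrite !continuous_C_components. intros [H1 H2] [H3 H4]. simpl. split.
  - apply continuous_Rplus; [|apply continuous_Ropp]; now apply continuous_Rmult.
  - apply continuous_Rplus; now apply continuous_Rmult.
Qed.

Lemma continuous_Cconst (c : C) x : @continuous U C_UniformSpace (fun _ => c) x.
Proof. apply continuous_const. Qed.

Lemma continuous_Cpow f n x :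
  @continuous U C_UniformSpace f x ->
  @continuous U C_UniformSpace (fun y => f y ^ n) x.
Proof.
  intros H. induction n as [|n IH]; simpl; [apply continuous_Cconst|].
  now apply continuous_Cmult.
Qed.

Lemma continuous_RtoC (f : U -> R) x :
  continuous f x -> @continuous U C_UniformSpace (fun y => RtoC (f y)) x.
Proof.
  intros H. apply continuous_C_components. split; [exact H|].
  apply (@continuous_const U R_UniformSpace).
Qed.

Lemma continuous_Cinv f x :
  f x <> 0 -> @continuous U C_UniformSpace f x ->
  @continuous U C_UniformSpace (fun y => / f y) x.
Proof.
  intros Hnz H. apply (continuous_comp f Cinv); [exact H|].
  apply Ccontinuous_eps. intros eps He.
  set (z := f x) in *.
  assert (Hz : (0 < Cmod z)%R) by now apply Cmod_gt_0.
  exists (Rmin (Cmod z / 2) (eps * (Cmod z * Cmod z) / 2))%R. split.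
  { apply Rmin_glb_lt; [lra|].
    apply Rdiv_lt_0_compat; [|lra]. repeat apply Rmult_lt_0_compat; lra. }
  intros w Hw.
  assert (Hw1 := Rlt_le_trans _ _ _ Hw (Rmin_l _ _)).
  assert (Hw2 := Rlt_le_trans _ _ _ Hw (Rmin_r _ _)).
  assert (Hm : (Cmod z / 2 < Cmod w)%R).
  { pose proof (Cmod_triangle_rev z w). rewrite Cmod_sym in H0. lra. }
  assert (Hwn : w <> 0) by (apply Cmod_gt_0; lra).
  replace (/ w - / z) with ((z - w) / (w * z)) by (field; auto).
  rewrite Cmod_div by now apply Cmult_neq_0.
  rewrite Cmod_mult, Cmod_sym.
  apply Rmult_lt_reg_r with (Cmod w * Cmod z)%R; [nra|].
  unfold Rdiv. rewrite Rmult_assoc, Rinv_l, Rmult_1_r by nra.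
  assert (P : (0 < eps * Cmod z * (Cmod w - Cmod z / 2))%R)
    by (repeat apply Rmult_lt_0_compat; lra).
  lra.
Qed.
End ContinuityRules.

Lemma is_Cderive_continuous (f : C -> C) (z l : C) :
  is_Cderive f z l -> Ccontinuous f z.
Proof.
  rewrite is_Cderive_eps, Ccontinuous_eps. intros H eps He.
  destruct (H 1%R Rlt_0_1) as [d [Hd Hw]].
  pose proof (Cmod_ge_0 l) as Hl.
  exists (Rmin d (eps / (Cmod l + 2)))%R. split.
  { apply Rmin_glb_lt; [lra|]. apply Rdiv_lt_0_compat; lra. }
  intros w Hd'.
  assert (Hw1 := Rlt_le_trans _ _ _ Hd' (Rmin_l _ _)).
  assert (Hw2 := Rlt_le_trans _ _ _ Hd' (Rmin_r _ _)).
  specialize (Hw w Hw1).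
  replace (f w - f z) with ((f w - f z - l * (w - z)) + l * (w - z)) by ring.
  eapply Rle_lt_trans; [apply Cmod_triangle|]. rewrite Cmod_mult.
  apply (Rmult_lt_compat_r (Cmod l + 2)) in Hw2; [|lra].
  unfold Rdiv in Hw2. rewrite Rmult_assoc, Rinv_l, Rmult_1_r in Hw2 by lra.
  pose proof (Cmod_ge_0 (w - z)). nra.
Qed.

Lemma is_Cderive_ext_loc (f g : C -> C) (z l : C) (d : R) :
  (0 < d)%R -> (forall w, (Cmod (w - z) < d)%R -> f w = g w) ->
  is_Cderive f z l -> is_Cderive g z l.
Proof.
  rewrite !is_Cderive_eps. intros Hd He H eps Heps.
  destruct (H eps Heps) as [d' [Hd' Hw]].
  exists (Rmin d d'). split; [now apply Rmin_glb_lt|].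
  intros w Hm.
  rewrite <- (He w), <- (He z).
  - apply Hw. eapply Rlt_le_trans; [exact Hm | apply Rmin_r].
  - replace (z - z) with (RtoC 0) by ring. now rewrite Cmod_0.
  - eapply Rlt_le_trans; [exact Hm | apply Rmin_l].
Qed.

Lemma is_Cderive_unique (f : C -> C) (z l1 l2 : C) :
  is_Cderive f z l1 -> is_Cderive f z l2 -> l1 = l2.
Proof.
  rewrite !is_Cderive_eps. intros H1 H2.
  destruct (Ceq_dec l1 l2) as [|Hne]; [assumption|exfalso].
  assert (Hp : (0 < Cmod (l1 - l2))%R) by (apply Cmod_gt_0, Cminus_eq_contra, Hne).
  destruct (H1 (Cmod (l1 - l2) / 4)%R) as [d1 [Hd1 Hw1]]; [lra|].
  destruct (H2 (Cmod (l1 - l2) / 4)%R) as [d2 [Hd2 Hw2]]; [lra|].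
  pose proof (Rmin_l d1 d2). pose proof (Rmin_r d1 d2).
  pose proof (Rmin_glb_lt _ _ _ Hd1 Hd2).
  set (d := (Rmin d1 d2 / 2)%R) in *.
  assert (Hd : (0 < d)%R) by (unfold d; lra).
  assert (Em : Cmod (z + d - z) = d).
  { replace (z + d - z) with (RtoC d) by ring. rewrite Cmod_R. apply Rabs_pos_eq. lra. }
  specialize (Hw1 (z + d)). specialize (Hw2 (z + d)).
  rewrite Em in Hw1, Hw2.
  assert (Q1 : (d < d1)%R) by (unfold d; lra).
  assert (Q2 : (d < d2)%R) by (unfold d; lra).
  specialize (Hw1 Q1). specialize (Hw2 Q2).
  replace (z + d - z) with (RtoC d) in Hw1, Hw2 by ring.
  assert (E : (l1 - l2) * d = (f (z + d) - f z - l2 * d) - (f (z + d) - f z - l1 * d))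
    by ring.
  apply (f_equal Cmod) in E. rewrite Cmod_mult, Cmod_R, Rabs_pos_eq in E by lra.
  pose proof (Cmod_triangle (f (z + d) - f z - l2 * d) (- (f (z + d) - f z - l1 * d))) as T.
  rewrite Cmod_opp in T.
  set (X := f (z + d) - f z - l2 * d) in *. set (Y := f (z + d) - f z - l1 * d) in *.
  change (X + - Y) with (X - Y) in T. rewrite <- E in T.
  pose proof (Rmult_lt_0_compat _ _ Hp Hd). lra.
Qed.

Lemma is_Cderive_value (f : C -> C) (z l m : C) :
  is_Cderive f z l -> l = m -> is_Cderive f z m.
Proof. now intros H <-. Qed.

Lemma is_Cderive_const (c z : C) : is_Cderive (fun _ => c) z 0.
Proof.
  apply is_Cderive_eps. intros eps He. exists 1%R. split; [lra|].
  intros w _. replace (c - c - 0 * (w - z)) with (RtoC 0) by ring. rewrite Cmod_0.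
  pose proof (Cmod_ge_0 (w - z)). nra.
Qed.

Lemma is_Cderive_id (z : C) : is_Cderive (fun w => w) z 1.
Proof.
  apply is_Cderive_eps. intros eps He. exists 1%R. split; [lra|].
  intros w _. replace (w - z - 1 * (w - z)) with (RtoC 0) by ring. rewrite Cmod_0.
  pose proof (Cmod_ge_0 (w - z)). nra.
Qed.

Lemma is_Cderive_plus (f g : C -> C) (z l m : C) :
  is_Cderive f z l -> is_Cderive g z m -> is_Cderive (fun w => f w + g w) z (l + m).
Proof. apply (@is_derive_plus C_AbsRing C_NormedModule). Qed.

Lemma is_Cderive_opp (f : C -> C) (z l : C) :
  is_Cderive f z l -> is_Cderive (fun w => - f w) z (- l).
Proof. apply (@is_derive_opp C_AbsRing C_NormedModule). Qed.

(** The product rule is the identity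
    [f w g w - f z g z = (f w - f z) g w + f z (g w - g z)]. *)
Lemma is_Cderive_mult (f g : C -> C) (z l m : C) :
  is_Cderive f z l -> is_Cderive g z m ->
  is_Cderive (fun w => f w * g w) z (l * g z + f z * m).
Proof.
  intros Hf Hg.
  assert (Cg := is_Cderive_continuous _ _ _ Hg).
  rewrite is_Cderive_eps in *. rewrite Ccontinuous_eps in Cg.
  intros eps He.
  pose proof (Cmod_ge_0 l) as L0. pose proof (Cmod_ge_0 (g z)) as G0.
  pose proof (Cmod_ge_0 (f z)) as F0.
  set (K := (Cmod l + Cmod (g z) + Cmod (f z) + 2)%R).
  assert (HK : (0 < K)%R) by (unfold K; lra).
  assert (He3 : (0 < eps / (3 * K))%R) by (apply Rdiv_lt_0_compat; lra).
  set (e := (eps / (3 * K))%R) in *.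
  assert (Ee : (e * (3 * K) = eps)%R) by (unfold e; field; lra).
  destruct (Hf e He3) as [d1 [D1 W1]]. destruct (Hg e He3) as [d2 [D2 W2]].
  destruct (Cg (Rmin 1 e)) as [d3 [D3 W3]]; [apply Rmin_glb_lt; lra|].
  exists (Rmin d1 (Rmin d2 d3)). split; [repeat apply Rmin_glb_lt; assumption|].
  intros w Hw.
  assert (Hw1 := Rlt_le_trans _ _ _ Hw (Rmin_l _ _)).
  assert (Hw23 := Rlt_le_trans _ _ _ Hw (Rmin_r _ _)).
  assert (Hw2 := Rlt_le_trans _ _ _ Hw23 (Rmin_l _ _)).
  assert (Hw3 := Rlt_le_trans _ _ _ Hw23 (Rmin_r _ _)).
  specialize (W1 w Hw1). specialize (W2 w Hw2). specialize (W3 w Hw3).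
  assert (W3a := Rlt_le_trans _ _ _ W3 (Rmin_l _ _)).
  assert (W3b := Rlt_le_trans _ _ _ W3 (Rmin_r _ _)).
  replace (f w * g w - f z * g z - (l * g z + f z * m) * (w - z))
    with ((f w - f z - l * (w - z)) * (g z + (g w - g z))
          + (l * (w - z) * (g w - g z) + f z * (g w - g z - m * (w - z)))) by ring.
  set (A := f w - f z - l * (w - z)) in *. set (B := g w - g z - m * (w - z)) in *.
  set (D := g w - g z) in *. set (h := w - z) in *.
  eapply Rle_trans; [apply Cmod_triangle|].
  eapply Rle_trans; [apply Rplus_le_compat_l, Cmod_triangle|].
  rewrite !Cmod_mult.
  pose proof (Cmod_triangle (g z) D) as T.
  pose proof (Cmod_ge_0 h) as Hh0. pose proof (Cmod_ge_0 A) as A0.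
  pose proof (Cmod_ge_0 B) as B0. pose proof (Cmod_ge_0 D) as D0.
  pose proof (Cmod_ge_0 (g z + D)) as GD0.
  assert (P1 : (Cmod A * Cmod (g z + D) <= (e * Cmod h) * K)%R).
  { apply Rmult_le_compat; auto. unfold K; lra. }
  assert (P2 : (Cmod l * Cmod h * Cmod D <= K * Cmod h * e)%R).
  { apply Rmult_le_compat; auto; [nra| |lra]. apply Rmult_le_compat_r; unfold K; lra. }
  assert (P3 : (Cmod (f z) * Cmod B <= K * (e * Cmod h))%R).
  { apply Rmult_le_compat; auto. unfold K; lra. }
  rewrite <- Ee. nra.
Qed.

Lemma is_Cderive_comp (f g : C -> C) (z l m : C) :
  is_Cderive f (g z) l -> is_Cderive g z m ->
  is_Cderive (fun w => f (g w)) z (l * m).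
Proof.
  intros Hf Hg.
  assert (Cg := is_Cderive_continuous _ _ _ Hg).
  rewrite is_Cderive_eps in *. rewrite Ccontinuous_eps in Cg.
  intros eps He.
  pose proof (Cmod_ge_0 l) as L0. pose proof (Cmod_ge_0 m) as M0.
  set (e := (eps / (Cmod l + Cmod m + 2))%R).
  assert (He' : (0 < e)%R) by (apply Rdiv_lt_0_compat; lra).
  assert (Ee : (e * (Cmod l + Cmod m + 2) = eps)%R) by (unfold e; field; lra).
  destruct (Hf e He') as [d1 [D1 W1]].
  destruct (Hg (Rmin 1 e)) as [d2 [D2 W2]]; [apply Rmin_glb_lt; lra|].
  destruct (Cg d1 D1) as [d3 [D3 W3]].
  exists (Rmin d2 d3). split; [now apply Rmin_glb_lt|].
  intros w Hw.
  specialize (W3 w (Rlt_le_trans _ _ _ Hw (Rmin_r _ _))).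
  specialize (W2 w (Rlt_le_trans _ _ _ Hw (Rmin_l _ _))).
  specialize (W1 _ W3).
  pose proof (Rmin_l 1 e). pose proof (Rmin_r 1 e).
  set (h := w - z) in *.
  replace (f (g w) - f (g z) - l * m * h)
    with ((f (g w) - f (g z) - l * (g w - g z)) + l * (g w - g z - m * h)) by ring.
  assert (T : (Cmod (g w - g z) <= (Cmod m + 1) * Cmod h)%R).
  { replace (g w - g z) with ((g w - g z - m * h) + m * h) by ring.
    eapply Rle_trans; [apply Cmod_triangle|]. rewrite Cmod_mult.
    pose proof (Cmod_ge_0 h). nra. }
  eapply Rle_trans; [apply Cmod_triangle|]. rewrite Cmod_mult.
  pose proof (Cmod_ge_0 h) as Hh0.
  assert (Q1 : (Cmod (f (g w) - f (g z) - l * (g w - g z)) <= e * ((Cmod m + 1) * Cmod h))%R)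
    by nra.
  assert (Q2 : (Cmod l * Cmod (g w - g z - m * h) <= Cmod l * (e * Cmod h))%R).
  { apply Rmult_le_compat_l; [assumption|]. nra. }
  rewrite <- Ee. nra.
Qed.

(** * Complex power series *)

Lemma Cmod_sum_n (u : nat -> C) (b : nat -> R) :
  (forall n, (Cmod (u n) <= b n)%R) ->
  forall n, (Cmod (sum_n (G := C_AbelianMonoid) u n)
             <= sum_n (G := R_AbelianMonoid) b n)%R.
Proof.
  intros H n. induction n as [|n IH].
  - rewrite !sum_O. apply H.
  - rewrite !sum_Sn. eapply Rle_trans; [apply Cmod_triangle|].
    apply Rplus_le_compat; auto.
Qed.

Lemma Cmod_series_le (u : nat -> C) (l : C) (B : R) :
  is_Cseries u l ->
  (forall n, (Cmod (sum_n (G := C_AbelianMonoid) u n) <= B)%R) -> (Cmod l <= B)%R.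
Proof.
  intros H HB. apply Rnot_lt_le. intros Hl.
  destruct (proj1 (is_Cseries_eps _ _) H (Cmod l - B)%R) as [N HN]; [lra|].
  specialize (HN N (Nat.le_refl N)). specialize (HB N).
  rewrite Cmod_sym in HN.
  pose proof (Cmod_triangle_rev l (sum_n (G := C_AbelianMonoid) u N)). lra.
Qed.

Lemma Cseries_dominated (u : nat -> C) (b : nat -> R) (B : R) :
  (forall n, (Cmod (u n) <= b n)%R) -> is_series b B ->
  exists l : C, is_Cseries u l /\ (Cmod l <= B)%R.
Proof.
  intros Hu Hb.
  destruct (@ex_series_le C_AbsRing C_CompleteNormedModule u b) as [l Hl].
  { exact Hu. } { now exists B. }
  exists l. split; [exact Hl|].
  apply (Cmod_series_le u l B Hl). intros n.
  eapply Rle_trans; [apply (Cmod_sum_n u b Hu)|].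
  assert (Hinc : forall m, (sum_n b n <= sum_n b (n + m))%R).
  { induction m as [|m IH]; [rewrite Nat.add_0_r; lra|].
    rewrite Nat.add_succ_r, sum_Sn.
    pose proof (Hu (S (n + m))). pose proof (Cmod_ge_0 (u (S (n + m)))).
    change plus with Rplus. lra. }
  apply Rnot_lt_le. intros Hlt.
  assert (He : (0 < sum_n b n - B)%R) by lra.
  destruct (proj1 (filterlim_locally _ _) Hb (mkposreal _ He)) as [N HN].
  specialize (HN (n + N)%nat ltac:(lia)). specialize (Hinc N).
  change (Rabs (sum_n b (n + N) - B) < sum_n b n - B)%R in HN.
  apply Rabs_def2 in HN. lra.
Qed.

Lemma Cseries_unique (u : nat -> C) (l m : C) :
  is_Cseries u l -> is_Cseries u m -> l = m.
Proof.
  intros Hl Hm.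
  apply (@filterlim_locally_unique nat C_AbsRing C_NormedModule eventually _
           (sum_n (G := C_AbelianMonoid) u)); assumption.
Qed.

Lemma Cseries_ext (u v : nat -> C) (l : C) :
  (forall n, u n = v n) -> is_Cseries u l -> is_Cseries v l.
Proof. exact (@is_series_ext C_AbsRing C_NormedModule u v l). Qed.

Lemma Cseries_scal (c : C) (u : nat -> C) (l : C) :
  is_Cseries u l -> is_Cseries (fun n => c * u n) (c * l).
Proof. exact (@is_series_scal C_AbsRing C_NormedModule c u l). Qed.

Lemma Cseries_minus (u v : nat -> C) (l m : C) :
  is_Cseries u l -> is_Cseries v m -> is_Cseries (fun n => u n - v n) (l - m).
Proof. exact (@is_series_minus C_AbsRing C_NormedModule u v l m). Qed.

Lemma Cseries_cons (u : nat -> C) (l : C) :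
  is_Cseries (fun n => u (S n)) l -> is_Cseries u (u 0%nat + l).
Proof.
  intros H. apply (@is_series_decr_1 C_AbsRing C_NormedModule u (u 0%nat + l)).
  refine (eq_ind l (is_Cseries (fun n => u (S n))) H _ _).
  change (l = u 0%nat + l + - u 0%nat). ring.
Qed.

Lemma Cseries_tail (u : nat -> C) (l : C) :
  is_Cseries u l -> is_Cseries (fun n => u (S n)) (l - u 0%nat).
Proof.
  intros H. apply (@is_series_incr_1 C_AbsRing C_NormedModule u (l - u 0%nat)).
  refine (eq_ind l (is_Cseries u) H _ _).
  change (l = l - u 0%nat + u 0%nat). ring.
Qed.

Lemma Cseries_zero : is_Cseries (fun _ => RtoC 0) (RtoC 0).
Proof.
  apply is_Cseries_eps. intros eps He. exists 0%nat. intros n _.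
  replace (sum_n (G := C_AbelianMonoid) (fun _ => RtoC 0) n) with (RtoC 0).
  - replace (RtoC 0 - RtoC 0) with (RtoC 0) by ring. now rewrite Cmod_0.
  - induction n as [|n IH]; [now rewrite sum_O|].
    rewrite sum_Sn, <- IH. change (RtoC 0 = RtoC 0 + RtoC 0). ring.
Qed.

Lemma Cpseries_unique_sum (a : nat -> C) (z l m : C) :
  is_Cpseries a z l -> is_Cpseries a z m -> l = m.
Proof. rewrite !is_Cpseries_series. apply Cseries_unique. Qed.

(** Convergent series are exactly those whose components converge, so
    [Series] yields a total summation operator. *)
Definition Csum (u : nat -> C) : C :=
  (Series (fun n => Re (u n)), Series (fun n => Im (u n))).

Lemma Csum_unique (u : nat -> C) (l : C) : is_Cseries u l -> Csum u = l.
Proof.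
  intros H. rewrite is_Cseries_eps in H.
  assert (E : forall n, Re (sum_n (G := C_AbelianMonoid) u n)
                        = sum_n (G := R_AbelianMonoid) (fun n => Re (u n)) n /\
                        Im (sum_n (G := C_AbelianMonoid) u n)
                        = sum_n (G := R_AbelianMonoid) (fun n => Im (u n)) n).
  { induction n as [|n [IH1 IH2]]; [now rewrite !sum_O|].
    rewrite !sum_Sn, <- IH1, <- IH2. now split. }
  apply C_eq; simpl; apply is_series_unique;
  apply (proj2 (filterlim_locally _ _)); intros eps;
  destruct (H eps (cond_pos eps)) as [N HN]; exists N; intros n Hn;
  specialize (HN n Hn); destruct (E n) as [E1 E2].
  - change (Rabs (sum_n (fun n => Re (u n)) n - Re l) < eps)%R. rewrite <- E1.
    eapply Rle_lt_trans; [|exact HN]. apply (re_le_Cmod (_ - _)).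
  - change (Rabs (sum_n (fun n => Im (u n)) n - Im l) < eps)%R. rewrite <- E2.
    eapply Rle_lt_trans; [|exact HN]. apply (im_le_Cmod (_ - _)).
Qed.

Definition psum (a : nat -> C) (z : C) : C := Csum (fun n => a n * z ^ n).

Lemma psum_unique (a : nat -> C) (z l : C) : is_Cpseries a z l -> psum a z = l.
Proof. rewrite is_Cpseries_series. apply Csum_unique. Qed.

Definition convergent_on (rho : R) (a : nat -> C) : Prop :=
  forall z, (Cmod z < rho)%R -> exists l : C, is_Cpseries a z l.

Lemma psum_correct (rho : R) (a : nat -> C) (z : C) :
  convergent_on rho a -> (Cmod z < rho)%R -> is_Cpseries a z (psum a z).
Proof.
  intros H Hz. destruct (H z Hz) as [l Hl].
  now rewrite (psum_unique a z l).
Qed.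

Lemma series_terms_bounded (u : nat -> C) (l : C) :
  is_Cseries u l -> exists K, forall n, (Cmod (u n) <= K)%R.
Proof.
  intros H.
  destruct (@filterlim_bounded C_AbsRing C_NormedModule
              (sum_n (G := C_AbelianMonoid) u)) as [M HM]; [now exists l|].
  change (forall n, (Cmod (sum_n (G := C_AbelianMonoid) u n) <= M)%R) in HM.
  exists (2 * M)%R. intros [|n].
  - specialize (HM 0%nat). rewrite sum_O in HM.
    pose proof (Cmod_ge_0 (u 0%nat)). lra.
  - pose proof (HM n) as H1. pose proof (HM (S n)) as H2. rewrite sum_Sn in H2.
    change (Cmod (sum_n (G := C_AbelianMonoid) u n + u (S n)) <= M)%R in H2.
    replace (u (S n)) with ((sum_n (G := C_AbelianMonoid) u n + u (S n))
                            + - (sum_n (G := C_AbelianMonoid) u n)) by ring.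
    eapply Rle_trans; [apply Cmod_triangle|]. rewrite Cmod_opp. lra.
Qed.

(** Cauchy estimates; the hypothesis under which series are compared with geometric
    ones. *)
Definition coef_bound (R0 K : R) (a : nat -> C) : Prop :=
  (0 < R0)%R /\ forall n, (Cmod (a n) * R0 ^ n <= K)%R.

Lemma coef_bound_pos R0 K a : coef_bound R0 K a -> (0 <= K)%R.
Proof.
  intros [_ H]. specialize (H 0%nat). pose proof (Cmod_ge_0 (a 0%nat)).
  simpl in H. lra.
Qed.

Lemma convergent_coef_bound (rho R0 : R) (a : nat -> C) :
  convergent_on rho a -> (0 < R0 < rho)%R -> exists K, coef_bound R0 K a.
Proof.
  intros H HR. destruct (H (RtoC R0)) as [l Hl].
  { rewrite Cmod_R, Rabs_pos_eq; lra. }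
  apply is_Cpseries_series, series_terms_bounded in Hl. destruct Hl as [K HK].
  exists K. split; [lra|]. intros n. specialize (HK n).
  rewrite Cmod_mult, Cmod_pow, Cmod_R, Rabs_pos_eq in HK; lra.
Qed.

(** Comparison with the geometric series of ratio [|z| / R0]. *)
Lemma pseries_geometric (R0 K : R) (a : nat -> C) (z : C) :
  coef_bound R0 K a -> (Cmod z < R0)%R ->
  exists l : C, is_Cpseries a z l /\ (Cmod l <= K * / (1 - Cmod z / R0))%R.
Proof.
  intros [HR HK] Hz. pose proof (Cmod_ge_0 z) as Hz0.
  assert (Hq : (Rabs (Cmod z / R0) < 1)%R).
  { rewrite Rabs_pos_eq by (apply Rdiv_le_0_compat; lra).
    apply Rmult_lt_reg_r with R0; [lra|].
    unfold Rdiv. rewrite Rmult_assoc, Rinv_l; lra. }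
  destruct (Cseries_dominated (fun n => a n * z ^ n)
              (fun n => (K * (Cmod z / R0) ^ n)%R) (K * / (1 - Cmod z / R0))) as [l [Hl HB]].
  - intros n. rewrite Cmod_mult, Cmod_pow. unfold Rdiv. rewrite Rpow_mult_distr, pow_inv.
    assert (Hp : (0 < R0 ^ n)%R) by now apply pow_lt.
    replace (Cmod (a n) * Cmod z ^ n)%R
      with ((Cmod (a n) * R0 ^ n) * (Cmod z ^ n * / R0 ^ n))%R by (field; lra).
    apply Rmult_le_compat_r; [|apply HK].
    apply Rmult_le_pos; [now apply pow_le|]. left. now apply Rinv_0_lt_compat.
  - apply (@is_series_scal R_AbsRing R_NormedModule K). now apply is_series_geom.
  - exists l. split; [now apply is_Cpseries_series | exact HB].
Qed.

Lemma coef_bound_convergent (R0 K : R) (a : nat -> C) :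
  coef_bound R0 K a -> convergent_on R0 a.
Proof.
  intros H z Hz. destruct (pseries_geometric R0 K a z H Hz) as [l [Hl _]]. now exists l.
Qed.

Lemma pseries_shift (a : nat -> C) (z l : C) :
  is_Cpseries (fun n => a (S n)) z l -> is_Cpseries a z (a 0%nat + z * l).
Proof.
  rewrite !is_Cpseries_series. intros H.
  replace (a 0%nat) with (a 0%nat * z ^ 0) by (simpl; ring).
  apply (Cseries_cons (fun n => a n * z ^ n)).
  eapply Cseries_ext; [|apply (Cseries_scal z), H].
  intros n. simpl. ring.
Qed.

Lemma coef_bound_shift R0 K a :
  coef_bound R0 K a -> coef_bound R0 (K / R0) (fun n => a (S n)).
Proof.
  intros [HR HK]. split; [exact HR|]. intros n. specialize (HK (S n)). simpl in HK.
  apply Rmult_le_reg_r with R0; [exact HR|].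
  unfold Rdiv. rewrite (Rmult_assoc K), Rinv_l by lra. lra.
Qed.

(** A series vanishing on a punctured disc has all coefficients zero: the
    constant one is the limit at the centre, and the others follow by shifting. *)
Lemma pseries_zero_coefs (R0 : R) (n : nat) : forall (a : nat -> C) K,
  coef_bound R0 K a ->
  (forall z : C, z <> 0 -> (Cmod z < R0)%R -> is_Cpseries a z (RtoC 0)) -> a n = 0.
Proof.
  assert (H0 : forall (a : nat -> C) K, coef_bound R0 K a ->
    (forall z : C, z <> 0 -> (Cmod z < R0)%R -> is_Cpseries a z (RtoC 0)) -> a 0%nat = 0).
  { intros a K' HK Hz. assert (HR := proj1 HK).
    pose proof (coef_bound_pos _ _ _ (coef_bound_shift _ _ _ HK)) as HKp.
    apply Cmod_eq_0, Rle_antisym; [|apply Cmod_ge_0].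
    apply Rnot_lt_le. intros Hpos.
    set (M := (K' / R0)%R) in *.
    set (d := Rmin (R0 / 2) (Cmod (a 0%nat) / (2 * M + 1) / 2)).
    assert (Hd : (0 < d)%R).
    { apply Rmin_glb_lt; [lra|]. repeat apply Rdiv_lt_0_compat; lra. }
    assert (Hd1 : (d <= R0 / 2)%R) by apply Rmin_l.
    assert (Hd2 : (d * (2 * M + 1) < Cmod (a 0%nat))%R).
    { apply Rle_lt_trans with (Cmod (a 0%nat) / (2 * M + 1) / 2 * (2 * M + 1))%R.
      - apply Rmult_le_compat_r; [lra | apply Rmin_r].
      - field_simplify; lra. }
    assert (Ed : Cmod d = d) by (rewrite Cmod_R, Rabs_pos_eq; lra).
    destruct (pseries_geometric R0 M (fun n => a (S n)) (RtoC d)) as [l [Hl HB]].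
    { now apply coef_bound_shift. } { lra. }
    rewrite Ed in HB.
    assert (HB' : (Cmod l <= M * 2)%R).
    { eapply Rle_trans; [exact HB|]. apply Rmult_le_compat_l; [exact HKp|].
      assert (d / R0 <= / 2)%R.
      { apply Rmult_le_reg_r with R0; [lra|]. unfold Rdiv.
        rewrite Rmult_assoc, Rinv_l; lra. }
      rewrite <- (Rinv_inv 2). apply Rinv_le_contravar; lra. }
    apply pseries_shift in Hl.
    assert (E : a 0%nat + d * l = 0).
    { eapply Cpseries_unique_sum; [exact Hl|]. apply Hz; [|lra].
      intros Z. apply (f_equal Cmod) in Z. rewrite Ed, Cmod_0 in Z. lra. }
    assert (E2 : a 0%nat = - (d * l)).
    { replace (a 0%nat) with (a 0%nat + d * l - d * l) by ring. rewrite E. ring. }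
    apply (f_equal Cmod) in E2. rewrite Cmod_opp, Cmod_mult, Ed in E2. nra. }
  induction n as [|n IH]; intros a K HK Hz; [eapply H0; eauto|].
  apply (IH (fun n => a (S n)) (K / R0)%R); [now apply coef_bound_shift|].
  intros z Hnz HzR.
  destruct (pseries_geometric R0 _ _ z (coef_bound_shift _ _ _ HK) HzR) as [l [Hl _]].
  assert (E : a 0%nat + z * l = 0).
  { eapply Cpseries_unique_sum; [apply pseries_shift, Hl | now apply Hz]. }
  rewrite (H0 a K HK Hz) in E.
  assert (El : l = 0).
  { replace l with (/ z * (0 + z * l)) by (field; exact Hnz). rewrite E. ring. }
  now rewrite El in Hl.
Qed.

Lemma pseries_minus (a b : nat -> C) (z l m : C) :
  is_Cpseries a z l -> is_Cpseries b z m ->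
  is_Cpseries (fun n => a n - b n) z (l - m).
Proof.
  rewrite !is_Cpseries_series. intros Ha Hb.
  eapply Cseries_ext; [|exact (Cseries_minus _ _ _ _ Ha Hb)].
  intros n. simpl. ring.
Qed.

Theorem pseries_coef_unique (rho : R) (a b : nat -> C) (f : C -> C) :
  (0 < rho)%R ->
  (forall z, (Cmod z < rho)%R -> is_Cpseries a z (f z)) ->
  (forall z, (Cmod z < rho)%R -> is_Cpseries b z (f z)) ->
  forall n, a n = b n.
Proof.
  intros Hr Ha Hb n.
  assert (Hc : convergent_on rho (fun n => a n - b n)).
  { intros z Hz. eexists. apply pseries_minus; eauto. }
  destruct (convergent_coef_bound rho (rho / 2) _ Hc) as [K HK]; [lra|].
  apply Ceq_minus.
  apply (pseries_zero_coefs (rho / 2) n _ K HK).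
  intros z _ Hz. replace (RtoC 0) with (f z - f z) by ring.
  apply pseries_minus; [apply Ha | apply Hb]; lra.
Qed.

Definition pderiv (a : nat -> C) (n : nat) : C := RtoC (INR (S n)) * a (S n).

(** Both series are derivatives of [sum x^n]. *)
Lemma ex_series_quadratic_geom (x : R) :
  (0 <= x < 1)%R ->
  ex_series (fun n => INR (S n) * x ^ n)%R /\
  ex_series (fun n => INR (S n) * INR (S (S n)) * x ^ n)%R.
Proof.
  intros Hx.
  assert (HC : Rbar_lt (Rabs x) (CV_radius (fun _ => 1%R))).
  { apply Rbar_lt_le_trans with (Finite 1).
    - simpl. rewrite Rabs_pos_eq; lra.
    - apply (proj1 (CV_radius_bounded (fun _ => 1%R))). exists 1%R. intros n.
      rewrite pow1, Rmult_1_l, Rabs_R1. lra. }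
  split.
  - rewrite <- CV_radius_derive in HC.
    apply CV_radius_inside in HC. apply ex_pseries_R in HC.
    eapply ex_series_ext; [|exact HC]. intros n. unfold PS_derive.
    now rewrite Rmult_1_r.
  - rewrite <- CV_radius_derive, <- CV_radius_derive in HC.
    apply CV_radius_inside in HC. apply ex_pseries_R in HC.
    eapply ex_series_ext; [|exact HC]. intros n. unfold PS_derive.
    now rewrite Rmult_1_r.
Qed.

Lemma pderiv_convergent (rho : R) (a : nat -> C) :
  convergent_on rho a -> convergent_on rho (pderiv a).
Proof.
  intros Ha z Hz. pose proof (Cmod_ge_0 z) as Hz0.
  set (R0 := ((Cmod z + rho) / 2)%R).
  destruct (convergent_coef_bound rho R0 a Ha) as [K HK]; [unfold R0; lra|].
  assert (HKp := coef_bound_pos _ _ _ (coef_bound_shift _ _ _ HK)).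
  destruct (coef_bound_shift _ _ _ HK) as [HR HB].
  assert (Hx : (0 <= Cmod z / R0 < 1)%R).
  { split; [apply Rdiv_le_0_compat; lra|].
    apply Rmult_lt_reg_r with R0; [lra|]. unfold Rdiv. rewrite Rmult_assoc, Rinv_l by lra.
    unfold R0; lra. }
  destruct (proj1 (ex_series_quadratic_geom _ Hx)) as [sg HS].
  destruct (Cseries_dominated (fun n => pderiv a n * z ^ n)
     (fun n => ((K / R0) * (INR (S n) * (Cmod z / R0) ^ n))%R) ((K / R0) * sg)) as [l [Hl _]].
  - intros n. unfold pderiv. rewrite !Cmod_mult, Cmod_pow, Cmod_R.
    rewrite Rabs_pos_eq by apply pos_INR.
    specialize (HB n). assert (Hp : (0 < R0 ^ n)%R) by now apply pow_lt.
    unfold Rdiv at 2. rewrite Rpow_mult_distr, pow_inv.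
    replace (INR (S n) * Cmod (a (S n)) * Cmod z ^ n)%R
      with ((Cmod (a (S n)) * R0 ^ n)
            * (INR (S n) * (Cmod z ^ n * / R0 ^ n)))%R by (field; lra).
    apply Rmult_le_compat_r; [|exact HB].
    apply Rmult_le_pos; [apply pos_INR|].
    apply Rmult_le_pos; [now apply pow_le|]. left. now apply Rinv_0_lt_compat.
  - now apply (@is_series_scal R_AbsRing R_NormedModule).
  - exists l. now apply is_Cpseries_series.
Qed.

(** Induction on [w^(n+1) - z^(n+1) - (n+1) z^n h
    = w (w^n - z^n - n z^(n-1) h) + n z^(n-1) h^2], where [h = w - z]. *)
Lemma Cpow_second_order (z w : C) (r : R) (n : nat) :
  (Cmod z <= r)%R -> (Cmod w <= r)%R ->
  (Cmod (w ^ S (S n) - z ^ S (S n) - RtoC (INR (S (S n))) * z ^ S n * (w - z))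
   <= INR (S n) * INR (S (S n)) * r ^ n * (Cmod (w - z) * Cmod (w - z)))%R.
Proof.
  intros Hz Hw. pose proof (Cmod_ge_0 z) as Hz0. pose proof (Cmod_ge_0 (w - z)) as Hh.
  induction n as [|n IH].
  - replace (w ^ 2 - z ^ 2 - RtoC (INR 2) * z ^ 1 * (w - z)) with ((w - z) * (w - z)).
    2:{ simpl. replace (RtoC (1 + 1)) with (1 + 1) by now rewrite RtoC_plus. ring. }
    rewrite Cmod_mult. simpl. nra.
  - set (h := w - z) in *.
    replace (w ^ S (S (S n)) - z ^ S (S (S n)) - RtoC (INR (S (S (S n)))) * z ^ S (S n) * h)
      with (w * (w ^ S (S n) - z ^ S (S n) - RtoC (INR (S (S n))) * z ^ S n * h)
            + RtoC (INR (S (S n))) * z ^ S n * (h * h)).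
    2:{ rewrite (S_INR (S (S n))), RtoC_plus. unfold h. simpl Cpow. ring. }
    eapply Rle_trans; [apply Cmod_triangle|].
    rewrite !Cmod_mult, Cmod_pow, Cmod_R, (Rabs_pos_eq (INR _)) by apply pos_INR.
    apply Rle_trans with (r * (INR (S n) * INR (S (S n)) * r ^ n * (Cmod h * Cmod h))
                          + INR (S (S n)) * r ^ S n * (Cmod h * Cmod h))%R.
    + apply Rplus_le_compat.
      * apply Rmult_le_compat; auto using Cmod_ge_0.
      * apply Rmult_le_compat_r; [nra|]. apply Rmult_le_compat_l; [apply pos_INR|].
        now apply pow_incr.
    + assert (Hr : (0 <= r ^ S n)%R) by (apply pow_le; lra).
      rewrite (S_INR (S (S n))).
      pose proof (pos_INR (S (S n))) as Hi. rewrite (S_INR (S n)) in *. simpl pow in *.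
      assert (0 <= Cmod h * Cmod h)%R by nra.
      set (x := (r * r ^ n * (Cmod h * Cmod h))%R).
      assert (0 <= x)%R by (unfold x; nra).
      replace (r * (INR (S n) * (INR (S n) + 1) * r ^ n * (Cmod h * Cmod h)) +
        (INR (S n) + 1) * (r * r ^ n) * (Cmod h * Cmod h))%R with
        (x * ((INR (S n) + 1) * (INR (S n) + 1)))%R by (unfold x; ring).
      replace ((INR (S n) + 1) * (INR (S n) + 1 + 1) * (r * r ^ n) * (Cmod h * Cmod h))%R
        with (x * ((INR (S n) + 1) * (INR (S n) + 1 + 1)))%R by (unfold x; ring).
      apply Rmult_le_compat_l; [assumption|]. nra.
Qed.

(** Termwise differentiation: inside radius [R0] the second-order remainders
    of the monomials are dominated by [sum n^2 x^n |h|^2]. *)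
Theorem psum_derive (rho : R) (a : nat -> C) (z : C) :
  convergent_on rho a -> (Cmod z < rho)%R ->
  is_Cderive (psum a) z (psum (pderiv a) z).
Proof.
  intros Ha Hz. pose proof (Cmod_ge_0 z) as Hz0.
  set (r := ((2 * Cmod z + rho) / 3)%R). set (R0 := ((Cmod z + 2 * rho) / 3)%R).
  assert (Hr : (Cmod z < r < R0)%R) by (unfold r, R0; lra).
  destruct (convergent_coef_bound rho R0 a Ha) as [K HK]; [unfold R0; lra|].
  assert (HKp := coef_bound_pos _ _ _ (coef_bound_shift _ _ _ (coef_bound_shift _ _ _ HK))).
  destruct (coef_bound_shift _ _ _ (coef_bound_shift _ _ _ HK)) as [HR HB].
  set (M := (K / R0 / R0)%R) in *.
  assert (Hx : (0 <= r / R0 < 1)%R).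
  { split; [apply Rdiv_le_0_compat; lra|].
    apply Rmult_lt_reg_r with R0; [lra|]. unfold Rdiv. rewrite Rmult_assoc, Rinv_l; lra. }
  destruct (proj2 (ex_series_quadratic_geom _ Hx)) as [sg HS].
  assert (Main : forall w, (Cmod w < r)%R ->
    (Cmod (psum a w - psum a z - psum (pderiv a) z * (w - z))
     <= M * sg * (Cmod (w - z) * Cmod (w - z)))%R).
  { intros w Hw.
    assert (Cw : is_Cpseries a w (psum a w)).
    { apply (psum_correct rho); [exact Ha|]. unfold R0 in Hr; lra. }
    assert (Cz := psum_correct rho a z Ha Hz).
    assert (Cd := psum_correct rho _ z (pderiv_convergent _ _ Ha) Hz).
    apply is_Cpseries_series in Cw, Cz, Cd.
    set (v := fun n : nat => match n with O => RtoC 0 | S m => pderiv a m * z ^ m * (w - z) end).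
    set (u := fun n => a n * (w ^ n - z ^ n) - v n).
    assert (Hu : is_Cseries u (psum a w - psum a z - psum (pderiv a) z * (w - z))).
    { assert (Cd' : is_Cseries v (v 0%nat + (w - z) * psum (pderiv a) z)).
      { apply (Cseries_cons v).
        eapply Cseries_ext; [|exact (Cseries_scal (w - z) _ _ Cd)].
        intros n. apply Cmult_comm. }
      assert (Q := Cseries_minus _ _ _ _ (Cseries_minus _ _ _ _ Cw Cz) Cd').
      replace (psum a w - psum a z - psum (pderiv a) z * (w - z))
        with (psum a w - psum a z - (v 0%nat + (w - z) * psum (pderiv a) z)) by (simpl; ring).
      eapply Cseries_ext; [|exact Q].
      intros n. unfold u. ring. }
    assert (Hu2 : is_Cseries (fun n => u (S (S n)))
               (psum a w - psum a z - psum (pderiv a) z * (w - z))).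
    { assert (Q := Cseries_tail _ _ (Cseries_tail _ _ Hu)). cbv beta in Q.
      replace (psum a w - psum a z - psum (pderiv a) z * (w - z))
        with (psum a w - psum a z - psum (pderiv a) z * (w - z) - u 0%nat - u 1%nat); [exact Q|].
      unfold u, v, pderiv. simpl. ring. }
    destruct (Cseries_dominated (fun n => u (S (S n)))
       (fun n => (M * (Cmod (w - z) * Cmod (w - z))
                 * (INR (S n) * INR (S (S n)) * (r / R0) ^ n))%R)
       (M * (Cmod (w - z) * Cmod (w - z)) * sg)) as [l [Hl Bl]].
    - intros n.
      replace (u (S (S n))) with
        (a (S (S n)) *
         (w ^ S (S n) - z ^ S (S n)
          - RtoC (INR (S (S n))) * z ^ S n * (w - z)))
        by (unfold u, v, pderiv; ring).
      rewrite Cmod_mult.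
      eapply Rle_trans; [apply Rmult_le_compat_l; [apply Cmod_ge_0|];
        apply (Cpow_second_order z w r); lra|].
      specialize (HB n). assert (Hp : (0 < R0 ^ n)%R) by now apply pow_lt.
      unfold Rdiv. rewrite Rpow_mult_distr, pow_inv.
      set (T := (INR (S n) * INR (S (S n)))%R).
      assert (HT : (0 <= T)%R) by (apply Rmult_le_pos; apply pos_INR).
      set (h := (Cmod (w - z) * Cmod (w - z))%R).
      assert (Hh : (0 <= h)%R) by apply Rle_0_sqr.
      replace (Cmod (a (S (S n))) * (T * r ^ n * h))%R
        with ((Cmod (a (S (S n))) * R0 ^ n) * (h * (T * (r ^ n * / R0 ^ n))))%R
        by (field; lra).
      rewrite (Rmult_assoc M).
      apply Rmult_le_compat_r; [|exact HB].
      apply Rmult_le_pos; [exact Hh|]. apply Rmult_le_pos; [exact HT|].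
      apply Rmult_le_pos; [apply pow_le; lra|].
      left. now apply Rinv_0_lt_compat.
    - now apply (@is_series_scal R_AbsRing R_NormedModule).
    - rewrite (Cseries_unique _ _ _ Hu2 Hl). lra. }
  assert (HMS : (0 <= M * sg)%R).
  { apply Rmult_le_pos; [assumption|].
    apply Rle_trans with (sum_n (fun _ => 0%R) 0); [rewrite sum_O; apply Rle_refl|].
    rewrite <- (is_series_unique _ _ HS).
    apply Rle_trans with (Series (fun _ => 0%R * 0)%R).
    - rewrite Series_scal_l, sum_O. lra.
    - apply Series_le; [|eexists; exact HS]. intros n. split; [lra|].
      rewrite Rmult_0_l. repeat apply Rmult_le_pos; try apply pos_INR. apply pow_le. lra. }
  apply is_Cderive_eps. intros eps He.
  exists (Rmin (r - Cmod z) (eps / (M * sg + 1)))%R. split.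
  { apply Rmin_glb_lt; [lra|]. apply Rdiv_lt_0_compat; lra. }
  intros w Hw.
  assert (Hw1 := Rlt_le_trans _ _ _ Hw (Rmin_l _ _)).
  assert (Hw2 := Rlt_le_trans _ _ _ Hw (Rmin_r _ _)).
  pose proof (Cmod_triangle_rev w z).
  eapply Rle_trans; [apply Main; lra|].
  rewrite <- Rmult_assoc. apply Rmult_le_compat_r; [apply Cmod_ge_0|].
  apply (Rmult_lt_compat_r (M * sg + 1)) in Hw2; [|lra].
  unfold Rdiv in Hw2. rewrite Rmult_assoc, Rinv_l, Rmult_1_r in Hw2 by lra.
  pose proof (Cmod_ge_0 (w - z)). lra.
Qed.

Lemma psum_continuous (rho : R) (a : nat -> C) (z : C) :
  convergent_on rho a -> (Cmod z < rho)%R -> Ccontinuous (psum a) z.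
Proof. intros Ha Hz. eapply is_Cderive_continuous, psum_derive; eauto. Qed.

(** * Means over a period and the Cauchy transform *)

Definition rmean (g : R -> R) : R := (RInt g 0 (2 * PI) / (2 * PI))%R.

Definition cmean (phi : R -> C) : C :=
  (rmean (fun t => Re (phi t)), rmean (fun t => Im (phi t))).

Definition Rcont (g : R -> R) : Prop :=
  forall t : R, @continuous R_UniformSpace R_UniformSpace g t.
Definition Ccont (phi : R -> C) : Prop :=
  forall t : R, @continuous R_UniformSpace C_UniformSpace phi t.

Lemma Ccont_components phi :
  Ccont phi <-> Rcont (fun t => Re (phi t)) /\ Rcont (fun t => Im (phi t)).
Proof.
  split.
  - intros H. split; intros t; apply (proj1 (continuous_C_components phi t) (H t)).
  - intros [H1 H2] t. apply continuous_C_components. now split.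
Qed.

Lemma Ccont_mult phi psi : Ccont phi -> Ccont psi -> Ccont (fun t => phi t * psi t).
Proof. intros H1 H2 t. now apply continuous_Cmult. Qed.
Lemma Ccont_plus phi psi : Ccont phi -> Ccont psi -> Ccont (fun t => phi t + psi t).
Proof. intros H1 H2 t. now apply continuous_Cplus. Qed.
Lemma Ccont_const c : Ccont (fun _ => c).
Proof. intros t. apply continuous_Cconst. Qed.
Lemma Ccont_pow phi n : Ccont phi -> Ccont (fun t => phi t ^ n).
Proof. intros H t. now apply continuous_Cpow. Qed.

Lemma two_PI_pos : (0 < 2 * PI)%R.
Proof. pose proof PI_RGT_0. lra. Qed.

Lemma Rcont_ex_RInt g : Rcont g -> ex_RInt g 0 (2 * PI).
Proof. intros H. apply (@ex_RInt_continuous R_CompleteNormedModule). intros z _. apply H. Qed.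

Lemma rmean_plus g h : Rcont g -> Rcont h ->
  rmean (fun t => g t + h t)%R = (rmean g + rmean h)%R.
Proof.
  intros Hg Hh. unfold rmean.
  rewrite (RInt_plus g h) by now apply Rcont_ex_RInt.
  change plus with Rplus. field. pose proof two_PI_pos; lra.
Qed.

Lemma rmean_scal c g : Rcont g -> rmean (fun t => c * g t)%R = (c * rmean g)%R.
Proof.
  intros Hg. unfold rmean.
  rewrite (RInt_scal g _ _ c) by now apply Rcont_ex_RInt.
  change scal with Rmult. field. pose proof two_PI_pos; lra.
Qed.

Lemma rmean_ext g h : (forall t, g t = h t) -> rmean g = rmean h.
Proof. intros H. f_equal. now apply functional_extensionality. Qed.

Lemma rmean_const c : rmean (fun _ => c) = c.
Proof.
  unfold rmean. rewrite RInt_const. change scal with Rmult. field.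
  pose proof two_PI_pos; lra.
Qed.

Lemma rmean_le g h : Rcont g -> Rcont h ->
  (forall t, (0 <= t <= 2 * PI)%R -> (g t <= h t)%R) -> (rmean g <= rmean h)%R.
Proof.
  intros Hg Hh H. unfold rmean. pose proof two_PI_pos.
  apply Rmult_le_compat_r; [left; now apply Rinv_0_lt_compat|].
  apply RInt_le; [lra| | |]; try now apply Rcont_ex_RInt.
  intros t Ht. apply H. lra.
Qed.

Lemma Rcont_mult g h : Rcont g -> Rcont h -> Rcont (fun t => g t * h t)%R.
Proof. intros H1 H2 t. now apply continuous_Rmult. Qed.
Lemma Rcont_const c : Rcont (fun _ => c).
Proof. intros t. apply (@continuous_const R_UniformSpace R_UniformSpace). Qed.

Lemma cmean_ext phi psi : (forall t, phi t = psi t) -> cmean phi = cmean psi.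
Proof. intros H. f_equal. now apply functional_extensionality. Qed.

Lemma cmean_plus phi psi : Ccont phi -> Ccont psi ->
  cmean (fun t => phi t + psi t) = cmean phi + cmean psi.
Proof.
  rewrite !Ccont_components. intros [H1 H2] [H3 H4].
  apply C_eq; simpl; now rewrite <- rmean_plus.
Qed.

Lemma cmean_scal c phi : Ccont phi -> cmean (fun t => c * phi t) = c * cmean phi.
Proof.
  rewrite !Ccont_components. intros [H1 H2]. apply C_eq; simpl.
  - replace (fst c * rmean (fun t => Re (phi t)) - snd c * rmean (fun t => Im (phi t)))%R
      with (rmean (fun t => fst c * Re (phi t))%R + rmean (fun t => (- snd c) * Im (phi t))%R)%R
      by (rewrite !rmean_scal by assumption; ring).
    rewrite <- rmean_plus by (apply Rcont_mult; [apply Rcont_const|assumption]).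
    apply rmean_ext. intros t. unfold Re, Im; simpl. ring.
  - replace (fst c * rmean (fun t => Im (phi t)) + snd c * rmean (fun t => Re (phi t)))%R
      with (rmean (fun t => fst c * Im (phi t))%R + rmean (fun t => snd c * Re (phi t))%R)%R
      by (rewrite !rmean_scal by assumption; ring).
    rewrite <- rmean_plus by (apply Rcont_mult; [apply Rcont_const|assumption]).
    apply rmean_ext. intros t. unfold Re, Im; simpl. ring.
Qed.

Lemma cmean_const c : cmean (fun _ => c) = c.
Proof. apply C_eq; simpl; apply rmean_const. Qed.

(** Rotating the mean to the positive axis reduces the bound to real parts. *)
Lemma cmean_bound phi M : Ccont phi ->
  (forall t, (0 <= t <= 2 * PI)%R -> (Cmod (phi t) <= M)%R) -> (Cmod (cmean phi) <= M)%R.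
Proof.
  intros Hc HM.
  set (m := cmean phi).
  destruct (Req_dec (Cmod m) 0) as [E|Hnz].
  { rewrite E. pose proof two_PI_pos. specialize (HM 0%R ltac:(lra)).
    pose proof (Cmod_ge_0 (phi 0%R)). lra. }
  pose proof (Cmod_ge_0 m) as Hp.
  assert (Hcc : Ccont (fun t => Cconj m * phi t))
    by (apply Ccont_mult; [apply Ccont_const|exact Hc]).
  assert (E : Re (cmean (fun t => Cconj m * phi t)) = (Cmod m * Cmod m)%R).
  { rewrite cmean_scal by assumption. fold m.
    rewrite Cmult_comm. pose proof (Cmod2_conj m) as Q.
    rewrite <- Q. simpl. ring. }
  assert (L : (Re (cmean (fun t => (Cconj m * phi t)%C)) <= rmean (fun _ => Cmod m * M))%R).
  { simpl. apply rmean_le.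
    - apply (proj1 (proj1 (Ccont_components _) Hcc)).
    - apply Rcont_const.
    - intros t Ht. change (Re (Cconj m * phi t) <= Cmod m * M)%R.
      eapply Rle_trans; [apply Rle_abs|]. eapply Rle_trans; [apply re_le_Cmod|].
      rewrite Cmod_mult, Cmod_conj. apply Rmult_le_compat_l; [assumption|now apply HM]. }
  rewrite rmean_const, E in L. apply Rmult_le_reg_l with (Cmod m); lra.
Qed.

(** Componentwise, so that derivatives and integrals of real functions apply
    directly. *)
Definition is_Rderive (gamma : R -> C) (t : R) (v : C) : Prop :=
  is_derive (fun s => Re (gamma s)) t (Re v) /\
  is_derive (fun s => Im (gamma s)) t (Im v).

Lemma is_Rderive_eps gamma t v :
  is_Rderive gamma t v ->
  forall eps : R, (0 < eps)%R -> exists d : R, (0 < d)%R /\ forall s, (Rabs (s - t) < d)%R ->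
    (Cmod (gamma s - gamma t - v * RtoC (s - t)) <= eps * Rabs (s - t))%R.
Proof.
  intros [[_ H1] [_ H2]] eps He.
  assert (He2 : (0 < eps / 2)%R) by lra.
  destruct (H1 t (fun P HP => HP) (mkposreal _ He2)) as [d1 D1].
  destruct (H2 t (fun P HP => HP) (mkposreal _ He2)) as [d2 D2].
  exists (Rmin d1 d2). split; [apply Rmin_glb_lt; apply cond_pos|].
  intros s Hs.
  specialize (D1 s (Rlt_le_trans _ _ _ Hs (Rmin_l _ _))).
  specialize (D2 s (Rlt_le_trans _ _ _ Hs (Rmin_r _ _))).
  change (Rabs (Re (gamma s) - Re (gamma t) - (s - t) * Re v) <= eps / 2 * Rabs (s - t))%R in D1.
  change (Rabs (Im (gamma s) - Im (gamma t) - (s - t) * Im v) <= eps / 2 * Rabs (s - t))%R in D2.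
  eapply Rle_trans; [apply Cmod_le_Re_Im|].
  replace (Re (gamma s - gamma t - v * RtoC (s - t)))
    with (Re (gamma s) - Re (gamma t) - (s - t) * Re v)%R by (unfold Re, Im; simpl; ring).
  replace (Im (gamma s - gamma t - v * RtoC (s - t)))
    with (Im (gamma s) - Im (gamma t) - (s - t) * Im v)%R by (unfold Re, Im; simpl; ring).
  lra.
Qed.

Lemma eps_is_Rderive gamma t v :
  (forall eps : R, (0 < eps)%R -> exists d : R, (0 < d)%R /\ forall s, (Rabs (s - t) < d)%R ->
    (Cmod (gamma s - gamma t - v * RtoC (s - t)) <= eps * Rabs (s - t))%R) ->
  is_Rderive gamma t v.
Proof.
  intros H.
  assert (G : forall (P : C -> R) ,
     (forall c, (Rabs (P c) <= Cmod c)%R) ->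
     (forall a b c r, P (a - b - c * RtoC r) = (P a - P b - r * P c)%R) ->
     is_derive (fun s => P (gamma s)) t (P v)).
  { intros P HP HL. split; [apply is_linear_scal_l|].
    intros x Hx eps.
    apply (@is_filter_lim_locally_unique R_AbsRing (AbsRing_NormedModule R_AbsRing)) in Hx. subst x.
    destruct (H eps (cond_pos eps)) as [d [Hd D]].
    exists (mkposreal d Hd). intros s Hs. specialize (D s Hs).
    change (Rabs (P (gamma s) - P (gamma t) - (s - t) * P v) <= eps * Rabs (s - t))%R.
    rewrite <- HL. eapply Rle_trans; [apply HP|exact D]. }
  split.
  - apply G; [apply re_le_Cmod|]. intros. unfold Re, Im; simpl; ring.
  - apply G; [apply im_le_Cmod|]. intros. unfold Re, Im; simpl; ring.
Qed.

Lemma is_Rderive_continuous gamma t v :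
  is_Rderive gamma t v -> @continuous R_UniformSpace C_UniformSpace gamma t.
Proof.
  intros [H1 H2]. apply continuous_C_components. split;
  eapply (@ex_derive_continuous R_AbsRing R_NormedModule); eexists; eassumption.
Qed.

Lemma is_Rderive_chain (f : C -> C) gamma t l v :
  is_Cderive f (gamma t) l -> is_Rderive gamma t v ->
  is_Rderive (fun s => f (gamma s)) t (l * v).
Proof.
  intros Hf Hg.
  assert (Cg := is_Rderive_continuous _ _ _ Hg).
  apply eps_is_Rderive. rewrite is_Cderive_eps in Hf.
  assert (Hg' := is_Rderive_eps _ _ _ Hg). clear Hg.
  intros eps He.
  pose proof (Cmod_ge_0 l) as L0. pose proof (Cmod_ge_0 v) as M0.
  set (e := (eps / (Cmod l + Cmod v + 2))%R).
  assert (He' : (0 < e)%R) by (apply Rdiv_lt_0_compat; lra).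
  assert (Ee : (e * (Cmod l + Cmod v + 2) = eps)%R) by (unfold e; field; lra).
  destruct (Hf e He') as [d1 [D1 W1]].
  destruct (Hg' (Rmin 1 e)) as [d2 [D2 W2]]; [apply Rmin_glb_lt; lra|].
  destruct (proj1 (continuous_C_eps gamma t) Cg d1 D1) as [d3 W3].
  exists (Rmin d2 d3). split; [apply Rmin_glb_lt; [lra|apply cond_pos]|].
  intros s Hs.
  specialize (W3 s (Rlt_le_trans _ _ _ Hs (Rmin_r _ _))).
  specialize (W2 s (Rlt_le_trans _ _ _ Hs (Rmin_l _ _))).
  specialize (W1 _ W3).
  pose proof (Rmin_l 1 e). pose proof (Rmin_r 1 e).
  set (h := RtoC (s - t)) in *.
  assert (Eh : Rabs (s - t) = Cmod h) by (unfold h; now rewrite Cmod_R).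
  rewrite Eh in *.
  replace (f (gamma s) - f (gamma t) - l * v * h)
    with ((f (gamma s) - f (gamma t) - l * (gamma s - gamma t))
          + l * (gamma s - gamma t - v * h)) by ring.
  pose proof (Cmod_ge_0 h) as Hh0.
  assert (T : (Cmod (gamma s - gamma t) <= (Cmod v + 1) * Cmod h)%R).
  { replace (gamma s - gamma t) with ((gamma s - gamma t - v * h) + v * h) by ring.
    eapply Rle_trans; [apply Cmod_triangle|]. rewrite Cmod_mult. nra. }
  eapply Rle_trans; [apply Cmod_triangle|]. rewrite Cmod_mult.
  assert (Q1 : (Cmod (f (gamma s) - f (gamma t) - l * (gamma s - gamma t))
                <= e * ((Cmod v + 1) * Cmod h))%R) by nra.
  assert (Q2 : (Cmod l * Cmod (gamma s - gamma t - v * h) <= Cmod l * (e * Cmod h))%R).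
  { apply Rmult_le_compat_l; [assumption|]. nra. }
  rewrite <- Ee. nra.
Qed.

Lemma is_Rderive_ext (gamma delta : R -> C) t v :
  (forall s, gamma s = delta s) -> is_Rderive gamma t v -> is_Rderive delta t v.
Proof. intros E. now rewrite (functional_extensionality _ _ E). Qed.

Lemma is_Rderive_RtoC (t : R) : is_Rderive RtoC t 1.
Proof.
  split; simpl.
  - apply (@is_derive_id R_AbsRing).
  - apply (@is_derive_const R_AbsRing R_NormedModule).
Qed.

Lemma is_Rderive_affine (c d : C) (gamma : R -> C) t v :
  is_Rderive gamma t v -> is_Rderive (fun s => c + d * gamma s) t (d * v).
Proof.
  intros H. apply (is_Rderive_chain (fun w => c + d * w)); [|exact H].
  eapply is_Cderive_value.
  - apply is_Cderive_plus; [apply is_Cderive_const|].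
    apply is_Cderive_mult; [apply is_Cderive_const | apply is_Cderive_id].
  - simpl. ring.
Qed.

Lemma is_Rderive_mult gamma delta t v w :
  is_Rderive gamma t v -> is_Rderive delta t w ->
  is_Rderive (fun s => gamma s * delta s) t (v * delta t + gamma t * w).
Proof.
  intros [G1 G2] [D1 D2]. split.
  - evar_last.
    + apply (@is_derive_minus R_AbsRing R_NormedModule);
        (apply (@is_derive_mult R_AbsRing); [eassumption|eassumption|exact Rmult_comm]).
    + unfold minus, plus, opp, mult, Re, Im; simpl. unfold Re, Im. ring.
  - evar_last.
    + apply (@is_derive_plus R_AbsRing R_NormedModule);
        (apply (@is_derive_mult R_AbsRing); [eassumption|eassumption|exact Rmult_comm]).
    + unfold minus, plus, opp, mult, Re, Im; simpl. unfold Re, Im. ring.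
Qed.

(** The fundamental theorem of calculus over one period. *)
Lemma cmean_derive gamma phi :
  (forall t, is_Rderive gamma t (phi t)) -> Ccont phi -> gamma (2 * PI)%R = gamma 0%R ->
  cmean phi = 0.
Proof.
  intros H Hc Hp. apply Ccont_components in Hc. destruct Hc as [C1 C2].
  unfold cmean, rmean.
  assert (E1 := is_RInt_unique _ _ _ _ (@is_RInt_derive R_CompleteNormedModule _ _ 0 (2 * PI)
     (fun x _ => proj1 (H x)) (fun x _ => C1 x))).
  assert (E2 := is_RInt_unique _ _ _ _ (@is_RInt_derive R_CompleteNormedModule _ _ 0 (2 * PI)
     (fun x _ => proj2 (H x)) (fun x _ => C2 x))).
  rewrite E1, E2, Hp, !minus_eq_zero.
  apply C_eq; simpl; change (@zero R_CompleteNormedModule) with 0%R;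
    unfold zero; simpl; unfold Rdiv; ring.
Qed.

Definition expi (t : R) : C := (cos t, sin t).

Lemma expi_derive t : is_Rderive expi t (Ci * expi t).
Proof.
  split; simpl.
  - replace (0 * cos t - 1 * sin t)%R with (- sin t)%R by ring. apply is_derive_cos.
  - replace (0 * sin t + 1 * cos t)%R with (cos t) by ring. apply is_derive_sin.
Qed.

Lemma expi_conj_derive t : is_Rderive (fun s => Cconj (expi s)) t (- Ci * Cconj (expi t)).
Proof.
  split; simpl.
  - replace (- 0 * cos t - - (1) * - sin t)%R with (- sin t)%R by ring. apply is_derive_cos.
  - replace (- 0 * - sin t + - (1) * cos t)%R with (- cos t)%R by ring.
    apply (@is_derive_opp R_AbsRing R_NormedModule). apply is_derive_sin.
Qed.

Lemma expi_conj_mult t : expi t * Cconj (expi t) = 1.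
Proof.
  apply C_eq; unfold Re, Im; simpl; [|ring].
  pose proof (sin2_cos2 t) as H. unfold Rsqr in H. lra.
Qed.

Lemma Cmod_expi t : Cmod (expi t) = 1%R.
Proof.
  unfold Cmod, expi; simpl. pose proof (sin2_cos2 t) as H. unfold Rsqr in H.
  replace (cos t * (cos t * 1) + sin t * (sin t * 1))%R with 1%R by lra. apply sqrt_1.
Qed.

Lemma expi_nz t : expi t <> 0.
Proof. apply Cmod_gt_0. rewrite Cmod_expi. lra. Qed.

Lemma expi_conj_inv t : Cconj (expi t) = / expi t.
Proof.
  pose proof (expi_nz t). pose proof (expi_conj_mult t) as E.
  replace (Cconj (expi t)) with (expi t * Cconj (expi t) * / expi t) by (field; assumption).
  rewrite E. ring.
Qed.

Lemma expi_period : expi (2 * PI) = expi 0.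
Proof. unfold expi. now rewrite cos_2PI, sin_2PI, cos_0, sin_0. Qed.

Lemma Ccont_expi : Ccont expi.
Proof. intros t. eapply is_Rderive_continuous, expi_derive. Qed.

Lemma Ccont_expi_conj : Ccont (fun t => Cconj (expi t)).
Proof. intros t. eapply is_Rderive_continuous, expi_conj_derive. Qed.

Lemma is_Rderive_pow_exponential (c : C) gamma n t :
  is_Rderive gamma t (c * gamma t) ->
  is_Rderive (fun s => gamma s ^ n) t (RtoC (INR n) * c * gamma t ^ n).
Proof.
  intros H. induction n as [|n IH].
  - simpl. replace (0 * c * 1) with (RtoC 0) by ring. split;
    apply (@is_derive_const R_AbsRing R_NormedModule).
  - rewrite S_INR, RtoC_plus. simpl Cpow.
    replace ((INR n + 1) * c * (gamma t * gamma t ^ n))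
      with (c * gamma t * gamma t ^ n + gamma t * (INR n * c * gamma t ^ n)) by ring.
    now apply is_Rderive_mult.
Qed.

(** Nonconstant harmonics have mean zero: [gamma ^ n] is a multiple of its own
    derivative. *)
Lemma cmean_pow_exponential (c : C) gamma n :
  c <> 0 -> (forall t, is_Rderive gamma t (c * gamma t)) ->
  gamma (2 * PI)%R = gamma 0%R -> cmean (fun t => gamma t ^ S n) = 0.
Proof.
  intros Hc H Hp.
  assert (Hn : RtoC (INR (S n)) <> 0).
  { intros E. apply RtoC_inj in E. rewrite S_INR in E. pose proof (pos_INR n). lra. }
  assert (Cg : Ccont gamma) by (intros t; eapply is_Rderive_continuous, H).
  assert (Hk : RtoC (INR (S n)) * c <> 0) by now apply Cmult_neq_0.
  assert (E : cmean (fun t => RtoC (INR (S n)) * c * gamma t ^ S n) = 0).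
  { apply cmean_derive with (gamma := fun t => gamma t ^ S n).
    - intros t. now apply is_Rderive_pow_exponential.
    - apply Ccont_mult; [apply Ccont_const|now apply Ccont_pow].
    - now rewrite Hp. }
  rewrite cmean_scal in E by now apply Ccont_pow.
  set (k := RtoC (INR (S n)) * c) in *.
  replace (cmean (fun t => gamma t ^ S n)) with (/ k * (k * cmean (fun t => gamma t ^ S n)))
    by (field; exact Hk).
  rewrite E. ring.
Qed.

Lemma cmean_sum_n (phi : nat -> R -> C) n :
  (forall k, Ccont (phi k)) ->
  Ccont (fun t => sum_n (G := C_AbelianMonoid) (fun k => phi k t) n) /\
  cmean (fun t => sum_n (G := C_AbelianMonoid) (fun k => phi k t) n)
  = sum_n (G := C_AbelianMonoid) (fun k => cmean (phi k)) n.
Proof.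
  intros H. induction n as [|n [IH1 IH2]].
  - rewrite sum_O. replace (fun t => sum_n (fun k => phi k t) 0) with (phi 0%nat); [now split|].
    apply functional_extensionality. intros t. now rewrite sum_O.
  - assert (E : (fun t => sum_n (G := C_AbelianMonoid) (fun k => phi k t) (S n))
            = (fun t => sum_n (G := C_AbelianMonoid) (fun k => phi k t) n + phi (S n) t)).
    { apply functional_extensionality. intros t. now rewrite sum_Sn. }
    rewrite E, sum_Sn. split; [now apply Ccont_plus|].
    rewrite cmean_plus by auto. now rewrite IH2.
Qed.

Lemma Ccont_bounded phi : Ccont phi ->
  exists B, (0 <= B)%R /\ forall t, (0 <= t <= 2 * PI)%R -> (Cmod (phi t) <= B)%R.
Proof.
  intros H. pose proof two_PI_pos.
  destruct (continuity_ab_maj (fun t => Cmod (phi t)) 0 (2 * PI)) as [t0 [Ht0 _]]; [lra| |].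
  - intros t _. apply continuity_pt_filterlim.
    change (@continuous R_UniformSpace R_UniformSpace (fun t => Cmod (phi t)) t).
    apply (proj2 (filterlim_locally _ _)). intros eps.
    generalize (proj1 (continuous_C_eps phi t) (H t) eps (cond_pos eps)).
    apply filter_imp. intros s Hs.
    change (Rabs (Cmod (phi s) - Cmod (phi t)) < eps)%R.
    apply Rabs_def1.
    + pose proof (Cmod_triangle_rev (phi s) (phi t)). lra.
    + pose proof (Cmod_triangle_rev (phi t) (phi s)). rewrite Cmod_sym in H1. lra.
  - exists (Cmod (phi t0)). split; [apply Cmod_ge_0|]. exact Ht0.
Qed.

Definition circle (R0 t : R) : C := R0 * expi t.

Section CauchyTransform.
Variables (R0 : R) (z : C).
Hypotheses (HR0 : (0 < R0)%R) (Hz : (Cmod z < R0)%R).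

Local Notation zeta := (circle R0).

Lemma circle_Cmod t : Cmod (zeta t) = R0.
Proof. unfold circle. rewrite Cmod_mult, Cmod_expi, Cmod_R, Rabs_pos_eq; lra. Qed.

Lemma circle_nz t : zeta t <> 0.
Proof. apply Cmod_gt_0. now rewrite circle_Cmod. Qed.

Lemma circle_minus_nz t : zeta t - z <> 0.
Proof.
  apply Cmod_gt_0. pose proof (Cmod_triangle_rev (zeta t) z). rewrite circle_Cmod in H. lra.
Qed.

Lemma Ccont_circle : Ccont zeta.
Proof. apply Ccont_mult; [apply Ccont_const | apply Ccont_expi]. Qed.

Lemma Ccont_circle_inv : Ccont (fun t => / zeta t).
Proof. intros t. apply continuous_Cinv; [apply circle_nz | apply Ccont_circle]. Qed.

Lemma Ccont_kernel : Ccont (fun t => zeta t / (zeta t - z)).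
Proof.
  intros t. apply continuous_Cmult; [apply Ccont_circle|].
  apply continuous_Cinv; [apply circle_minus_nz|].
  apply continuous_Cminus; [apply Ccont_circle | apply continuous_Cconst].
Qed.

Lemma geometric_partial_sum t n :
  sum_n (G := C_AbelianMonoid) (fun k => (/ zeta t) ^ k * z ^ k) n
  = zeta t / (zeta t - z) - zeta t / (zeta t - z) * (z / zeta t) ^ S n.
Proof.
  pose proof (circle_nz t). pose proof (circle_minus_nz t).
  induction n as [|n IH].
  - rewrite sum_O. simpl. field. auto.
  - rewrite sum_Sn, IH. rewrite <- Cpow_mult_l.
    change plus with Cplus.
    replace (/ zeta t * z) with (z / zeta t) by (unfold Cdiv; ring).
    rewrite (Cpow_S _ (S n)).
    set (q := (z / zeta t) ^ S n).
    (* [field] recognizes equations in [C], not in its additive monoid *)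
    match goal with |- ?a = ?b => change (@eq C a b) end. field. auto.
Qed.

(** Expanding the kernel in a geometric series whose remainder decays
    uniformly on the circle. *)
Lemma cauchy_transform phi : Ccont phi ->
  is_Cpseries (fun n => cmean (fun t => phi t * (/ zeta t) ^ n)) z
    (cmean (fun t => phi t * (zeta t / (zeta t - z)))).
Proof.
  intros Hphi. apply is_Cpseries_series, is_Cseries_eps. intros eps He.
  assert (Hpk : Ccont (fun t => phi t * (zeta t / (zeta t - z))))
    by (apply Ccont_mult; [exact Hphi | apply Ccont_kernel]).
  destruct (Ccont_bounded _ Hpk) as [B [HB0 HB]].
  set (q := (Cmod z / R0)%R). pose proof (Cmod_ge_0 z) as Hz0.
  assert (Hq : (0 <= q < 1)%R).
  { unfold q. split; [apply Rdiv_le_0_compat; lra|].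
    apply Rmult_lt_reg_r with R0; [lra|]. unfold Rdiv. rewrite Rmult_assoc, Rinv_l; lra. }
  assert (Hlim : is_lim_seq (fun n => q ^ n)%R 0)
    by (apply is_lim_seq_geom; rewrite Rabs_pos_eq; lra).
  assert (He2 : (0 < eps / (B + 1))%R) by (apply Rdiv_lt_0_compat; lra).
  destruct (proj1 (filterlim_locally _ _) Hlim (mkposreal _ He2)) as [N HN].
  exists N. intros n Hn.
  set (rem := fun t => - z ^ S n * (phi t * (zeta t / (zeta t - z)) * (/ zeta t) ^ S n)).
  assert (Hi : Ccont (fun t => phi t * (zeta t / (zeta t - z)) * (/ zeta t) ^ S n)).
  { apply Ccont_mult; [exact Hpk|]. apply Ccont_pow, Ccont_circle_inv. }
  assert (Hrem : Ccont rem) by (apply Ccont_mult; [apply Ccont_const|exact Hi]).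
  assert (E : sum_n (G := C_AbelianMonoid)
                (fun k => cmean (fun t => phi t * (/ zeta t) ^ k) * z ^ k) n
              = cmean (fun t => phi t * (zeta t / (zeta t - z)) + rem t)).
  { rewrite (sum_n_ext _ (fun k => cmean (fun t => phi t * (/ zeta t) ^ k * z ^ k))).
    - rewrite <- (proj2 (cmean_sum_n (fun k t => phi t * (/ zeta t) ^ k * z ^ k) n
        ltac:(intros k; apply Ccont_mult;
              [apply Ccont_mult; [exact Hphi|apply Ccont_pow, Ccont_circle_inv]
              |apply Ccont_const]))).
      apply cmean_ext. intros t.
      rewrite (sum_n_ext _ (fun k => mult (K := C_Ring) (phi t) ((/ zeta t) ^ k * z ^ k)))
        by (intros k; change (phi t * (/ zeta t) ^ k * z ^ k = phi t * ((/ zeta t) ^ k * z ^ k)); ring).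
      rewrite (sum_n_mult_l (K := C_Ring)).
      change (phi t * sum_n (G := C_AbelianMonoid) (fun k => (/ zeta t) ^ k * z ^ k) n
              = phi t * (zeta t / (zeta t - z)) + rem t).
      rewrite geometric_partial_sum. unfold rem.
      replace ((z / zeta t) ^ S n) with (z ^ S n * (/ zeta t) ^ S n)
        by (unfold Cdiv; now rewrite Cpow_mult_l).
      ring.
    - intros k. rewrite (Cmult_comm (cmean _)), <- cmean_scal.
      + apply cmean_ext. intros t. ring.
      + apply Ccont_mult; [exact Hphi|]. apply Ccont_pow, Ccont_circle_inv. }
  rewrite E, cmean_plus by assumption.
  replace (_ + cmean rem - _) with (cmean rem) by ring.
  apply Rle_lt_trans with (B * q ^ S n)%R.
  - apply cmean_bound; [exact Hrem|]. intros t Ht. unfold rem.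
    rewrite (Cmod_mult (- _)), (Cmod_mult (_ * _) ((/ _) ^ _)), Cmod_opp, !Cmod_pow, Cmod_inv
      by apply circle_nz.
    rewrite circle_Cmod. unfold q, Rdiv. rewrite Rpow_mult_distr.
    rewrite (Rmult_comm (Cmod z ^ S n)), Rmult_assoc, (Rmult_comm (Cmod z ^ S n)).
    apply Rmult_le_compat_r; [|now apply HB].
    apply Rmult_le_pos; apply pow_le; [left; now apply Rinv_0_lt_compat | assumption].
  - specialize (HN (S n) ltac:(lia)).
    change (Rabs (q ^ S n - 0) < eps / (B + 1))%R in HN.
    rewrite Rminus_0_r, Rabs_pos_eq in HN by (apply pow_le; lra).
    apply (Rmult_lt_compat_r (B + 1)) in HN; [|lra].
    unfold Rdiv in HN. rewrite Rmult_assoc, Rinv_l, Rmult_1_r in HN by lra.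
    pose proof (pow_le q (S n) (proj1 Hq)). nra.
Qed.

Lemma kernel_mean : cmean (fun t => zeta t / (zeta t - z)) = 1.
Proof.
  set (u := fun n => cmean (fun t => 1 * (/ zeta t) ^ n) * z ^ n).
  assert (H : is_Cseries u (cmean (fun t => 1 * (zeta t / (zeta t - z))))).
  { apply is_Cpseries_series, (cauchy_transform (fun _ => 1)), Ccont_const. }
  rewrite (cmean_ext _ (fun t => 1 * (zeta t / (zeta t - z)))) by (intros t; ring).
  assert (U0 : u 0%nat = 1).
  { unfold u. rewrite (cmean_ext _ (fun _ => RtoC 1)) by (intros t; simpl; ring).
    rewrite cmean_const. simpl. ring. }
  assert (E : forall n, RtoC 0 = u (S n)).
  { intros n. unfold u. rewrite (cmean_ext _ (fun t => (/ R0) ^ S n * Cconj (expi t) ^ S n)).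
    - rewrite cmean_scal by (apply Ccont_pow, Ccont_expi_conj).
      rewrite (cmean_pow_exponential (- Ci)); [ring| | |].
      + intros E. apply Ci_nz. replace Ci with (- - Ci) by ring. rewrite E. ring.
      + intros t. apply expi_conj_derive.
      + now rewrite expi_period.
    - intros t. rewrite expi_conj_inv, <- Cpow_mult_l. unfold circle.
      rewrite Cmult_1_l. f_equal. field. split; [apply expi_nz|].
      intros E. apply RtoC_inj in E. lra. }
  assert (U : is_Cseries u (u 0%nat + 0)).
  { apply Cseries_cons. exact (Cseries_ext _ _ _ E Cseries_zero). }
  rewrite U0, Cplus_0_r in U. exact (Cseries_unique _ _ _ H U).
Qed.
End CauchyTransform.

(** * Cauchy's formula and power series expansions *)

Lemma rmean_param_derive (G D : R -> R -> R) (lo hi s : R) :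
  (lo < s < hi)%R ->
  (forall s', (lo < s' < hi)%R -> forall t, is_derive (fun u => G u t) s' (D s' t)) ->
  (forall s', (lo < s' < hi)%R -> Rcont (G s')) ->
  (forall t, continuity_2d_pt D s t) ->
  is_derive (fun s => rmean (G s)) s (rmean (D s)).
Proof.
  intros Hs HD HG Hc.
  assert (Hd : (0 < Rmin (s - lo) (hi - s))%R) by (apply Rmin_glb_lt; lra).
  assert (Hloc : forall s', (Rabs (s' - s) < Rmin (s - lo) (hi - s))%R -> (lo < s' < hi)%R).
  { intros s' Hs'. pose proof (Rmin_l (s - lo) (hi - s)). pose proof (Rmin_r (s - lo) (hi - s)).
    apply Rabs_def2 in Hs'. lra. }
  unfold rmean, Rdiv.
  apply (is_derive_ext (fun s => (/ (2 * PI) * RInt (G s) 0 (2 * PI))%R)).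
  { intros u. apply Rmult_comm. }
  rewrite (Rmult_comm (RInt _ _ _)). apply is_derive_scal.
  replace (RInt (D s) 0 (2 * PI)) with (RInt (fun t => Derive (fun u => G u t) s) 0 (2 * PI)).
  - apply is_derive_RInt_param.
    + exists (mkposreal _ Hd). intros s' Hs' t _. eexists. apply HD, Hloc. exact Hs'.
    + intros t _. eapply continuity_2d_pt_ext_loc; [|apply Hc].
      exists (mkposreal _ Hd). intros u v Hu _. symmetry.
      apply is_derive_unique, HD, Hloc, Hu.
    + exists (mkposreal _ Hd). intros s' Hs'. apply Rcont_ex_RInt, HG, Hloc. exact Hs'.
  - apply RInt_ext. intros t _. apply is_derive_unique, HD, Hs.
Qed.

Lemma cmean_param_derive (Phi Psi : R -> R -> C) (lo hi s : R) :
  (lo < s < hi)%R ->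
  (forall s', (lo < s' < hi)%R -> forall t, is_Rderive (fun u => Phi u t) s' (Psi s' t)) ->
  (forall s', (lo < s' < hi)%R -> Ccont (Phi s')) ->
  (forall t, @continuous (prod_UniformSpace R_UniformSpace R_UniformSpace) C_UniformSpace
               (fun p => Psi (fst p) (snd p)) (s, t)) ->
  is_Rderive (fun s => cmean (Phi s)) s (cmean (Psi s)).
Proof.
  intros Hs HD HG Hc. split; simpl.
  - apply (rmean_param_derive (fun s t => Re (Phi s t)) (fun s t => Re (Psi s t)) lo hi); auto.
    + intros s' Hs' t. apply HD, Hs'.
    + intros s' Hs'. apply (proj1 (Ccont_components _) (HG s' Hs')).
    + intros t. apply continuity_2d_pt_filterlim.
      apply (proj1 (proj1 (continuous_C_components _ _) (Hc t))).
  - apply (rmean_param_derive (fun s t => Im (Phi s t)) (fun s t => Im (Psi s t)) lo hi); auto.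
    + intros s' Hs' t. apply HD, Hs'.
    + intros s' Hs'. apply (proj1 (Ccont_components _) (HG s' Hs')).
    + intros t. apply continuity_2d_pt_filterlim.
      apply (proj2 (proj1 (continuous_C_components _ _) (Hc t))).
Qed.

(** Continuity of the derivative permits differentiation under the integral sign, so
    that Goursat's theorem can be avoided. *)
Definition C1_on (rho : R) (f f1 : C -> C) : Prop :=
  forall z, (Cmod z < rho)%R -> is_Cderive f z (f1 z) /\ Ccontinuous f1 z.

(** The circle is contracted to [z] along segments.  Let [h s] be the mean of
    [f (z + s (zeta - z)) zeta / (zeta - z)].  Its derivative is the mean of
    [f1 (z + s (zeta - z)) zeta], which for [s <> 0] is the derivative in [t] of
    [f (z + s (zeta - z)) / (i s)] and so has mean zero, as it does for [s = 0].
    Hence [h 1 = h 0 = f z]. *)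
Theorem cauchy_formula (rho R0 : R) (f f1 : C -> C) (z : C) :
  C1_on rho f f1 -> (0 < R0 < rho)%R -> (Cmod z < R0)%R ->
  f z = cmean (fun t => f (circle R0 t) * (circle R0 t / (circle R0 t - z))).
Proof.
  intros Hf HR Hz. pose proof (Cmod_ge_0 z) as Hz0.
  set (k := fun t => circle R0 t / (circle R0 t - z)).
  assert (Hk : Ccont k) by (apply Ccont_kernel; lra).
  set (pt := fun s t : R => z + s * (circle R0 t - z)).
  set (Phi := fun s t : R => f (pt s t) * k t).
  set (Psi := fun s t : R => f1 (pt s t) * circle R0 t).
  set (eta := ((rho - R0) / (4 * R0))%R).
  assert (Heta : (0 < eta)%R) by (apply Rdiv_lt_0_compat; lra).
  assert (Eeta : ((1 + 2 * eta) * R0 < rho)%R) by (unfold eta; field_simplify; lra).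
  assert (Hin : forall s t, (- eta < s < 1 + eta)%R -> (Cmod (pt s t) < rho)%R).
  { intros s t Hs. unfold pt.
    replace (z + s * (circle R0 t - z)) with (RtoC (1 - s) * z + s * circle R0 t)
      by (rewrite RtoC_minus; ring).
    eapply Rle_lt_trans; [apply Cmod_triangle|].
    rewrite !Cmod_mult, circle_Cmod, !Cmod_R by lra.
    apply Rle_lt_trans with ((Rabs (1 - s) + Rabs s) * R0)%R.
    { pose proof (Rabs_pos (1 - s)). nra. }
    assert (Rabs (1 - s) + Rabs s <= 1 + 2 * eta)%R.
    { unfold Rabs. destruct (Rcase_abs (1 - s)), (Rcase_abs s); lra. }
    nra. }
  assert (Hpt : forall s t, @continuous (prod_UniformSpace R_UniformSpace R_UniformSpace)
             C_UniformSpace (fun p => pt (fst p) (snd p)) (s, t)).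
  { intros s t. unfold pt. apply continuous_Cplus; [apply continuous_Cconst|].
    apply continuous_Cmult.
    - apply continuous_RtoC. apply (@continuous_fst R_UniformSpace R_UniformSpace).
    - apply continuous_Cminus; [|apply continuous_Cconst].
      apply (continuous_comp (fun p : R * R => snd p) (circle R0)).
      + apply (@continuous_snd R_UniformSpace R_UniformSpace).
      + apply Ccont_circle. }
  assert (Hpt2 : forall s, Ccont (pt s)).
  { intros s. apply Ccont_plus; [apply Ccont_const|]. apply Ccont_mult; [apply Ccont_const|].
    intros t. apply continuous_Cminus; [apply Ccont_circle|apply continuous_Cconst]. }
  assert (Hder : forall s, (- eta < s < 1 + eta)%R ->
                 is_Rderive (fun s => cmean (Phi s)) s (cmean (Psi s))).
  { intros s Hs. apply (cmean_param_derive Phi Psi (- eta) (1 + eta) s Hs).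
    - intros s' Hs' t. unfold Phi, Psi.
      replace (f1 (pt s' t) * circle R0 t)
        with ((f1 (pt s' t) * k t + f (pt s' t) * 0) * ((circle R0 t - z) * 1)).
      2:{ unfold k. field. apply (circle_minus_nz R0 z); lra. }
      apply (is_Rderive_chain (fun w => f w * k t) (fun u => pt u t)).
      + apply is_Cderive_mult; [apply Hf, Hin, Hs' | apply is_Cderive_const].
      + unfold pt.
        apply (is_Rderive_ext (fun u : R => z + (circle R0 t - z) * u)).
        { intros u. ring. }
        apply is_Rderive_affine. apply is_Rderive_RtoC.
    - intros s' Hs'. apply Ccont_mult; [|exact Hk].
      intros t. apply (continuous_comp (pt s') f); [apply Hpt2|].
      eapply is_Cderive_continuous. apply Hf, Hin, Hs'.
    - intros t. unfold Psi. apply continuous_Cmult.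
      + apply (continuous_comp (fun p : R * R => pt (fst p) (snd p)) f1); [apply Hpt|].
        simpl. apply Hf, Hin, Hs.
      + apply (continuous_comp (fun p : R * R => snd p) (circle R0)).
        * apply (@continuous_snd R_UniformSpace R_UniformSpace).
        * apply Ccont_circle. }
  assert (Hcirc : forall t, is_Rderive (circle R0) t (Ci * circle R0 t)).
  { intros t. unfold circle.
    apply (is_Rderive_ext (fun t => 0 + RtoC R0 * expi t)); [intros; ring|].
    replace (Ci * (R0 * expi t)) with (R0 * (Ci * expi t)) by ring.
    apply is_Rderive_affine, expi_derive. }
  assert (Hzero : forall s, (- eta < s < 1 + eta)%R -> cmean (Psi s) = 0).
  { intros s Hs.
    assert (HPsi : Ccont (Psi s)).
    { apply Ccont_mult; [|apply Ccont_circle]. intros t.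
      apply (continuous_comp (pt s) f1); [apply Hpt2|]. apply Hf, Hin, Hs. }
    destruct (Req_dec s 0) as [->|Hs0].
    - rewrite (cmean_ext _ (fun t => f1 z * circle R0 t)).
      2:{ intros t. unfold Psi, pt. f_equal. f_equal. ring. }
      rewrite cmean_scal by apply Ccont_circle.
      rewrite (cmean_ext _ (fun t => circle R0 t ^ 1)) by (intros t; simpl; ring).
      rewrite (cmean_pow_exponential Ci); [ring|apply Ci_nz|exact Hcirc|].
      unfold circle. now rewrite expi_period.
    - assert (Hs1 : RtoC s <> 0) by (intros E; apply RtoC_inj in E; lra).
      apply (cmean_derive (fun t => 0 + / (s * Ci) * f (pt s t))); [|exact HPsi|].
      + intros t.
        replace (Psi s t) with (/ (s * Ci) * (f1 (pt s t) * (s * (Ci * circle R0 t)))).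
        2:{ unfold Psi. field. split; [apply Ci_nz|exact Hs1]. }
        apply is_Rderive_affine.
        apply (is_Rderive_chain f (pt s)); [apply Hf, Hin, Hs|].
        apply (is_Rderive_ext (fun t => (z - s * z) + s * circle R0 t)).
        { intros u. unfold pt. ring. }
        apply is_Rderive_affine, Hcirc.
      + unfold pt, circle. now rewrite expi_period. }
  assert (Hconst : cmean (Phi 0%R) = cmean (Phi 1%R)).
  { assert (Hd0 : forall s, (0 <= s <= 1)%R -> is_Rderive (fun s => cmean (Phi s)) s 0).
    { intros s Hs. rewrite <- (Hzero s) by lra. apply Hder. lra. }
    apply C_eq.
    - apply (@eq_is_derive R_NormedModule (fun s => Re (cmean (Phi s))) 0 1); [|lra].
      intros s Hs. apply (proj1 (Hd0 s Hs)).
    - apply (@eq_is_derive R_NormedModule (fun s => Im (cmean (Phi s))) 0 1); [|lra].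
      intros s Hs. apply (proj2 (Hd0 s Hs)). }
  transitivity (cmean (Phi 0%R)).
  - rewrite (cmean_ext (Phi 0%R) (fun t => f z * k t)).
    + rewrite cmean_scal by exact Hk. unfold k. rewrite kernel_mean by lra. ring.
    + intros t. unfold Phi, pt. f_equal. f_equal. ring.
  - rewrite Hconst. apply cmean_ext. intros t. unfold Phi, pt, k. f_equal. f_equal. ring.
Qed.

Corollary cauchy_series (rho R0 : R) (f f1 : C -> C) (z : C) :
  C1_on rho f f1 -> (0 < R0 < rho)%R -> (Cmod z < R0)%R ->
  is_Cpseries (fun n => cmean (fun t => f (circle R0 t) * (/ circle R0 t) ^ n)) z (f z).
Proof.
  intros Hf HR Hz. rewrite (cauchy_formula rho R0 f f1 z Hf HR Hz).
  apply (cauchy_transform R0 z ltac:(lra) Hz (fun t => f (circle R0 t))).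
  intros t. apply (continuous_comp (circle R0) f); [apply Ccont_circle|].
  eapply is_Cderive_continuous. apply Hf. rewrite circle_Cmod; lra.
Qed.

Definition series_on (rho : R) (a : nat -> C) (f : C -> C) : Prop :=
  forall z : C, (Cmod z < rho)%R -> is_Cpseries a z (f z).

(** The expansions obtained on circles of different radii agree near [0], so
    they are one series, converging on the whole disc. *)
Theorem C1_series (rho : R) (f f1 : C -> C) :
  (0 < rho)%R -> C1_on rho f f1 -> exists a, series_on rho a f.
Proof.
  intros Hr Hf.
  set (coefs := fun R0 n => cmean (fun t => f (circle R0 t) * (/ circle R0 t) ^ n)).
  exists (coefs (rho / 2)%R). intros z Hz.
  set (R1 := ((Rmax (Cmod z) (rho / 2) + rho) / 2)%R).
  pose proof (Rmax_l (Cmod z) (rho / 2)). pose proof (Rmax_r (Cmod z) (rho / 2)).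
  assert (HR1 : (rho / 2 < R1 < rho)%R /\ (Cmod z < R1)%R).
  { assert (Rmax (Cmod z) (rho / 2) < rho)%R by (apply Rmax_lub_lt; lra). unfold R1; lra. }
  apply (is_pseries_ext (coefs R1)).
  - apply (pseries_coef_unique (rho / 2) _ _ f ltac:(lra));
      intros w Hw; apply (cauchy_series rho _ f f1); auto; lra.
  - apply (cauchy_series rho _ f f1); auto; lra.
Qed.

Lemma series_on_convergent rho a f : series_on rho a f -> convergent_on rho a.
Proof. intros H z Hz. exists (f z). now apply H. Qed.

Lemma series_on_psum rho a f z : series_on rho a f -> (Cmod z < rho)%R -> psum a z = f z.
Proof. intros H Hz. now apply psum_unique, H. Qed.

Lemma psum_series_on rho a : convergent_on rho a -> series_on rho a (psum a).
Proof. intros H z Hz. now apply (psum_correct rho). Qed.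

Lemma series_on_derive rho a f z :
  series_on rho a f -> (Cmod z < rho)%R -> is_Cderive f z (psum (pderiv a) z).
Proof.
  intros H Hz.
  apply (is_Cderive_ext_loc (psum a) f z _ (rho - Cmod z)); [lra| |].
  - intros w Hw. pose proof (Cmod_triangle_rev w z).
    apply (series_on_psum rho a f w H). lra.
  - apply (psum_derive rho); [|exact Hz]. eapply series_on_convergent, H.
Qed.

Lemma series_on_C1 rho a f : series_on rho a f -> C1_on rho f (psum (pderiv a)).
Proof.
  intros H z Hz. split; [now apply (series_on_derive rho)|].
  apply (psum_continuous rho); [|exact Hz].
  eapply pderiv_convergent, series_on_convergent, H.
Qed.

Lemma series_on_pderiv rho a f f1 :
  series_on rho a f -> (forall z, (Cmod z < rho)%R -> is_Cderive f z (f1 z)) ->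
  series_on rho (pderiv a) f1.
Proof.
  intros H H1 z Hz.
  rewrite (is_Cderive_unique f z (f1 z) (psum (pderiv a) z)).
  - apply (psum_correct rho); [|exact Hz]. eapply pderiv_convergent, series_on_convergent, H.
  - now apply H1.
  - now apply (series_on_derive rho).
Qed.

Lemma series_on_at_0 rho a f : (0 < rho)%R -> series_on rho a f -> f 0 = a 0%nat.
Proof.
  intros Hr H. assert (Hz : (Cmod 0 < rho)%R) by now rewrite Cmod_0.
  apply (Cpseries_unique_sum a 0); [now apply H|].
  replace (a 0%nat) with (a 0%nat * 0 ^ 0 + 0) by (simpl; ring).
  apply is_Cpseries_series, (Cseries_cons (fun n => a n * 0 ^ n)).
  apply (Cseries_ext (fun _ => RtoC 0)); [|exact Cseries_zero].
  intros n. simpl. ring.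
Qed.

Lemma series_on_coef_mean rho R0 a f n :
  series_on rho a f -> (0 < R0 < rho)%R ->
  cmean (fun t => f (circle R0 t) * (/ circle R0 t) ^ n) = a n.
Proof.
  intros H HR.
  apply (pseries_coef_unique R0
    (fun n => cmean (fun t => f (circle R0 t) * (/ circle R0 t) ^ n)) a f ltac:(lra)).
  - intros z Hz. apply (cauchy_series rho R0 f (psum (pderiv a))); try assumption.
    now apply series_on_C1.
  - intros z Hz. apply H. lra.
Qed.

Lemma series_on_times_id rho a f :
  series_on rho a f ->
  series_on rho (fun m => match m with O => RtoC 0 | S m => a m end) (fun w => w * f w).
Proof.
  intros H z Hz. replace (z * f z) with (0 + z * f z) by ring.
  apply (pseries_shift (fun m => match m with O => RtoC 0 | S m => a m end)). now apply H.
Qed.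

(** This is the mean value property at [0] of [f w * w ^ S n], multiplying by [w] one
    factor at a time. *)
Lemma series_on_negative_mean rho R0 a f n :
  series_on rho a f -> (0 < R0 < rho)%R ->
  cmean (fun t => f (circle R0 t) * circle R0 t ^ S n) = 0.
Proof.
  intros H HR.
  revert a f H. induction n as [|n IH]; intros a f H;
    assert (Hc := series_on_times_id rho a f H).
  - rewrite <- (series_on_coef_mean rho R0 _ _ 0 Hc HR).
    apply cmean_ext. intros t. simpl. ring.
  - rewrite (cmean_ext _ (fun t => (circle R0 t * f (circle R0 t)) * circle R0 t ^ S n)).
    2:{ intros t. rewrite (Cpow_S _ (S n)). ring. }
    exact (IH _ _ Hc).
Qed.

(** * Functions with positive real part *)

(** [|x_0 v_0 + ... + x_3 v_3|^2] when [v_0, ..., v_3] are unit vectors with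
    [<v_j, v_k> = conj g_(j-k)] for [j > k], as [e^(i k t)] are for the probability
    density [Re p]. *)
Definition toeplitz_form (g1 g2 g3 x0 x1 x2 x3 : C) : R :=
  (Cmod x0 ^ 2 + Cmod x1 ^ 2 + Cmod x2 ^ 2 + Cmod x3 ^ 2
   + 2 * Re (Cconj g1 * (x1 * Cconj x0 + x2 * Cconj x1 + x3 * Cconj x2)
             + Cconj g2 * (x2 * Cconj x0 + x3 * Cconj x1)
             + Cconj g3 * (x3 * Cconj x0)))%R.

Lemma cmean_conj phi : Ccont phi -> cmean (fun t => Cconj (phi t)) = Cconj (cmean phi).
Proof.
  intros H. apply Ccont_components in H. destruct H as [_ H].
  apply C_eq; simpl; [reflexivity|].
  rewrite (rmean_ext _ (fun t => (-1) * Im (phi t))%R).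
  - rewrite rmean_scal by exact H. ring.
  - intros t. unfold Im; simpl. ring.
Qed.

Lemma Ccont_conj phi : Ccont phi -> Ccont (fun t => Cconj (phi t)).
Proof.
  rewrite !Ccont_components. intros [H1 H2]. split; [exact H1|].
  intros t. apply continuous_Ropp, H2.
Qed.

Section PositiveRealPart.
Variables (p : C -> C) (c : nat -> C) (r : R).
Hypotheses (Hp : series_on 1 c p) (Hr : (0 < r < 1)%R).

Let pc (t : R) : C := p (circle r t).

Lemma Ccont_on_circle : Ccont pc.
Proof.
  intros t. apply (continuous_comp (circle r) p); [apply Ccont_circle|].
  eapply is_Cderive_continuous, (series_on_derive 1); [exact Hp|].
  rewrite circle_Cmod; lra.
Qed.

Lemma mean_times_conj_pow n : cmean (fun t => pc t * Cconj (expi t) ^ n) = c n * r ^ n.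
Proof.
  assert (Hrn : RtoC r <> 0) by (intros E; apply RtoC_inj in E; lra).
  assert (E := series_on_coef_mean 1 r c p n Hp Hr).
  rewrite <- E, Cmult_comm, <- cmean_scal.
  - apply cmean_ext. intros t. rewrite expi_conj_inv. unfold pc, circle.
    replace (/ (r * expi t)) with (/ r * / expi t)
      by (field; split; [apply expi_nz|exact Hrn]).
    rewrite (Cpow_mult_l (/ r)).
    replace (r ^ n * (p (r * expi t) * ((/ r) ^ n * (/ expi t) ^ n)))
      with ((r ^ n * (/ r) ^ n) * (p (r * expi t) * (/ expi t) ^ n)) by ring.
    rewrite <- Cpow_mult_l, Cinv_r, Cpow_1_l by exact Hrn. ring.
  - apply Ccont_mult; [apply Ccont_on_circle|].
    apply Ccont_pow, Ccont_circle_inv. lra.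
Qed.

Lemma mean_times_pow n : cmean (fun t => pc t * expi t ^ S n) = 0.
Proof.
  assert (Hrn : RtoC r <> 0) by (intros E; apply RtoC_inj in E; lra).
  assert (E := series_on_negative_mean 1 r c p n Hp Hr).
  rewrite (cmean_ext _ (fun t => (/ r) ^ S n * (pc t * circle r t ^ S n))).
  - rewrite cmean_scal; [unfold pc; rewrite E; ring|].
    apply Ccont_mult; [apply Ccont_on_circle|]. apply Ccont_pow, Ccont_circle.
  - intros t. unfold circle at 1. rewrite (Cpow_mult_l r).
    transitivity (((/ r) ^ S n * r ^ S n) * (pc t * expi t ^ S n)); [|unfold circle; ring].
    rewrite <- Cpow_mult_l, Cinv_l, Cpow_1_l by exact Hrn. ring.
Qed.

(** [2 Re p = p + conj p], and the mean of [p * expi ^ n] vanishes for [n > 0]. *)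
Lemma mean_Re_times_pow n :
  cmean (fun t => RtoC (Re (pc t)) * expi t ^ S n) = Cconj (c (S n) * r ^ S n) / 2.
Proof.
  assert (C1 : Ccont (fun t => pc t * expi t ^ S n))
    by (apply Ccont_mult; [apply Ccont_on_circle|apply Ccont_pow, Ccont_expi]).
  assert (C2 : Ccont (fun t => pc t * Cconj (expi t) ^ S n))
    by (apply Ccont_mult; [apply Ccont_on_circle|apply Ccont_pow, Ccont_expi_conj]).
  rewrite (cmean_ext _ (fun t => / 2 * (pc t * expi t ^ S n)
              + / 2 * Cconj (pc t * Cconj (expi t) ^ S n))).
  - assert (C3 := Ccont_conj _ C2).
    rewrite cmean_plus by (apply Ccont_mult; [apply Ccont_const|assumption]).
    rewrite !cmean_scal, cmean_conj, mean_times_pow, mean_times_conj_pow by assumption.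
    unfold Cdiv. ring.
  - intros t. rewrite Cmult_conj, Cpow_conj, Cconj_conj, re_alt. field.
Qed.

Lemma mean_Re : c 0%nat = 1 -> cmean (fun t => RtoC (Re (pc t))) = 1.
Proof.
  intros Hc. assert (E := mean_times_conj_pow 0).
  rewrite (cmean_ext _ pc) in E by (intros t; simpl; ring).
  rewrite Hc in E. simpl in E. rewrite Cmult_1_l in E.
  apply C_eq.
  - change (Re (cmean pc) = 1%R). now rewrite E.
  - simpl. apply rmean_const.
Qed.

(** The Caratheodory-Toeplitz condition of order three: the form is the mean of
    [Re p |x0 + x1 e + x2 e^2 + x3 e^3|^2]. *)
Theorem caratheodory_toeplitz x0 x1 x2 x3 :
  c 0%nat = 1 -> (forall z, (Cmod z < 1)%R -> (0 < Re (p z))%R) ->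
  (0 <= toeplitz_form (c 1%nat * r / 2) (c 2%nat * r ^ 2 / 2) (c 3%nat * r ^ 3 / 2)
          x0 x1 x2 x3)%R.
Proof.
  intros Hc Hpos.
  set (A0 := x0 * Cconj x0 + x1 * Cconj x1 + x2 * Cconj x2 + x3 * Cconj x3).
  set (A1 := x1 * Cconj x0 + x2 * Cconj x1 + x3 * Cconj x2).
  set (A2 := x2 * Cconj x0 + x3 * Cconj x1).
  set (A3 := x3 * Cconj x0).
  set (rp := fun t => RtoC (Re (pc t))).
  assert (Crp : Ccont rp).
  { intros t. apply continuous_RtoC, (proj1 (proj1 (Ccont_components _) Ccont_on_circle)). }
  assert (Ce : forall n, Ccont (fun t => rp t * expi t ^ n)).
  { intros n. apply Ccont_mult; [exact Crp|apply Ccont_pow, Ccont_expi]. }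
  set (Theta := fun t => A0 * rp t + (2 * A1 * (rp t * expi t ^ 1)
      + (2 * A2 * (rp t * expi t ^ 2) + 2 * A3 * (rp t * expi t ^ 3)))).
  assert (Ek : forall k n, Ccont (fun t => k * (rp t * expi t ^ n))).
  { intros k n. apply Ccont_mult; [apply Ccont_const|apply Ce]. }
  assert (C23 : Ccont (fun t => 2 * A2 * (rp t * expi t ^ 2) + 2 * A3 * (rp t * expi t ^ 3)))
    by (apply Ccont_plus; apply Ek).
  assert (C123 : Ccont (fun t => 2 * A1 * (rp t * expi t ^ 1)
     + (2 * A2 * (rp t * expi t ^ 2) + 2 * A3 * (rp t * expi t ^ 3))))
    by (apply Ccont_plus; [apply Ek|exact C23]).
  assert (C0 : Ccont (fun t => A0 * rp t)) by (apply Ccont_mult; [apply Ccont_const|exact Crp]).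
  assert (CT : Ccont Theta) by (apply Ccont_plus; assumption).
  assert (Em : cmean Theta = A0 + (A1 * Cconj (c 1%nat * r ^ 1)
                + A2 * Cconj (c 2%nat * r ^ 2) + A3 * Cconj (c 3%nat * r ^ 3))).
  { unfold Theta. rewrite !cmean_plus, !cmean_scal by auto.
    unfold rp. rewrite mean_Re, !mean_Re_times_pow by exact Hc. field. }
  assert (HT : forall t, (0 <= Re (Theta t))%R).
  { intros t.
    set (e := expi t). set (P := x0 + x1 * e + x2 * e ^ 2 + x3 * e ^ 3).
    assert (HP : P * Cconj P = A0 + (A1 * e + A2 * e ^ 2 + A3 * e ^ 3)
                    + Cconj (A1 * e + A2 * e ^ 2 + A3 * e ^ 3)).
    { pose proof (expi_conj_mult t) as He. fold e in He.
      unfold P, A0, A1, A2, A3.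
      rewrite !Cplus_conj, !Cmult_conj, !Cplus_conj, !Cmult_conj, !Cconj_conj, !Cpow_conj.
      ring [He]. }
    assert (HA0 : Im A0 = 0%R) by (unfold A0, Im; simpl; ring).
    replace (Re (Theta t)) with (Re (pc t) * Cmod P ^ 2)%R.
    - apply Rmult_le_pos; [|apply pow_le, Cmod_ge_0].
      left. apply Hpos. rewrite circle_Cmod; lra.
    - assert (Q : RtoC (Cmod P ^ 2) = P * Cconj P) by (symmetry; rewrite <- Cmod2_conj; reflexivity).
      apply (f_equal Re) in Q. rewrite HP in Q.
      change (Re (RtoC (Cmod P ^ 2))) with (Cmod P ^ 2)%R in Q. rewrite Q.
      unfold Theta, rp. fold e.
      set (B := A1 * e + A2 * e ^ 2 + A3 * e ^ 3).
      replace (A0 * RtoC (Re (pc t)) + _) with (RtoC (Re (pc t)) * (A0 + 2 * B))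
        by (unfold B; ring).
      rewrite re_scal_l. f_equal. unfold Re; simpl. ring. }
  assert (Hm : (0 <= Re (cmean Theta))%R).
  { rewrite <- (rmean_const 0). simpl. apply rmean_le.
    - apply Rcont_const.
    - apply (proj1 (proj1 (Ccont_components _) CT)).
    - intros t _. apply HT. }
  rewrite Em in Hm.
  unfold toeplitz_form. fold A1 A2 A3.
  assert (E0 : (Cmod x0 ^ 2 + Cmod x1 ^ 2 + Cmod x2 ^ 2 + Cmod x3 ^ 2)%R = Re A0).
  { rewrite !Cmod2_alt. unfold A0, Re, Im; simpl. ring. }
  rewrite E0.
  eapply Rle_trans; [exact Hm|]. right.
  rewrite re_plus. f_equal.
  set (D := A1 * Cconj (c 1%nat * r ^ 1) + A2 * Cconj (c 2%nat * r ^ 2)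
            + A3 * Cconj (c 3%nat * r ^ 3)).
  rewrite <- re_scal_l. f_equal. unfold D, Cdiv.
  rewrite !Cmult_conj, (Cinv_conj 2).
  - replace (Cconj 2) with (RtoC 2) by (apply C_eq; simpl; ring).
    rewrite Cpow_1_r. field.
  - intros E; apply RtoC_inj in E; lra.
Qed.
End PositiveRealPart.

(** * From positivity to the coefficient inequality *)

(** Positivity of [|f - lambda b|^2] for vectors with [|f|^2 = |b|^2 = N] and
    [<f, b> = w] is the Cauchy-Schwarz inequality [|w| <= N]. *)
Lemma cauchy_schwarz_phase (N : R) (w : C) :
  (forall lam : C, (0 <= (1 + Cmod lam ^ 2) * N - 2 * Re (Cconj lam * w))%R) ->
  (Cmod w <= N)%R.
Proof.
  intros H. destruct (Req_dec (Cmod w) 0) as [E|Hn].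
  - specialize (H 0). rewrite Cmod_0 in H.
    replace (Re (Cconj 0 * w)) with 0%R in H by (unfold Re; simpl; ring). lra.
  - pose proof (Cmod_ge_0 w) as Hw.
    specialize (H (w * RtoC (/ Cmod w))).
    replace (Cmod (w * RtoC (/ Cmod w))) with 1%R in H.
    2:{ rewrite Cmod_mult, Cmod_R, Rabs_pos_eq by (left; apply Rinv_0_lt_compat; lra). field. lra. }
    replace (Re (Cconj (w * RtoC (/ Cmod w)) * w)) with (Cmod w) in H; [lra|].
    replace (Cconj (w * RtoC (/ Cmod w)) * w) with (RtoC (Cmod w ^ 2 * / Cmod w)).
    + simpl. field. exact Hn.
    + rewrite RtoC_mult, Cmod2_conj.
      rewrite Cmult_conj.
      replace (Cconj (RtoC (/ Cmod w))) with (RtoC (/ Cmod w)) by (apply C_eq; simpl; ring).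
      ring.
Qed.

Section ToeplitzConsequences.
Variables g1 g2 g3 : C.
Hypothesis Hpsd : forall x0 x1 x2 x3, (0 <= toeplitz_form g1 g2 g3 x0 x1 x2 x3)%R.

Let s : R := (1 - Cmod g1 ^ 2)%R.
Let d : C := g2 - g1 * g1.
Let e : C := s * g3 - (s * g1 - d * Cconj g1) * g2 - d * g1.

(** The squared norm of [b = v_0 - g1 v_1], which is orthogonal to [v_1]. *)
Lemma toeplitz_s_ge_0 : (0 <= s)%R.
Proof.
  assert (H := Hpsd 1 (- g1) 0 0).
  replace (toeplitz_form g1 g2 g3 1 (- g1) 0 0) with s in H; [exact H|].
  unfold s, toeplitz_form. rewrite !Cmod2_alt.
  destruct g1, g2, g3. unfold Re, Im; simpl. ring.
Qed.

(** Cauchy-Schwarz for [f = v_2 - conj g1 v_1] and [b = v_0 - g1 v_1], both of squared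
    norm [s]. *)
Lemma toeplitz_order2 : (Cmod d <= s)%R.
Proof.
  rewrite <- Cmod_conj. apply cauchy_schwarz_phase. intros lam.
  assert (H := Hpsd (- lam) (- Cconj g1 + lam * g1) 1 0).
  eapply Rle_trans; [exact H|]. right.
  unfold d, s, toeplitz_form. rewrite !Cmod2_alt.
  destruct g1, g2, g3, lam. unfold Re, Im; simpl. ring.
Qed.

(** Cauchy-Schwarz for the components of [s v_3] and [s v_0] orthogonal to [v_1] and [v_2],
    both of squared norm [s (s^2 - |d|^2)].  The factor [s] clears the denominators. *)
Lemma toeplitz_order3 : (s * Cmod e <= s * (s ^ 2 - Cmod d ^ 2))%R.
Proof.
  pose proof toeplitz_s_ge_0 as Hs.
  replace (s * Cmod e)%R with (Cmod (s * Cconj e))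
    by (now rewrite Cmod_mult, Cmod_conj, Cmod_R, Rabs_pos_eq).
  apply cauchy_schwarz_phase. intros lam.
  assert (H := Hpsd (- lam * s) (- Cconj d + lam * (s * g1 - d * Cconj g1))
                 (- Cconj (s * g1 - d * Cconj g1) + lam * d) s).
  eapply Rle_trans; [exact H|]. right.
  unfold e, d, s, toeplitz_form. rewrite !Cmod2_alt.
  destruct g1, g2, g3, lam. unfold Re, Im; simpl. ring.
Qed.
(** Now [f = v_3 - conj g1 v_2] has squared norm [s = 0], hence is orthogonal to [v_0]. *)
Lemma toeplitz_degenerate : s = 0%R -> g3 = g1 * g2.
Proof.
  intros Hs. apply Ceq_minus, Cmod_eq_0, Rle_antisym; [|apply Cmod_ge_0].
  apply Rnot_lt_le. intros Hlt.
  set (w := g3 - g1 * g2) in *.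
  assert (H := Hpsd (- Cconj w) 0 (- Cconj g1) 1).
  apply (Rlt_not_le (Cmod w ^ 2) 0); [now apply pow_lt|].
  replace (toeplitz_form g1 g2 g3 (- Cconj w) 0 (- Cconj g1) 1)
    with (s - Cmod w ^ 2)%R in H; [lra|].
  unfold w, s, toeplitz_form. rewrite !Cmod2_alt.
  destruct g1, g2, g3. unfold Re, Im; simpl. ring.
Qed.
End ToeplitzConsequences.

(** Four times the determinant [Gamma_1 Gamma_3 - Gamma_2^2], through [g_n = c_n / 2]
    where [c_(n-1) = n^2 a_n]. *)
Definition hankel_form (g1 g2 g3 : C) : C :=
  RtoC (13 / 192) * g1 ^ 4 + RtoC (1 / 16) * (g1 * g3)
  - RtoC (1 / 18) * (g1 ^ 2 * g2) - RtoC (4 / 81) * g2 ^ 2.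

(** Here [t] stands for [|g1|] and [d] for the modulus of [g2 - g1^2].  The left-hand side
    increases with [d], and at [d = s] it equals [s (4/81 - (36 t^2 + 89 t^4) / 5184)]. *)
Lemma hankel_real_bound (t s d : R) :
  (0 <= t)%R -> s = (1 - t ^ 2)%R -> (0 < s)%R -> (0 <= d <= s)%R ->
  (s * (131 / 5184 * t ^ 4 + 19 / 648 * (t ^ 2 * d) + 4 / 81 * d ^ 2)
   + 1 / 16 * t * (t * d ^ 2 + (s ^ 2 - d ^ 2)) <= s * (4 / 81))%R.
Proof.
  intros Ht Es Hs Hd.
  assert (Ht1 : (t < 1)%R) by nra.
  (* the factor of [d^2]; it vanishes at [t = 1] *)
  assert (Hc : (0 <= 4 / 81 * s + 1 / 16 * t ^ 2 - 1 / 16 * t)%R).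
  { replace (4 / 81 * s + 1 / 16 * t ^ 2 - 1 / 16 * t)%R
      with ((1 - t) * (4 / 81 * (1 + t) - 1 / 16 * t))%R by (rewrite Es; ring).
    apply Rmult_le_pos; lra. }
  assert (Hd2 : (d ^ 2 <= s ^ 2)%R) by (apply pow_incr; lra).
  apply Rle_trans with
    (s * (131 / 5184 * t ^ 4 + 19 / 648 * (t ^ 2 * s))
     + (4 / 81 * s + 1 / 16 * t ^ 2 - 1 / 16 * t) * s ^ 2 + 1 / 16 * t * s ^ 2)%R.
  - assert (P1 : (t ^ 2 * d <= t ^ 2 * s)%R) by (apply Rmult_le_compat_l; [apply pow_le|]; lra).
    assert (P2 := Rmult_le_compat_l _ _ _ Hc Hd2).
    assert (P3 : (s * (t ^ 2 * d) <= s * (t ^ 2 * s))%R) by (apply Rmult_le_compat_l; lra).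
    lra.
  - replace (s * (131 / 5184 * t ^ 4 + 19 / 648 * (t ^ 2 * s))
     + (4 / 81 * s + 1 / 16 * t ^ 2 - 1 / 16 * t) * s ^ 2 + 1 / 16 * t * s ^ 2)%R
     with (s * (4 / 81 - (36 * t ^ 2 + 89 * t ^ 4) / 5184))%R by (rewrite Es; field).
    apply Rmult_le_compat_l; [lra|].
    pose proof (pow_le t 2 Ht). pose proof (pow_le t 4 Ht). lra.
Qed.

Lemma Cmod_RtoC_mult (x : R) (z : C) : (0 <= x)%R -> Cmod (x * z) = (x * Cmod z)%R.
Proof. intros H. now rewrite Cmod_mult, Cmod_R, Rabs_pos_eq. Qed.

(** Eliminating [g3] in favour of [e] makes [s * hankel_form] a polynomial in [g1], [d], [e]
    whose terms are estimated separately. *)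
Theorem hankel_form_bound (g1 g2 g3 : C) :
  (forall x0 x1 x2 x3, (0 <= toeplitz_form g1 g2 g3 x0 x1 x2 x3)%R) ->
  (Cmod (hankel_form g1 g2 g3) <= 4 / 81)%R.
Proof.
  intros Hpsd.
  assert (H1 := toeplitz_s_ge_0 g1 g2 g3 Hpsd).
  assert (H2 := toeplitz_order2 g1 g2 g3 Hpsd).
  assert (H3 := toeplitz_order3 g1 g2 g3 Hpsd).
  set (s := (1 - Cmod g1 ^ 2)%R) in *. set (d := g2 - g1 * g1) in *.
  set (e := s * g3 - (s * g1 - d * Cconj g1) * g2 - d * g1) in *.
  set (t := Cmod g1) in *.
  assert (Ht : (0 <= t)%R) by apply Cmod_ge_0.
  assert (Hd : (0 <= Cmod d)%R) by apply Cmod_ge_0.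
  destruct (Rle_lt_or_eq_dec 0 s H1) as [Hs|Hs].
  - assert (He : (Cmod e <= s ^ 2 - Cmod d ^ 2)%R) by (apply Rmult_le_reg_l with s; lra).
    assert (Es : RtoC s = 1 - g1 * Cconj g1).
    { unfold s, t. now rewrite RtoC_minus, Cmod2_conj. }
    assert (E : s * hankel_form g1 g2 g3 =
      s * (RtoC (131 / 5184) * g1 ^ 4 + (- (RtoC (19 / 648) * (g1 ^ 2 * d))
                 + - (RtoC (4 / 81) * d ^ 2)))
      + RtoC (1 / 16) * g1 * (- (Cconj g1 * d ^ 2) + e)).
    { unfold hankel_form, e. replace g2 with (g1 * g1 + d) by (unfold d; ring).
      rewrite !RtoC_div by lra. rewrite Es. field. }
    apply Rmult_le_reg_l with s; [exact Hs|].
    rewrite <- Cmod_RtoC_mult, E by lra.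
    eapply Rle_trans; [|apply (hankel_real_bound t s (Cmod d) Ht eq_refl Hs); lra].
    eapply Rle_trans; [apply Cmod_triangle|].
    apply Rplus_le_compat.
    + rewrite Cmod_RtoC_mult by lra. apply Rmult_le_compat_l; [lra|].
      eapply Rle_trans; [apply Cmod_triangle|]. rewrite Rplus_assoc.
      apply Rplus_le_compat.
      * rewrite Cmod_RtoC_mult, Cmod_pow by lra. apply Rle_refl.
      * eapply Rle_trans; [apply Cmod_triangle|].
        rewrite !Cmod_opp, !Cmod_RtoC_mult, Cmod_mult, !Cmod_pow by lra. apply Rle_refl.
    + rewrite !Cmod_mult, Cmod_R, Rabs_pos_eq by lra. fold t.
      apply Rmult_le_compat_l; [apply Rmult_le_pos; lra|].
      eapply Rle_trans; [apply Cmod_triangle|].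
      rewrite Cmod_opp, Cmod_mult, Cmod_conj, Cmod_pow. fold t. lra.
  - (* [|g1| = 1]: the form degenerates and [g2], [g3] are powers of [g1] *)
    assert (Ed : d = 0) by (apply Cmod_eq_0; lra).
    assert (Eg2 : g2 = g1 * g1)
      by (replace g2 with (g1 * g1 + d) by (unfold d; ring); rewrite Ed; ring).
    assert (H4 := toeplitz_degenerate g1 g2 g3 Hpsd (eq_sym Hs)).
    assert (Et : t = 1%R) by (unfold s in Hs; nra).
    replace (hankel_form g1 g2 g3) with (RtoC (131 / 5184) * g1 ^ 4).
    + rewrite Cmod_RtoC_mult, Cmod_pow by lra. fold t. rewrite Et. lra.
    + unfold hankel_form. rewrite H4, Eg2, !RtoC_div by lra. field.
Qed.

(** * The coefficients of functions in W(1) *)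

Lemma series_on_plus rho a b f g :
  series_on rho a f -> series_on rho b g ->
  series_on rho (fun n => a n + b n) (fun z => f z + g z).
Proof.
  intros Ha Hb z Hz.
  exact (@is_pseries_plus C_AbsRing C_NormedModule a b z _ _ (Ha z Hz) (Hb z Hz)).
Qed.

(** The same quantity as [hankel_form], through the coefficients of [f]. *)
Definition hankel_coefs (a2 a3 a4 : C) : C :=
  RtoC (13 / 12) * a2 ^ 4 + a2 * a4 - a2 ^ 2 * a3 - a3 ^ 2.

(** The bound for [g_n = c_n r^n / 2] is [r^4 |K| <= 4/81]; then [r] tends to [1]. *)
Theorem class_W1_hankel (f : C -> C) :
  class_W1 f ->
  exists a : nat -> C, series_on 1 a f /\ a 0%nat = 0 /\ a 1%nat = 1 /\
    (Cmod (hankel_coefs (a 2%nat) (a 3%nat) (a 4%nat)) <= 4 / 81)%R.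
Proof.
  intros [[_ [Hf0 Hf1]] [f1 [f2 Hf]]].
  assert (HC : C1_on 1 f f1).
  { intros z Hz. destruct (Hf z Hz) as [D1 [D2 _]].
    split; [exact D1|]. now apply is_Cderive_continuous with (f2 z). }
  destruct (C1_series 1 f f1 Rlt_0_1 HC) as [a Ha].
  assert (Ha1 : series_on 1 (pderiv a) f1).
  { apply (series_on_pderiv 1 a f); [exact Ha|]. intros z Hz. apply Hf, Hz. }
  assert (Ha2 : series_on 1 (pderiv (pderiv a)) f2).
  { apply (series_on_pderiv 1 (pderiv a) f1); [exact Ha1|]. intros z Hz. apply Hf, Hz. }
  assert (Hp := series_on_plus _ _ _ _ _ Ha1 (series_on_times_id _ _ _ Ha2)).
  set (c := fun n => pderiv a n + match n with O => RtoC 0 | S m => pderiv (pderiv a) m end) in Hp.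
  assert (E0 : a 0%nat = 0).
  { rewrite <- (series_on_at_0 1 a f Rlt_0_1 Ha). exact Hf0. }
  assert (E1 : a 1%nat = 1).
  { assert (Q := series_on_at_0 1 _ f1 Rlt_0_1 Ha1).
    assert (Q2 : f1 0 = 1).
    { apply (is_Cderive_unique f 0); [|exact Hf1]. apply Hf. rewrite Cmod_0. lra. }
    rewrite Q2 in Q. unfold pderiv in Q. simpl in Q. rewrite Q. ring. }
  exists a. split; [exact Ha|]. split; [exact E0|]. split; [exact E1|].
  set (K := hankel_coefs (a 2%nat) (a 3%nat) (a 4%nat)).
  assert (Hscale : forall r, (0 < r < 1)%R -> (r ^ 4 * Cmod K <= 4 / 81)%R).
  { intros r Hr.
    assert (HB : (Cmod (hankel_form (c 1%nat * r / 2) (c 2%nat * r ^ 2 / 2)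
                            (c 3%nat * r ^ 3 / 2)) <= 4 / 81)%R).
    { apply hankel_form_bound. intros x0 x1 x2 x3.
      apply (caratheodory_toeplitz (fun z => f1 z + z * f2 z) c r Hp Hr).
      - unfold c, pderiv. simpl. rewrite E1. ring.
      - intros z Hz. apply Hf, Hz. }
    replace (hankel_form _ _ _) with (RtoC (r ^ 4) * K) in HB.
    - rewrite Cmod_RtoC_mult in HB; [exact HB|]. apply pow_le; lra.
    - unfold K, hankel_form, hankel_coefs, c, pderiv.
      rewrite !RtoC_div, RtoC_pow by lra.
      replace (INR 1) with 1%R by reflexivity.
      replace (INR 2) with 2%R by (simpl; ring).
      replace (INR 3) with 3%R by (simpl; ring).
      replace (INR 4) with 4%R by (simpl; ring). field. }
  apply Rnot_lt_le. intros Hlt.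
  set (k := Cmod K) in *.
  (* at [r = 1 - h], Bernoulli's inequality leaves at least half of the excess of [k] *)
  set (h := ((k - 4 / 81) / (8 * k))%R).
  assert (Hh : (0 < h)%R) by (apply Rdiv_lt_0_compat; lra).
  assert (Eh : (8 * (h * k) = k - 4 / 81)%R) by (unfold h; field; lra).
  assert (Hh1 : (h < 1)%R) by nra.
  assert (Q := Hscale (1 - h)%R ltac:(lra)).
  assert (B : (1 - 4 * h <= (1 - h) ^ 4)%R).
  { assert (0 <= h * h)%R by nra. assert ((1 - h) ^ 2 >= 1 - 2 * h)%R by (simpl; nra).
    destruct (Rle_lt_dec (1 - 2 * h) 0) as [L|L].
    - apply Rle_trans with 0%R; [lra | apply pow_le; lra].
    - replace ((1 - h) ^ 4)%R with ((1 - h) ^ 2 * (1 - h) ^ 2)%R by ring. nra. }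
  assert (Hk : (0 < k)%R) by lra.
  apply (Rmult_le_compat_r k) in B; lra.
Qed.

(** * The exponential *)

Lemma Cexp_plus (z w : C) : Cexp (z + w) = Cexp z * Cexp w.
Proof.
  unfold Cexp. rewrite re_plus, im_plus, exp_plus, cos_plus, sin_plus.
  apply C_eq; unfold Re at 1 4, Im at 1 4; simpl; unfold Re, Im; simpl; ring.
Qed.

Lemma Cexp_0 : Cexp 0 = 1.
Proof. unfold Cexp; simpl. rewrite exp_0, cos_0, sin_0. apply C_eq; simpl; ring. Qed.

Lemma is_derive_eps (g : R -> R) (x l : R) :
  is_derive g x l ->
  forall eps : R, (0 < eps)%R -> exists d : R, (0 < d)%R /\ forall y, (Rabs (y - x) < d)%R ->
    (Rabs (g y - g x - (y - x) * l) <= eps * Rabs (y - x))%R.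
Proof.
  intros [_ H] eps He.
  destruct (H x (fun P HP => HP) (mkposreal _ He)) as [d D].
  exists d. split; [apply cond_pos|]. intros y Hy. exact (D y Hy).
Qed.

Lemma Cexp_derive_0 : is_Cderive Cexp 0 1.
Proof.
  apply is_Cderive_eps. intros eps He.
  set (ep := Rmin 1 (eps / 10)).
  assert (Hep : (0 < ep)%R) by (apply Rmin_glb_lt; lra).
  pose proof (Rmin_l 1 (eps / 10)) as Hep1. pose proof (Rmin_r 1 (eps / 10)) as Hep2.
  fold ep in Hep1, Hep2.
  destruct (is_derive_eps exp 0 _ (is_derive_exp 0) ep Hep) as [d1 [P1 D1]].
  destruct (is_derive_eps cos 0 _ (is_derive_cos 0) ep Hep) as [d2 [P2 D2]].
  destruct (is_derive_eps sin 0 _ (is_derive_sin 0) ep Hep) as [d3 [P3 D3]].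
  exists (Rmin (Rmin d1 ep) (Rmin d2 d3)). split.
  { apply Rmin_glb_lt; apply Rmin_glb_lt; assumption. }
  intros w Hw.
  assert (Hw1 := Rlt_le_trans _ _ _ Hw (Rmin_l _ _)).
  assert (Hw2 := Rlt_le_trans _ _ _ Hw (Rmin_r _ _)).
  assert (Ha := Rlt_le_trans _ _ _ Hw1 (Rmin_l _ _)).
  assert (Hb := Rlt_le_trans _ _ _ Hw1 (Rmin_r _ _)).
  assert (Hc := Rlt_le_trans _ _ _ Hw2 (Rmin_l _ _)).
  assert (Hd := Rlt_le_trans _ _ _ Hw2 (Rmin_r _ _)).
  replace (w - 0) with w in * by ring.
  destruct w as [x y].
  pose proof (re_le_Cmod (x, y)) as Hx. pose proof (im_le_Cmod (x, y)) as Hy.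
  set (m := Cmod (x, y)) in *. simpl in Hx, Hy.
  assert (X0 := Rabs_pos x). assert (Y0 := Rabs_pos y).
  specialize (D1 x). specialize (D2 y). specialize (D3 y).
  rewrite Rminus_0_r in D1, D2, D3.
  specialize (D1 ltac:(lra)). specialize (D2 ltac:(lra)). specialize (D3 ltac:(lra)).
  rewrite exp_0 in D1. rewrite cos_0, sin_0 in D2. rewrite sin_0, cos_0 in D3.
  set (r1 := (exp x - 1 - x * 1)%R) in *.
  set (r2 := (cos y - 1 - y * - 0)%R) in *.
  set (r3 := (sin y - 0 - y * 1)%R) in *.
  rewrite Cexp_0.
  replace (Cexp (x, y) - 1 - 1 * (x, y))
    with ((r1 + exp x * r2)%R, ((x + r1) * y + exp x * r3)%R).
  2:{ unfold r1, r2, r3, Cexp, Re, Im; apply C_eq; simpl; ring. }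
  assert (R1 : (Rabs r1 <= Rabs x)%R) by nra.
  assert (Ex : (Rabs (exp x) <= 3)%R).
  { replace (exp x) with (1 + x + r1)%R by (unfold r1; ring).
    eapply Rle_trans; [apply Rabs_triang|].
    assert (Rabs (1 + x) <= 1 + Rabs x)%R
      by (eapply Rle_trans; [apply Rabs_triang|]; rewrite Rabs_R1; lra).
    lra. }
  eapply Rle_trans; [apply Cmod_le_Re_Im|]. simpl.
  assert (Q1 : (Rabs (r1 + exp x * r2) <= ep * m + 3 * (ep * m))%R).
  { eapply Rle_trans; [apply Rabs_triang|]. rewrite Rabs_mult.
    apply Rplus_le_compat; [nra|].
    apply Rmult_le_compat; auto using Rabs_pos. nra. }
  assert (Q2 : (Rabs ((x + r1) * y + exp x * r3) <= 2 * ep * m + 3 * (ep * m))%R).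
  { eapply Rle_trans; [apply Rabs_triang|]. rewrite !Rabs_mult.
    apply Rplus_le_compat.
    - apply Rmult_le_compat; auto using Rabs_pos.
      eapply Rle_trans; [apply Rabs_triang|]. lra.
    - apply Rmult_le_compat; auto using Rabs_pos. nra. }
  assert (0 <= m)%R by lra.
  nra.
Qed.

Lemma Cexp_derive (z : C) : is_Cderive Cexp z (Cexp z).
Proof.
  apply (is_Cderive_ext_loc (fun w => Cexp z * Cexp (w - z)) Cexp z _ 1); [lra| |].
  - intros w _. rewrite <- Cexp_plus. f_equal. ring.
  - eapply is_Cderive_value.
    + apply is_Cderive_mult; [apply is_Cderive_const|].
      apply (is_Cderive_comp Cexp (fun w => w - z)).
      * replace (z - z) with (RtoC 0) by ring. apply Cexp_derive_0.
      * apply is_Cderive_plus; [apply is_Cderive_id|].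
        apply is_Cderive_opp, is_Cderive_const.
    + simpl. ring.
Qed.

(** The coefficients follow from [Cexp' = Cexp] by comparing series. *)
Lemma Cexp_series : exists e, series_on 1 e Cexp /\ e 0%nat = 1 /\ e 1%nat = 1 /\
  e 2%nat = / 2 /\ e 3%nat = / 6 /\ e 4%nat = / 24.
Proof.
  assert (HC : C1_on 1 Cexp Cexp).
  { intros z _. split; [apply Cexp_derive|].
    eapply is_Cderive_continuous, Cexp_derive. }
  destruct (C1_series 1 Cexp Cexp Rlt_0_1 HC) as [e He].
  assert (Hd : series_on 1 (pderiv e) Cexp).
  { apply (series_on_pderiv 1 e Cexp Cexp He). intros z _. apply Cexp_derive. }
  assert (Eq := pseries_coef_unique 1 e (pderiv e) Cexp Rlt_0_1 He Hd).
  assert (E0 : e 0%nat = 1).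
  { rewrite <- (series_on_at_0 1 e Cexp Rlt_0_1 He). apply Cexp_0. }
  assert (Step : forall n, e (S n) = / RtoC (INR (S n)) * e n).
  { intros n. rewrite (Eq n). unfold pderiv. field.
    intros Q. apply RtoC_inj in Q. rewrite S_INR in Q. pose proof (pos_INR n). lra. }
  exists e. rewrite !Step, E0.
  replace (INR 1) with 1%R by reflexivity.
  replace (INR 2) with 2%R by (simpl; ring).
  replace (INR 3) with 3%R by (simpl; ring).
  replace (INR 4) with 4%R by (simpl; ring).
  split; [exact He|]. repeat split; field.
Qed.

(** * Jets at the origin *)

Definition near0 (P : C -> Prop) : Prop :=
  exists d : R, (0 < d)%R /\ forall w : C, (Cmod w < d)%R -> P w.

Lemma near0_and P Q : near0 P -> near0 Q -> near0 (fun w => P w /\ Q w).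
Proof.
  intros [d1 [H1 P1]] [d2 [H2 P2]]. exists (Rmin d1 d2).
  split; [now apply Rmin_glb_lt|]. intros w Hw. split.
  - apply P1. eapply Rlt_le_trans; [exact Hw|apply Rmin_l].
  - apply P2. eapply Rlt_le_trans; [exact Hw|apply Rmin_r].
Qed.

Lemma near0_imp (P Q : C -> Prop) : near0 P -> (forall w, P w -> Q w) -> near0 Q.
Proof. intros [d [Hd H]] HI. exists d. auto. Qed.

(** [jet [c_0; ...; c_(n-1)] phi] means
    [phi w = c_0 + c_1 w + ... + c_(n-1) w^(n-1) + O(w^n)].  Peeling off one
    coefficient at a time turns products and compositions of jets into structural
    recursions on lists, with boundedness as the only analytic ingredient. *)
Fixpoint jet (cs : list C) (phi : C -> C) : Prop :=
  match cs with
  | [] => exists K : R, near0 (fun w => (Cmod (phi w) <= K)%R)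
  | c :: cs => exists psi, jet cs psi /\ near0 (fun w => phi w = c + w * psi w)
  end.

Fixpoint jadd (cs ds : list C) : list C :=
  match cs, ds with
  | c :: cs, d :: ds => (c + d) :: jadd cs ds
  | _, _ => []
  end.

Fixpoint jmul (cs ds : list C) : list C :=
  match cs, ds with
  | c :: cs, d :: ds' => (c * d) :: jadd (map (Cmult c) ds') (jmul cs ds)
  | _, _ => []
  end.

(** Composition with [w |-> w * psi w], where [ds] is the jet of [psi]. *)
Fixpoint jcomp (cs ds : list C) : list C :=
  match cs with
  | [] => []
  | c :: cs => c :: jmul ds (jcomp cs ds)
  end.

Lemma jet_bounded cs phi : jet cs phi -> jet [] phi.
Proof.
  revert phi. induction cs as [|c cs IH]; intros phi; [auto|].
  intros [psi [Hpsi He]]. destruct (IH _ Hpsi) as [K HK].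
  exists (Cmod c + 1 * Rmax K 0)%R.
  assert (N1 : near0 (fun w => (Cmod w < 1)%R)) by (exists 1%R; split; [lra|auto]).
  apply (near0_imp _ _ (near0_and _ _ N1 (near0_and _ _ HK He))).
  intros w [H1 [H2 ->]]. eapply Rle_trans; [apply Cmod_triangle|].
  apply Rplus_le_compat_l. rewrite Cmod_mult.
  apply Rmult_le_compat; try apply Cmod_ge_0; [lra|].
  eapply Rle_trans; [exact H2|apply Rmax_l].
Qed.

Lemma jet_plus cs : forall ds phi psi, jet cs phi -> jet ds psi ->
  jet (jadd cs ds) (fun w => phi w + psi w).
Proof.
  assert (Hn : forall phi psi, jet [] phi -> jet [] psi -> jet [] (fun w => phi w + psi w)).
  { intros phi psi [K HK] [L HL]. exists (K + L)%R.
    apply (near0_imp _ _ (near0_and _ _ HK HL)). intros w [H1 H2].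
    eapply Rle_trans; [apply Cmod_triangle|]. lra. }
  induction cs as [|c cs IH]; intros [|d ds] phi psi H1 H2;
    try (apply Hn; eapply jet_bounded; eassumption).
  destruct H1 as [phi' [J1 E1]], H2 as [psi' [J2 E2]].
  exists (fun w => phi' w + psi' w). split; [now apply IH|].
  apply (near0_imp _ _ (near0_and _ _ E1 E2)). intros w [-> ->]. ring.
Qed.

Lemma jet_scal c cs : forall phi, jet cs phi -> jet (map (Cmult c) cs) (fun w => c * phi w).
Proof.
  induction cs as [|d cs IH]; intros phi H; simpl map.
  - destruct H as [K HK]. exists (Cmod c * K)%R. apply (near0_imp _ _ HK). intros w Hw.
    rewrite Cmod_mult. apply Rmult_le_compat_l; [apply Cmod_ge_0|exact Hw].
  - destruct H as [psi [J E]]. exists (fun w => c * psi w). split; [now apply IH|].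
    apply (near0_imp _ _ E). intros w ->. ring.
Qed.

Lemma jet_mult cs : forall ds phi psi, jet cs phi -> jet ds psi ->
  jet (jmul cs ds) (fun w => phi w * psi w).
Proof.
  assert (Hn : forall phi psi, jet [] phi -> jet [] psi -> jet [] (fun w => phi w * psi w)).
  { intros phi psi [K HK] [L HL]. exists (Rmax K 0 * Rmax L 0)%R.
    apply (near0_imp _ _ (near0_and _ _ HK HL)). intros w [H1 H2].
    rewrite Cmod_mult. apply Rmult_le_compat; try apply Cmod_ge_0;
      (eapply Rle_trans; [eassumption|apply Rmax_l]). }
  induction cs as [|c cs IH]; intros [|d ds] phi psi H1 H2;
    try (apply Hn; eapply jet_bounded; eassumption).
  assert (J3 := H2).
  destruct H1 as [phi' [J1 E1]], H2 as [psi' [J2 E2]].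
  exists (fun w => c * psi' w + phi' w * psi w). split.
  - apply jet_plus; [now apply jet_scal | now apply IH].
  - apply (near0_imp _ _ (near0_and _ _ E1 E2)). intros w [-> E]. rewrite E. ring.
Qed.

(** If [phi z = c + z * phi1 z], then [phi (w * psi w) = c + w * (psi w * phi1 (w * psi w))]. *)
Lemma jet_comp cs ds : forall phi psi, jet cs phi -> jet ds psi ->
  jet (jcomp cs ds) (fun w => phi (w * psi w)).
Proof.
  assert (Hs : forall P psi, near0 P -> jet ds psi -> near0 (fun w => P (w * psi w))).
  { intros P psi [d [Hd HP]] H. destruct (jet_bounded _ _ H) as [K [d' [Hd' HK]]].
    assert (HM : (0 < Rmax K 0 + 1)%R) by (pose proof (Rmax_r K 0); lra).
    exists (Rmin d' (d / (Rmax K 0 + 1))). split.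
    { apply Rmin_glb_lt; [assumption|]. now apply Rdiv_lt_0_compat. }
    intros w Hw. apply HP. rewrite Cmod_mult.
    assert (Hw1 := Rlt_le_trans _ _ _ Hw (Rmin_l _ _)).
    assert (Hw2 := Rlt_le_trans _ _ _ Hw (Rmin_r _ _)).
    specialize (HK w Hw1). pose proof (Rmax_l K 0).
    apply (Rmult_lt_compat_r (Rmax K 0 + 1)) in Hw2; [|exact HM].
    unfold Rdiv in Hw2. rewrite Rmult_assoc, Rinv_l, Rmult_1_r in Hw2 by lra.
    pose proof (Cmod_ge_0 w).
    eapply Rle_lt_trans; [|exact Hw2]. apply Rmult_le_compat_l; lra. }
  induction cs as [|c cs IH]; intros phi psi H1 H2.
  - destruct H1 as [K HK]. exists K. exact (Hs _ _ HK H2).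
  - destruct H1 as [phi' [J1 E1]].
    exists (fun w => psi w * phi' (w * psi w)). split.
    + apply jet_mult; [exact H2|now apply IH].
    + apply (near0_imp _ _ (Hs _ _ E1 H2)). intros w ->. ring.
Qed.

(** Equality is only required off the origin, since the peeled-off functions are
    determined there alone. *)
Lemma jet_unique cs : forall ds phi psi, jet cs phi -> jet ds psi ->
  near0 (fun w => w <> 0 -> phi w = psi w) -> length cs = length ds -> cs = ds.
Proof.
  induction cs as [|c cs IH]; intros [|d ds] phi psi H1 H2 He Hl; try discriminate; [reflexivity|].
  destruct H1 as [phi' [J1 E1]], H2 as [psi' [J2 E2]].
  assert (Hc : c = d).
  { destruct (jet_bounded _ _ J1) as [K HK]. destruct (jet_bounded _ _ J2) as [L HL].
    destruct (near0_and _ _ (near0_and _ _ E1 E2) (near0_and _ _ He (near0_and _ _ HK HL)))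
      as [r [Hr H]].
    apply Ceq_minus, Cmod_eq_0, Rle_antisym; [|apply Cmod_ge_0].
    apply Rnot_lt_le. intros Hp.
    set (M := (Rmax K 0 + Rmax L 0 + 1)%R).
    pose proof (Rmax_l K 0). pose proof (Rmax_r K 0).
    pose proof (Rmax_l L 0). pose proof (Rmax_r L 0).
    assert (HM : (0 < M)%R) by (unfold M; lra).
    set (t := Rmin (r / 2) (Cmod (c - d) / M / 2)).
    assert (Ht : (0 < t)%R) by (apply Rmin_glb_lt; [lra|]; repeat apply Rdiv_lt_0_compat; lra).
    assert (Ht1 : (t <= r / 2)%R) by apply Rmin_l.
    assert (Ht2 : (t <= Cmod (c - d) / M / 2)%R) by apply Rmin_r.
    assert (Et : Cmod t = t) by (rewrite Cmod_R, Rabs_pos_eq; lra).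
    destruct (H t ltac:(lra)) as [[A1 A2] [A3 [A4 A5]]].
    assert (A6 : RtoC t <> 0) by (apply Cmod_gt_0; lra).
    specialize (A3 A6). rewrite A1, A2 in A3.
    assert (E : c - d = t * (psi' t - phi' t)).
    { replace (c - d) with ((c + t * phi' t) - d - t * phi' t) by ring. rewrite A3. ring. }
    apply (f_equal Cmod) in E. rewrite Cmod_mult, Et in E.
    pose proof (Cmod_triangle (psi' t) (- phi' t)) as T. rewrite Cmod_opp in T.
    change (psi' t + - phi' t) with (psi' t - phi' t) in T.
    apply (Rmult_le_compat_r M) in Ht2; [|lra].
    replace (Cmod (c - d) / M / 2 * M)%R with (Cmod (c - d) / 2)%R in Ht2 by (field; lra).
    assert (t * Cmod (psi' t - phi' t) <= t * M)%R
      by (apply Rmult_le_compat_l; unfold M; lra).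
    lra. }
  subst d. f_equal. apply (IH ds phi' psi' J1 J2); [|now injection Hl].
  apply (near0_imp _ _ (near0_and _ _ (near0_and _ _ E1 E2) He)).
  intros w [[A1 A2] A3] Hw. specialize (A3 Hw). rewrite A1, A2 in A3.
  assert (A4 : w * phi' w = w * psi' w).
  { replace (w * phi' w) with (c + w * phi' w - c) by ring. rewrite A3. ring. }
  replace (phi' w) with (/ w * (w * phi' w)) by (field; exact Hw).
  rewrite A4. field. exact Hw.
Qed.

Fixpoint first_coefs (a : nat -> C) (n : nat) : list C :=
  match n with O => [] | S n => a 0%nat :: first_coefs (fun k => a (S k)) n end.

(** A series factors as [a 0 + w * psum (a shifted) w]. *)
Lemma series_jet n : forall rho a f, (0 < rho)%R -> series_on rho a f -> jet (first_coefs a n) f.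
Proof.
  induction n as [|n IH]; intros rho a f Hr H.
  - assert (Hc : Ccontinuous f (RtoC 0)).
    { eapply is_Cderive_continuous, (series_on_derive rho); [exact H|]. now rewrite Cmod_0. }
    destruct (proj1 (Ccontinuous_eps f 0) Hc 1%R Rlt_0_1) as [d [Hd Hw]].
    exists (Cmod (f 0) + 1)%R. exists d. split; [exact Hd|]. intros w Hm.
    specialize (Hw w). replace (w - 0) with w in Hw by ring. specialize (Hw Hm).
    pose proof (Cmod_triangle_rev (f w) (f 0)). lra.
  - destruct (convergent_coef_bound rho (rho / 2) a) as [K HK];
      [eapply series_on_convergent, H|lra|].
    assert (HS := coef_bound_convergent _ _ _ (coef_bound_shift _ _ _ HK)).
    exists (psum (fun k => a (S k))). split.
    + apply (IH (rho / 2)%R); [lra|]. now apply psum_series_on.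
    + exists (rho / 2)%R. split; [lra|]. intros w Hw.
      eapply Cpseries_unique_sum; [apply H; lra|].
      apply pseries_shift. now apply (psum_correct (rho / 2)).
Qed.

(** * The determinant in terms of the coefficients *)

(** Comparing the jets of both sides of [f (w Cexp (F w)) = w]. *)
Theorem H21_in_coefs (f : C -> C) (a Gamma : nat -> C) :
  series_on 1 a f -> a 0%nat = 0 -> a 1%nat = 1 ->
  is_log_inverse_coeffs f Gamma ->
  H21 Gamma = / 4 * hankel_coefs (a 2%nat) (a 3%nat) (a 4%nat).
Proof.
  intros Ha E0 E1 [g [F [Hinv [[HF0 Hlog] HF]]]].
  set (b := fun n => match n with O => RtoC 0 | S _ => RtoC 2 * Gamma n end) in HF.
  assert (HFs : series_on (1 / 4) b F) by exact HF.
  destruct Cexp_series as [e [He [e0 [e1 [e2 [e3 e4]]]]]].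
  assert (JF : jet (RtoC 0 :: [2 * Gamma 1%nat; 2 * Gamma 2%nat; 2 * Gamma 3%nat; 2 * Gamma 4%nat]) F)
    by (apply (series_jet 5 (1 / 4) b F); [lra|exact HFs]).
  assert (Je : jet [RtoC 1; RtoC 1; / 2; / 6; / 24] Cexp).
  { replace [RtoC 1; RtoC 1; / 2; / 6; / 24] with (first_coefs e 5)
      by (simpl; now rewrite e0, e1, e2, e3, e4).
    exact (series_jet 5 1 e Cexp Rlt_0_1 He). }
  assert (Jf : jet [RtoC 0; RtoC 1; a 2%nat; a 3%nat; a 4%nat] f).
  { replace [RtoC 0; RtoC 1; a 2%nat; a 3%nat; a 4%nat] with (first_coefs a 5)
      by (simpl; now rewrite E0, E1).
    exact (series_jet 5 1 a f Rlt_0_1 Ha). }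
  destruct JF as [F1 [JF1 EF]].
  assert (JE := jet_comp _ _ _ _ Je JF1).
  assert (JC := jet_comp _ _ _ _ Jf JE).
  assert (Jid : jet [RtoC 0; RtoC 1; RtoC 0; RtoC 0; RtoC 0] (fun w => w)).
  { exists (fun _ => RtoC 1). split; [|exists 1%R; split; [lra|intros; ring]].
    do 4 (exists (fun _ => RtoC 0); split; [|exists 1%R; split; [lra|intros; ring]]).
    exists 0%R, 1%R. split; [lra|]. intros _ _. rewrite Cmod_0. lra. }
  assert (N4 : near0 (fun w => (Cmod w < 1 / 4)%R)) by (exists (1 / 4)%R; split; [lra|auto]).
  assert (Eq : near0 (fun w => w <> 0 -> f (w * Cexp (w * F1 w)) = w)).
  { apply (near0_imp _ _ (near0_and _ _ N4 EF)). intros w [Hw Ew] Hnz.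
    replace (w * F1 w) with (F w) by (rewrite Ew; ring).
    rewrite (proj2 (Hlog w Hw) Hnz).
    replace (w * (g w / w)) with (g w) by (field; exact Hnz).
    destruct (Hinv w Hw) as [Hg Hiff]. now apply Hiff. }
  assert (L := jet_unique _ _ _ _ JC Jid Eq eq_refl).
  assert (L2 := f_equal (fun l : list C => nth 2 l (RtoC 0)) L).
  assert (L3 := f_equal (fun l : list C => nth 3 l (RtoC 0)) L).
  assert (L4 := f_equal (fun l : list C => nth 4 l (RtoC 0)) L).
  cbn [jcomp jmul jadd map nth] in L2, L3, L4. clear L.
  set (b1 := 2 * Gamma 1%nat) in *. set (b2 := 2 * Gamma 2%nat) in *.
  set (b3 := 2 * Gamma 3%nat) in *.
  assert (A2 : a 2%nat = RtoC 0 - b1) by (rewrite <- L2; ring).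
  assert (A3 : a 3%nat = RtoC 0 - (2 * a 2%nat * b1 + (b2 + b1 * b1 / 2)))
    by (rewrite <- L3; field).
  assert (A4 : a 4%nat = RtoC 0 - (3 * a 3%nat * b1
      + a 2%nat * (2 * (b2 + b1 * b1 / 2) + b1 * b1) + (b3 + b1 * b2 + b1 * b1 * b1 / 6)))
    by (rewrite <- L4; field).
  unfold H21, hankel_coefs. rewrite A4, A3, A2, RtoC_div by lra.
  unfold b1, b2, b3. field.
Qed.

Theorem H21_bound (f : C -> C) (Gamma : nat -> C) :
  class_W1 f -> is_log_inverse_coeffs f Gamma -> (Cmod (H21 Gamma) <= 1 / 81)%R.
Proof.
  intros Hf HG. destruct (class_W1_hankel f Hf) as [a [Ha [E0 [E1 HB]]]].
  rewrite (H21_in_coefs f a Gamma Ha E0 E1 HG).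
  replace (/ 4) with (RtoC (/ 4)) by (rewrite RtoC_inv; [reflexivity|lra]).
  rewrite Cmod_RtoC_mult by lra. lra.
Qed.

(** * The logarithm near 1 *)

(** The power series of the derivative vanishes, hence so do the coefficients of [f]
    beyond the constant one. *)
Lemma zero_derivative_constant (rho : R) (f : C -> C) (z : C) :
  (forall w, (Cmod w < rho)%R -> is_Cderive f w 0) -> (Cmod z < rho)%R -> f z = f 0.
Proof.
  intros H Hz. assert (Hr : (0 < rho)%R) by (pose proof (Cmod_ge_0 z); lra).
  assert (HC : C1_on rho f (fun _ => 0)).
  { intros w Hw. split; [now apply H|]. apply continuous_Cconst. }
  destruct (C1_series rho f _ Hr HC) as [a Ha].
  assert (Hd : series_on rho (pderiv a) (fun _ => 0)) by now apply (series_on_pderiv rho a f).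
  assert (H0 : series_on rho (fun _ => RtoC 0) (fun _ => 0)).
  { intros w _. apply is_Cpseries_series.
    apply (Cseries_ext (fun _ => RtoC 0)); [intros n; ring|exact Cseries_zero]. }
  assert (E := pseries_coef_unique rho _ _ _ Hr Hd H0).
  rewrite (series_on_at_0 rho a f Hr Ha).
  apply (Cpseries_unique_sum a z); [now apply Ha|].
  replace (a 0%nat) with (a 0%nat + z * 0) by ring.
  apply pseries_shift, is_Cpseries_series.
  apply (Cseries_ext (fun _ => RtoC 0)); [|exact Cseries_zero].
  intros n. specialize (E n). unfold pderiv in E.
  assert (Hn : RtoC (INR (S n)) <> 0).
  { intros Q. apply RtoC_inj in Q. rewrite S_INR in Q. pose proof (pos_INR n). lra. }
  replace (a (S n)) with (/ RtoC (INR (S n)) * (RtoC (INR (S n)) * a (S n)))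
    by (field; exact Hn).
  rewrite E. ring.
Qed.

Definition log_coef (n : nat) : C :=
  match n with O => 0 | S m => RtoC ((-1) ^ m / INR (S m)) end.

Lemma pderiv_log_coef n : pderiv log_coef n = RtoC ((-1) ^ n).
Proof.
  unfold pderiv, log_coef. rewrite <- RtoC_mult. f_equal. field.
  rewrite S_INR. pose proof (pos_INR n). lra.
Qed.

Lemma bounded_coef_bound (a : nat -> C) (K : R) :
  (forall n, (Cmod (a n) <= K)%R) -> coef_bound 1 K a.
Proof. intros H. split; [lra|]. intros n. rewrite pow1, Rmult_1_r. apply H. Qed.

Lemma log_coef_convergent : convergent_on 1 log_coef.
Proof.
  apply (coef_bound_convergent 1 1), bounded_coef_bound. intros [|n].
  - simpl. rewrite Cmod_0. lra.
  - unfold log_coef. rewrite Cmod_R. unfold Rdiv. rewrite Rabs_mult, pow_1_abs, Rmult_1_l.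
    rewrite Rabs_pos_eq; [|left; apply Rinv_0_lt_compat, lt_0_INR; lia].
    rewrite <- Rinv_1. apply Rinv_le_contravar; [lra|]. rewrite S_INR. pose proof (pos_INR n). lra.
Qed.

Definition log1p : C -> C := psum log_coef.

Lemma log1p_derive (v : C) : (Cmod v < 1)%R -> is_Cderive log1p v (/ (1 + v)).
Proof.
  intros Hv.
  assert (Hs := psum_correct 1 _ v (pderiv_convergent _ _ log_coef_convergent) Hv).
  set (s := psum (pderiv log_coef) v) in *.
  assert (E : s = 1 - v * s).
  { apply (Cpseries_unique_sum (pderiv log_coef) v); [exact Hs|].
    replace (1 - v * s) with (pderiv log_coef 0 + v * (0 - s)).
    2:{ rewrite pderiv_log_coef. simpl. ring. }
    apply pseries_shift. apply is_Cpseries_series in Hs. apply is_Cpseries_series.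
    eapply Cseries_ext; [|exact (Cseries_minus _ _ _ _ Cseries_zero Hs)].
    intros n. rewrite !pderiv_log_coef. simpl. rewrite RtoC_mult.
    change (RtoC (-1)) with (RtoC (- (1))). rewrite RtoC_opp. ring. }
  assert (Hnz : 1 + v <> 0).
  { apply Cmod_gt_0. pose proof (Cmod_triangle_rev 1 (- v)) as T.
    rewrite Cmod_opp, Cmod_1 in T. replace (1 - - v) with (1 + v) in T by ring. lra. }
  eapply is_Cderive_value.
  - apply (psum_derive 1); [apply log_coef_convergent|exact Hv].
  - fold s. replace s with ((s + v * s) * / (1 + v)) by (field; exact Hnz).
    rewrite E at 1. field. exact Hnz.
Qed.

(** [(1 + v) exp (- log (1 + v))] has derivative zero. *)
Lemma Cexp_opp_log1p (v : C) : (Cmod v < 1)%R -> Cexp (- log1p v) * (1 + v) = 1.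
Proof.
  intros Hv.
  rewrite (zero_derivative_constant 1 (fun v => Cexp (- log1p v) * (1 + v)) v); [| |exact Hv].
  - replace (log1p 0) with (RtoC 0).
    + replace (- 0) with (RtoC 0) by ring. rewrite Cexp_0. ring.
    + symmetry. apply (series_on_at_0 1 log_coef); [lra|].
      apply psum_series_on, log_coef_convergent.
  - intros w Hw.
    assert (Hnz : 1 + w <> 0).
    { apply Cmod_gt_0. pose proof (Cmod_triangle_rev 1 (- w)) as T.
      rewrite Cmod_opp, Cmod_1 in T. replace (1 - - w) with (1 + w) in T by ring. lra. }
    eapply is_Cderive_value.
    + apply is_Cderive_mult.
      * apply (is_Cderive_comp Cexp (fun v => - log1p v)); [apply Cexp_derive|].
        apply is_Cderive_opp, log1p_derive, Hw.
      * apply is_Cderive_plus; [apply is_Cderive_const|apply is_Cderive_id].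
    + simpl. field. exact Hnz.
Qed.

(** * The extremal function *)

(** Coefficients of [(1 + z^2) / (1 - z^2)]. *)
Definition cayley_coef (n : nat) : R :=
  match n with O => 1 | S _ => if Nat.even n then 2 else 0 end%R.

Definition extremal_coef (n : nat) : R :=
  match n with O => 0 | S m => (cayley_coef m / INR (S m) ^ 2)%R end.

Lemma cayley_coef_bound n : (0 <= cayley_coef n <= 2)%R.
Proof. destruct n; unfold cayley_coef; [|destruct (Nat.even (S n))]; lra. Qed.

Lemma extremal_coef_bound n : (0 <= extremal_coef n <= 2)%R.
Proof.
  destruct n as [|n]; unfold extremal_coef; [lra|].
  pose proof (cayley_coef_bound n). pose proof (pos_INR n).
  assert (H1 : (1 <= INR (S n) ^ 2)%R) by (rewrite S_INR; simpl; nra).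
  split; [apply Rdiv_le_0_compat; lra|].
  apply Rmult_le_reg_r with (INR (S n) ^ 2)%R; [lra|].
  unfold Rdiv. rewrite Rmult_assoc, Rinv_l by lra. nra.
Qed.

Definition extremal_series (n : nat) : C := RtoC (extremal_coef n).

Lemma extremal_convergent : convergent_on 1 extremal_series.
Proof.
  apply (coef_bound_convergent 1 2), bounded_coef_bound. intros n.
  unfold extremal_series. pose proof (extremal_coef_bound n).
  rewrite Cmod_R, Rabs_pos_eq; lra.
Qed.

Definition extremal : C -> C := psum extremal_series.
Definition extremal1 : C -> C := psum (pderiv extremal_series).
Definition extremal2 : C -> C := psum (pderiv (pderiv extremal_series)).

Lemma extremal_series_on : series_on 1 extremal_series extremal.
Proof. apply psum_series_on, extremal_convergent. Qed.

Lemma extremal_derive z : (Cmod z < 1)%R -> is_Cderive extremal z (extremal1 z).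
Proof. intros Hz. apply (psum_derive 1); [apply extremal_convergent|exact Hz]. Qed.

Lemma extremal1_derive z : (Cmod z < 1)%R -> is_Cderive extremal1 z (extremal2 z).
Proof.
  intros Hz. apply (psum_derive 1); [|exact Hz].
  apply pderiv_convergent, extremal_convergent.
Qed.

Lemma extremal_0 : extremal 0 = 0.
Proof. apply (series_on_at_0 1 _ _ Rlt_0_1 extremal_series_on). Qed.

(** The even coefficients from the second on repeat, so [p = 1 + z^2 (p + 1)]. *)
Lemma cayley_series_sum (z p : C) :
  (Cmod z < 1)%R -> is_Cpseries (fun n => RtoC (cayley_coef n)) z p ->
  p * (1 - z * z) = 1 + z * z.
Proof.
  intros Hz Hp.
  set (c := fun n => RtoC (cayley_coef n)) in *.
  set (one := fun n : nat => match n with O => RtoC 1 | S _ => RtoC 0 end).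
  assert (H1 : is_Cpseries one z (RtoC 1)).
  { replace (RtoC 1) with (1 + z * 0) by ring.
    apply (pseries_shift one), is_Cpseries_series.
    apply (Cseries_ext (fun _ => RtoC 0)); [|exact Cseries_zero]. intros n. simpl. ring. }
  assert (Hs : is_Cpseries (fun n => c (S (S n))) z (p + 1)).
  { eapply is_pseries_ext;
      [|exact (@is_pseries_plus C_AbsRing C_NormedModule c one z _ _ Hp H1)].
    intros n. change (c n + one n = c (S (S n))).
    unfold c, one, cayley_coef. destruct n as [|n].
    - apply C_eq; simpl; ring.
    - apply Cplus_0_r. }
  assert (H3 := pseries_shift c z _ (pseries_shift (fun n => c (S n)) z _ Hs)).
  assert (E := Cpseries_unique_sum c z _ _ Hp H3).
  unfold c in E. simpl in E.
  replace (p * (1 - z * z)) with (p - z * z * p) by ring.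
  rewrite E at 1. ring.
Qed.

(** [Re p |1 - z^2|^2 = 1 - |z|^4]. *)
Lemma extremal_class_W1 : class_W1 extremal.
Proof.
  assert (S1 : series_on 1 (pderiv extremal_series) extremal1)
    by apply psum_series_on, pderiv_convergent, extremal_convergent.
  assert (S2 : series_on 1 (pderiv (pderiv extremal_series)) extremal2)
    by apply psum_series_on, pderiv_convergent, pderiv_convergent, extremal_convergent.
  split; [split; [|split]|].
  - intros z Hz. exists (extremal1 z). now apply extremal_derive.
  - apply extremal_0.
  - eapply is_Cderive_value; [apply extremal_derive; rewrite Cmod_0; lra|].
    rewrite (series_on_at_0 1 _ _ Rlt_0_1 S1).
    unfold pderiv, extremal_series, extremal_coef, cayley_coef.
    rewrite <- RtoC_mult. f_equal. simpl. field.
  - exists extremal1, extremal2. intros z Hz.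
    split; [now apply extremal_derive|]. split; [now apply extremal1_derive|].
    set (p := extremal1 z + z * extremal2 z).
    assert (Hp : is_Cpseries (fun n => RtoC (cayley_coef n)) z p).
    { eapply is_pseries_ext; [|exact (series_on_plus _ _ _ _ _ S1 (series_on_times_id _ _ _ S2) z Hz)].
      intros n. unfold pderiv, extremal_series, extremal_coef. destruct n as [|n].
      - simpl. apply C_eq; simpl; field.
      - rewrite <- !RtoC_mult, <- RtoC_plus. f_equal.
        pose proof (pos_INR n). rewrite (S_INR (S n)), (S_INR n). field. lra. }
    assert (E := cayley_series_sum z p Hz Hp).
    assert (Hq : 1 - z * z <> 0).
    { apply Cmod_gt_0. pose proof (Cmod_triangle_rev 1 (z * z)) as T.
      rewrite Cmod_1, Cmod_mult in T. pose proof (Cmod_ge_0 z). nra. }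
    assert (E2 : Re (p * RtoC (Cmod (1 - z * z) ^ 2)) = (1 - Cmod z ^ 4)%R).
    { rewrite Cmod2_conj, Cmult_assoc, E.
      replace (Cmod z ^ 4)%R with ((Cmod z ^ 2) ^ 2)%R by ring. rewrite Cmod2_alt.
      destruct z as [x y]. unfold Re, Im; simpl. ring. }
    rewrite re_scal_r in E2.
    assert (P1 : (0 < Cmod (1 - z * z) ^ 2)%R) by (apply pow_lt; now apply Cmod_gt_0).
    assert (P2 : (Cmod z ^ 4 < 1)%R).
    { pose proof (Cmod_ge_0 z). assert (Cmod z ^ 2 < 1)%R by (simpl; nra).
      replace (Cmod z ^ 4)%R with (Cmod z ^ 2 * Cmod z ^ 2)%R by ring.
      pose proof (pow_le (Cmod z) 2 H). nra. }
    apply Rmult_lt_reg_r with (Cmod (1 - z * z) ^ 2)%R; [exact P1|]. lra.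
Qed.

(** The quotient [extremal z / z], with the singularity at [0] removed. *)
Definition extremal_quot : C -> C := psum (fun n => extremal_series (S n)).

Lemma extremal_quot_convergent : convergent_on 1 (fun n => extremal_series (S n)).
Proof.
  apply (coef_bound_convergent 1 2), bounded_coef_bound. intros n.
  unfold extremal_series. pose proof (extremal_coef_bound (S n)).
  rewrite Cmod_R, Rabs_pos_eq; lra.
Qed.

Lemma extremal_factor z : (Cmod z < 1)%R -> extremal z = z * extremal_quot z.
Proof.
  intros Hz. apply (Cpseries_unique_sum extremal_series z); [now apply extremal_series_on|].
  replace (z * extremal_quot z) with (extremal_series 0 + z * extremal_quot z)
    by (unfold extremal_series; simpl; ring).
  apply pseries_shift. apply (psum_correct 1); [apply extremal_quot_convergent|exact Hz].
Qed.

(** Coefficients of [extremal_quot - 1]. *)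
Definition extremal_tail_coef (n : nat) : R :=
  match n with O => 0%R | S _ => extremal_coef (S n) end.

(** Telescoping: [2 / (2 m + 3)^2 <= 1 / (2 (m + 1)) - 1 / (2 (m + 2))]. *)
Lemma extremal_tail_sum N :
  (sum_n extremal_tail_coef N <= / 2)%R.
Proof.
  set (beta := extremal_tail_coef).
  assert (Hodd : forall m, beta (S (2 * m)) = 0%R).
  { intros m. unfold beta, extremal_tail_coef, extremal_coef, cayley_coef.
    replace (Nat.even (S (2 * m))) with false; [unfold Rdiv; ring|].
    rewrite Nat.even_succ, Nat.odd_mul. reflexivity. }
  assert (Heven : forall m, beta (S (S (2 * m))) = (2 / (2 * INR m + 3) ^ 2)%R).
  { intros m. unfold beta, extremal_tail_coef, extremal_coef, cayley_coef.
    replace (Nat.even (S (S (2 * m)))) with true.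
    - rewrite !S_INR, mult_INR. f_equal. simpl (INR 2). f_equal. ring.
    - change (true = Nat.even (2 * m)). now rewrite Nat.even_mul. }
  assert (Main : forall m, (sum_n beta (2 * m) <= / 2 - / (2 * (INR m + 1)))%R).
  { induction m as [|m IH].
    - simpl (2 * 0)%nat. rewrite sum_O. simpl. lra.
    - replace (2 * S m)%nat with (S (S (2 * m))) by lia.
      rewrite !sum_Sn, Hodd, Heven, S_INR. change plus with Rplus.
      pose proof (pos_INR m) as Hm. set (x := INR m) in *.
      assert (T : (2 / (2 * x + 3) ^ 2 <= / (2 * (x + 1)) - / (2 * (x + 1 + 1)))%R).
      { replace (/ (2 * (x + 1)) - / (2 * (x + 1 + 1)))%R
          with (2 / (4 * ((x + 1) * (x + 2))))%R by (field; lra).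
        unfold Rdiv. apply Rmult_le_compat_l; [lra|].
        apply Rinv_le_contravar; nra. }
      lra. }
  destruct (Nat.Even_or_Odd N) as [[m ->]|[m ->]].
  - specialize (Main m). pose proof (pos_INR m).
    assert (0 < / (2 * (INR m + 1)))%R by (apply Rinv_0_lt_compat; lra). lra.
  - replace (2 * m + 1)%nat with (S (2 * m)) by lia.
    rewrite sum_Sn, Hodd. change plus with Rplus.
    specialize (Main m). pose proof (pos_INR m).
    assert (0 < / (2 * (INR m + 1)))%R by (apply Rinv_0_lt_compat; lra). lra.
Qed.

Lemma extremal_quot_near_1 z : (Cmod z < 1)%R -> (Cmod (extremal_quot z - 1) <= / 2)%R.
Proof.
  intros Hz.
  assert (H := psum_correct 1 _ z extremal_quot_convergent Hz).
  assert (H1 := Cseries_tail _ _ (proj1 (is_Cpseries_series _ _ _) H)). cbv beta in H1.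
  set (v := fun n => match n with O => RtoC 0 | S _ => extremal_series (S n) * z ^ n end).
  assert (Hv : is_Cseries v (extremal_quot z - 1)).
  { replace (extremal_quot z - 1) with (v 0%nat + (extremal_quot z - extremal_series 1 * z ^ 0)).
    - apply Cseries_cons. exact H1.
    - unfold v, extremal_series, extremal_coef, cayley_coef. simpl.
      replace (1 / (1 * (1 * 1)))%R with 1%R by field. ring. }
  apply (Cmod_series_le v _ _ Hv). intros n.
  eapply Rle_trans; [|apply (extremal_tail_sum n)].
  apply Cmod_sum_n. intros [|k]; unfold v.
  - rewrite Cmod_0. apply Rle_refl.
  - pose proof (extremal_coef_bound (S (S k))).
    unfold extremal_series. rewrite Cmod_RtoC_mult by lra.
    rewrite Cmod_pow.
    apply Rle_trans with (extremal_coef (S (S k)) * 1)%R; [|rewrite Rmult_1_r; apply Rle_refl].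
    apply Rmult_le_compat_l; [lra|].
    rewrite <- (pow1 (S k)). apply pow_incr. pose proof (Cmod_ge_0 z). lra.
Qed.

(** From [|extremal z| = |z| |extremal_quot z| >= |z| / 2]. *)
Lemma extremal_preimage_small z :
  (Cmod z < 1)%R -> (Cmod (extremal z) < 1 / 4)%R -> (Cmod z < 1 / 2)%R.
Proof.
  intros Hz Hf. rewrite extremal_factor, Cmod_mult in Hf by exact Hz.
  assert (Hq := extremal_quot_near_1 z Hz).
  pose proof (Cmod_triangle_rev 1 (extremal_quot z)) as T.
  rewrite Cmod_sym, Cmod_1 in T. pose proof (Cmod_ge_0 z). nra.
Qed.

Lemma Cpow_lipschitz (z w : C) (r : R) (n : nat) :
  (Cmod z <= r)%R -> (Cmod w <= r)%R ->
  (Cmod (z ^ S n - w ^ S n) <= INR (S n) * r ^ n * Cmod (z - w))%R.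
Proof.
  intros Hz Hw. pose proof (Cmod_ge_0 z). pose proof (Cmod_ge_0 (z - w)).
  induction n as [|n IH].
  - simpl. rewrite !Cmult_1_r. lra.
  - replace (z ^ S (S n) - w ^ S (S n)) with (z * (z ^ S n - w ^ S n) + w ^ S n * (z - w))
      by (simpl; ring).
    eapply Rle_trans; [apply Cmod_triangle|]. rewrite !Cmod_mult, Cmod_pow.
    rewrite (S_INR (S n)).
    apply Rle_trans with (r * (INR (S n) * r ^ n * Cmod (z - w)) + r ^ S n * Cmod (z - w))%R.
    + apply Rplus_le_compat.
      * apply Rmult_le_compat; auto using Cmod_ge_0.
      * apply Rmult_le_compat_r; [lra|]. apply pow_incr. split; [apply Cmod_ge_0|exact Hw].
    + simpl pow. right. ring.
Qed.

Lemma extremal_term_bound n z w :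
  (Cmod z <= 1 / 2)%R -> (Cmod w <= 1 / 2)%R ->
  (Cmod (extremal_series (S (S (S n))) * z ^ S (S (S n))
         - extremal_series (S (S (S n))) * w ^ S (S (S n)))
   <= (/ 6 * Cmod (z - w)) * (1 / 2) ^ n)%R.
Proof.
  intros Hz Hw.
  set (m := S (S n)).
  replace (extremal_series (S m) * z ^ S m - extremal_series (S m) * w ^ S m)
    with (extremal_series (S m) * (z ^ S m - w ^ S m)) by ring.
  unfold extremal_series. pose proof (extremal_coef_bound (S m)) as Hb.
  rewrite Cmod_RtoC_mult by lra.
  pose proof (Cmod_ge_0 (z - w)) as Hh.
  eapply Rle_trans.
  { apply Rmult_le_compat_l; [lra|]. apply (Cpow_lipschitz z w (1 / 2) m Hz Hw). }
  assert (Hc : (extremal_coef (S m) * INR (S m) <= 2 / 3)%R).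
  { unfold extremal_coef. pose proof (cayley_coef_bound m).
    assert (H3 : (3 <= INR (S m))%R)
      by (unfold m; rewrite !S_INR; pose proof (pos_INR n); lra).
    replace (cayley_coef m / INR (S m) ^ 2 * INR (S m))%R
      with (cayley_coef m * / INR (S m))%R by (field; lra).
    apply Rmult_le_compat; [lra| |lra|apply Rinv_le_contravar; lra].
    left. apply Rinv_0_lt_compat. lra. }
  assert (Hp : (0 <= (1 / 2) ^ n * Cmod (z - w))%R)
    by (apply Rmult_le_pos; [apply pow_le; lra|exact Hh]).
  replace (extremal_coef (S m) * (INR (S m) * (1 / 2) ^ m * Cmod (z - w)))%R
    with (extremal_coef (S m) * INR (S m) * (1 / 4 * ((1 / 2) ^ n * Cmod (z - w))))%R
    by (unfold m; simpl pow; field).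
  apply Rle_trans with (2 / 3 * (1 / 4 * ((1 / 2) ^ n * Cmod (z - w))))%R; [|lra].
  apply Rmult_le_compat_r; lra.
Qed.

(** On the disc of radius 1/2, [extremal z - z] contracts by [1/3]: the coefficients
    from the cubic one on satisfy [n a_n <= 2/3]. *)
Lemma extremal_contraction z w :
  (Cmod z <= 1 / 2)%R -> (Cmod w <= 1 / 2)%R ->
  (Cmod ((extremal z - z) - (extremal w - w)) <= / 3 * Cmod (z - w))%R.
Proof.
  intros Hz Hw.
  assert (Sz := extremal_series_on z ltac:(lra)). assert (Sw := extremal_series_on w ltac:(lra)).
  assert (Tz := proj1 (is_Cpseries_series _ _ _) Sz).
  assert (Tw := proj1 (is_Cpseries_series _ _ _) Sw).
  assert (H := Cseries_tail _ _ (Cseries_tail _ _ (Cseries_tail _ _ (Cseries_minus _ _ _ _ Tz Tw)))).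
  cbv beta in H.
  set (l := extremal z - extremal w) in H.
  assert (E : l - (extremal_series 0 * z ^ 0 - extremal_series 0 * w ^ 0)
     - (extremal_series 1 * z ^ 1 - extremal_series 1 * w ^ 1)
     - (extremal_series 2 * z ^ 2 - extremal_series 2 * w ^ 2)
     = (extremal z - z) - (extremal w - w)).
  { unfold l, extremal_series, extremal_coef, cayley_coef. simpl.
    replace (1 / (1 * (1 * 1)))%R with 1%R by field.
    replace (0 / ((1 + 1) * ((1 + 1) * 1)))%R with 0%R by field. ring. }
  rewrite E in H.
  set (h := Cmod (z - w)). assert (Hh : (0 <= h)%R) by apply Cmod_ge_0.
  destruct (Cseries_dominated
    (fun n => extremal_series (S (S (S n))) * z ^ S (S (S n))
              - extremal_series (S (S (S n))) * w ^ S (S (S n)))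
    (fun n => (/ 6 * h) * (1 / 2) ^ n)%R (/ 6 * h * / (1 - 1 / 2))%R) as [l' [Hl' HB]].
  - intros n. now apply extremal_term_bound.
  - apply (@is_series_scal R_AbsRing R_NormedModule (/ 6 * h)%R), is_series_geom.
    rewrite Rabs_pos_eq; lra.
  - rewrite (Cseries_unique _ _ _ H Hl'). lra.
Qed.

(** * The inverse of the extremal function *)

(** Fixed-point iteration for [z = w - (extremal z - z)], the equation [extremal z = w]. *)
Fixpoint picard (w : C) (n : nat) : C :=
  match n with
  | O => 0
  | S n => w - (extremal (picard w n) - picard w n)
  end.

Lemma extremal_minus_id_bound z :
  (Cmod z <= 1 / 2)%R -> (Cmod (extremal z - z) <= / 3 * Cmod z)%R.
Proof.
  intros Hz. assert (H := extremal_contraction z 0 Hz).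
  rewrite extremal_0, Cmod_0 in H. specialize (H ltac:(lra)).
  replace (extremal z - z - (0 - 0)) with (extremal z - z) in H by ring.
  now replace (z - 0) with z in H by ring.
Qed.

Lemma picard_bound w n : (Cmod w < 1 / 4)%R -> (Cmod (picard w n) <= 3 / 8)%R.
Proof.
  intros Hw. induction n as [|n IH]; simpl.
  - rewrite Cmod_0. lra.
  - eapply Rle_trans; [apply Cmod_triangle|]. rewrite Cmod_opp.
    pose proof (extremal_minus_id_bound (picard w n) ltac:(lra)). lra.
Qed.

Lemma picard_step w n : (Cmod w < 1 / 4)%R ->
  (Cmod (picard w (S n) - picard w n) <= 1 / 4 * (/ 3) ^ n)%R.
Proof.
  intros Hw. induction n as [|n IH].
  - simpl. rewrite extremal_0. replace (w - (0 - 0) - 0) with w by ring. lra.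
  - replace (picard w (S (S n)) - picard w (S n))
      with (- ((extremal (picard w (S n)) - picard w (S n))
               - (extremal (picard w n) - picard w n))) by (simpl; ring).
    rewrite Cmod_opp.
    pose proof (picard_bound w n Hw). pose proof (picard_bound w (S n) Hw).
    eapply Rle_trans; [apply extremal_contraction; lra|]. simpl pow. lra.
Qed.

(** The limit of the iteration, as a telescoping series. *)
Definition extremal_inv (w : C) : C := Csum (fun n => picard w (S n) - picard w n).

Lemma picard_limit w : (Cmod w < 1 / 4)%R -> forall eps : R, (0 < eps)%R ->
  exists n, (Cmod (picard w n - extremal_inv w) < eps)%R /\
            (Cmod (picard w (S n) - extremal_inv w) < eps)%R.
Proof.
  intros Hw eps He.
  destruct (Cseries_dominated (fun n => picard w (S n) - picard w n)
     (fun n => (1 / 4 * (/ 3) ^ n)%R) (1 / 4 * / (1 - / 3))%R) as [l [Hl _]].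
  - intros n. now apply picard_step.
  - apply (@is_series_scal R_AbsRing R_NormedModule (1 / 4)%R), is_series_geom.
    rewrite Rabs_pos_eq; lra.
  - assert (El : extremal_inv w = l) by (apply Csum_unique, Hl). rewrite El.
    destruct (proj1 (is_Cseries_eps _ _) Hl eps He) as [N HN].
    assert (T : forall n, sum_n (G := C_AbelianMonoid) (fun n => picard w (S n) - picard w n) n
                          = picard w (S n)).
    { induction n as [|n IH]; [rewrite sum_O; simpl; ring|].
      rewrite sum_Sn, IH.
      change (picard w (S n) + (picard w (S (S n)) - picard w (S n)) = picard w (S (S n))). ring. }
    exists (S N). rewrite <- (T N), <- (T (S N)). split; apply HN; lia.
Qed.

Lemma extremal_inv_bound w : (Cmod w < 1 / 4)%R -> (Cmod (extremal_inv w) < 1 / 2)%R.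
Proof.
  intros Hw. destruct (picard_limit w Hw (1 / 8) ltac:(lra)) as [n [Hn _]].
  pose proof (picard_bound w n Hw). rewrite Cmod_sym in Hn.
  pose proof (Cmod_triangle_rev (extremal_inv w) (picard w n)). lra.
Qed.

Lemma extremal_inv_correct w : (Cmod w < 1 / 4)%R -> extremal (extremal_inv w) = w.
Proof.
  intros Hw. pose proof (extremal_inv_bound w Hw) as Hb.
  apply Ceq_minus, Cmod_eq_0, Rle_antisym; [|apply Cmod_ge_0].
  apply Rnot_lt_le. intros Hp.
  set (l := extremal_inv w) in *.
  destruct (picard_limit w Hw (Cmod (extremal l - w) / 2) ltac:(lra)) as [n [H1 H2]].
  fold l in H1, H2.
  pose proof (picard_bound w n Hw) as Hn.
  replace (extremal l - w) with
    (((extremal l - l) - (extremal (picard w n) - picard w n)) - (picard w (S n) - l)) in *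
    by (simpl; ring).
  assert (C1 := extremal_contraction l (picard w n) ltac:(lra) ltac:(lra)).
  rewrite (Cmod_sym l) in C1.
  set (A := (extremal l - l) - (extremal (picard w n) - picard w n)) in *.
  pose proof (Cmod_triangle A (- (picard w (S n) - l))) as T. rewrite Cmod_opp in T.
  change (A + - (picard w (S n) - l)) with (A - (picard w (S n) - l)) in T. lra.
Qed.

Lemma extremal_expansion z w :
  (Cmod z <= 1 / 2)%R -> (Cmod w <= 1 / 2)%R ->
  (2 / 3 * Cmod (z - w) <= Cmod (extremal z - extremal w))%R.
Proof.
  intros Hz Hw. assert (H := extremal_contraction z w Hz Hw).
  pose proof (Cmod_triangle_rev (z - w) (- ((extremal z - z) - (extremal w - w)))) as T.
  rewrite Cmod_opp in T.
  replace (z - w - - (extremal z - z - (extremal w - w))) with (extremal z - extremal w) in T by ring.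
  lra.
Qed.

Lemma extremal_is_inverse : is_inverse extremal extremal_inv.
Proof.
  intros w Hw. pose proof (extremal_inv_bound w Hw) as Hb. split; [lra|].
  intros z Hz. split; [|intros ->; now apply extremal_inv_correct].
  intros E.
  assert (Hz2 : (Cmod z < 1 / 2)%R)
    by (apply extremal_preimage_small; [exact Hz|now rewrite E]).
  assert (L := extremal_expansion z (extremal_inv w) ltac:(lra) ltac:(lra)).
  rewrite extremal_inv_correct, E in L by exact Hw.
  replace (w - w) with (RtoC 0) in L by ring. rewrite Cmod_0 in L.
  apply Ceq_minus, Cmod_eq_0, Rle_antisym; [lra|apply Cmod_ge_0].
Qed.

(** A zero derivative would contradict [extremal_expansion] near [z]. *)
Lemma extremal1_nz z : (Cmod z < 1 / 2)%R -> extremal1 z <> 0.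
Proof.
  intros Hz E. assert (D := extremal_derive z ltac:(lra)).
  rewrite is_Cderive_eps in D. destruct (D (/ 3)%R ltac:(lra)) as [d [Hd H]].
  set (h := (Rmin d (1 / 2 - Cmod z) / 2)%R).
  pose proof (Rmin_l d (1 / 2 - Cmod z)). pose proof (Rmin_r d (1 / 2 - Cmod z)).
  assert (Hm : (0 < Rmin d (1 / 2 - Cmod z))%R) by (apply Rmin_glb_lt; lra).
  assert (Eh : Cmod (z + h - z) = h).
  { replace (z + h - z) with (RtoC h) by ring. rewrite Cmod_R, Rabs_pos_eq; unfold h; lra. }
  assert (Hzh : (Cmod (z + h) <= 1 / 2)%R).
  { eapply Rle_trans; [apply Cmod_triangle|]. rewrite Cmod_R, Rabs_pos_eq; unfold h; lra. }
  assert (L := extremal_expansion (z + h) z Hzh ltac:(lra)).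
  specialize (H (z + h)). rewrite Eh in *. specialize (H ltac:(unfold h; lra)).
  rewrite E in H.
  replace (extremal (z + h) - extremal z - 0 * (z + h - z))
    with (extremal (z + h) - extremal z) in H by ring.
  assert (0 < h)%R by (unfold h; lra). lra.
Qed.

Lemma extremal_inv_lipschitz w w' :
  (Cmod w < 1 / 4)%R -> (Cmod w' < 1 / 4)%R ->
  (Cmod (extremal_inv w - extremal_inv w') <= 3 / 2 * Cmod (w - w'))%R.
Proof.
  intros Hw Hw'.
  pose proof (extremal_inv_bound w Hw). pose proof (extremal_inv_bound w' Hw').
  assert (L := extremal_expansion (extremal_inv w) (extremal_inv w') ltac:(lra) ltac:(lra)).
  rewrite !extremal_inv_correct in L by assumption. lra.
Qed.

Lemma extremal_inv_derive w :
  (Cmod w < 1 / 4)%R -> is_Cderive extremal_inv w (/ extremal1 (extremal_inv w)).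
Proof.
  intros Hw. pose proof (extremal_inv_bound w Hw) as Hb.
  set (z := extremal_inv w) in *.
  assert (Hnz := extremal1_nz z Hb). set (m := extremal1 z) in *.
  assert (Hm : (0 < Cmod m)%R) by now apply Cmod_gt_0.
  assert (D := extremal_derive z ltac:(lra)). fold m in D.
  rewrite is_Cderive_eps in D. apply is_Cderive_eps. intros eps He.
  destruct (D (eps * Cmod m * (2 / 3))%R) as [d [Hd H]].
  { repeat apply Rmult_lt_0_compat; lra. }
  exists (Rmin (1 / 4 - Cmod w) (d * (2 / 3))). split; [apply Rmin_glb_lt; lra|].
  intros v Hv.
  assert (Hv1 := Rlt_le_trans _ _ _ Hv (Rmin_l _ _)).
  assert (Hv2 := Rlt_le_trans _ _ _ Hv (Rmin_r _ _)).
  assert (Hv4 : (Cmod v < 1 / 4)%R) by (pose proof (Cmod_triangle_rev v w); lra).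
  assert (L := extremal_inv_lipschitz v w Hv4 Hw). fold z in L.
  specialize (H (extremal_inv v) ltac:(lra)).
  replace (extremal z) with w in H by (symmetry; now apply extremal_inv_correct).
  rewrite extremal_inv_correct in H by assumption.
  change (extremal_inv w) with z.
  replace (extremal_inv v - z - / m * (v - w))
    with (- (/ m * (v - w - m * (extremal_inv v - z)))) by (field; exact Hnz).
  rewrite Cmod_opp, Cmod_mult, Cmod_inv by exact Hnz.
  apply Rmult_le_reg_l with (Cmod m); [exact Hm|].
  rewrite <- Rmult_assoc, Rinv_r, Rmult_1_l by lra.
  eapply Rle_trans; [exact H|].
  apply Rle_trans with (eps * Cmod m * (2 / 3) * (3 / 2 * Cmod (v - w)))%R; [|right; field].
  apply Rmult_le_compat_l; [|exact L].
  left. repeat apply Rmult_lt_0_compat; lra.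
Qed.

(** * Logarithmic inverse coefficients of the extremal function *)

(** [w / f^{-1} w] is [extremal_quot (f^{-1} w)], which stays in the disc of radius
    1/2 about 1. *)
Definition extremal_log (w : C) : C := - log1p (extremal_quot (extremal_inv w) - 1).

Definition extremal_log1 (w : C) : C :=
  - (/ extremal_quot (extremal_inv w)
     * (psum (pderiv (fun n => extremal_series (S n))) (extremal_inv w)
        * / extremal1 (extremal_inv w))).

Lemma extremal_quot_nz z : (Cmod z < 1)%R -> extremal_quot z <> 0.
Proof.
  intros Hz. apply Cmod_gt_0. assert (Hq := extremal_quot_near_1 z Hz).
  pose proof (Cmod_triangle_rev 1 (extremal_quot z)) as T.
  rewrite Cmod_sym, Cmod_1 in T. lra.
Qed.

Lemma extremal_log_C1 : C1_on (1 / 4) extremal_log extremal_log1.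
Proof.
  intros w Hw. pose proof (extremal_inv_bound w Hw) as Hb.
  assert (Hq := extremal_quot_near_1 (extremal_inv w) ltac:(lra)).
  assert (Hqnz := extremal_quot_nz (extremal_inv w) ltac:(lra)).
  assert (Dq := psum_derive 1 _ (extremal_inv w) extremal_quot_convergent ltac:(lra)).
  fold extremal_quot in Dq.
  assert (Dg := extremal_inv_derive w Hw).
  assert (Cg := is_Cderive_continuous _ _ _ Dg).
  split.
  - unfold extremal_log, extremal_log1. apply is_Cderive_opp.
    eapply is_Cderive_value.
    + apply (is_Cderive_comp log1p (fun w => extremal_quot (extremal_inv w) - 1)).
      * apply log1p_derive. lra.
      * apply is_Cderive_plus; [|apply is_Cderive_opp, is_Cderive_const].
        exact (is_Cderive_comp extremal_quot extremal_inv _ _ _ Dq Dg).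
    + replace (1 + (extremal_quot (extremal_inv w) - 1))
        with (extremal_quot (extremal_inv w)) by ring. ring.
  - unfold extremal_log1. apply continuous_Copp, continuous_Cmult; [|apply continuous_Cmult].
    + apply continuous_Cinv; [exact Hqnz|].
      apply (continuous_comp extremal_inv extremal_quot); [exact Cg|].
      eapply is_Cderive_continuous, Dq.
    + apply (continuous_comp extremal_inv); [exact Cg|].
      apply (psum_continuous 1); [|lra]. apply pderiv_convergent, extremal_quot_convergent.
    + apply continuous_Cinv; [apply extremal1_nz, Hb|].
      apply (continuous_comp extremal_inv extremal1); [exact Cg|].
      eapply is_Cderive_continuous, extremal1_derive. lra.
Qed.

Lemma extremal_log_quotient : is_log_quotient extremal_inv extremal_log.
Proof.
  assert (G0 : extremal_inv 0 = 0).
  { symmetry. apply (extremal_is_inverse 0); [rewrite Cmod_0; lra|rewrite Cmod_0; lra|].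
    apply extremal_0. }
  split.
  - unfold extremal_log. rewrite G0.
    replace (extremal_quot 0) with (RtoC 1).
    + replace (1 - 1) with (RtoC 0) by ring.
      unfold log1p. rewrite (series_on_at_0 1 log_coef (psum log_coef) Rlt_0_1).
      * simpl. ring.
      * apply psum_series_on, log_coef_convergent.
    + unfold extremal_quot.
      rewrite (series_on_at_0 1 _ _ Rlt_0_1 (psum_series_on _ _ extremal_quot_convergent)).
      unfold extremal_series, extremal_coef, cayley_coef. f_equal. simpl. field.
  - intros w Hw. split.
    + eapply is_Cderive_continuous, extremal_log_C1, Hw.
    + intros Hnz. pose proof (extremal_inv_bound w Hw) as Hb.
      assert (Ef := extremal_inv_correct w Hw).
      rewrite extremal_factor in Ef by lra.
      assert (Hq := extremal_quot_near_1 (extremal_inv w) ltac:(lra)).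
      assert (Hqnz := extremal_quot_nz (extremal_inv w) ltac:(lra)).
      assert (EC := Cexp_opp_log1p (extremal_quot (extremal_inv w) - 1) ltac:(lra)).
      change (Cexp (extremal_log w) * (1 + (extremal_quot (extremal_inv w) - 1)) = 1) in EC.
      set (z := extremal_inv w) in *. set (q := extremal_quot z) in *.
      assert (Hz : z <> 0).
      { intros Z. apply Hnz. rewrite <- Ef, Z. ring. }
      replace (z / w) with (/ q) by (rewrite <- Ef; field; split; assumption).
      replace (1 + (q - 1)) with q in EC by ring.
      replace (Cexp (extremal_log w)) with (Cexp (extremal_log w) * q * / q)
        by (field; exact Hqnz).
      rewrite EC. ring.
Qed.

Theorem extremal_sharp :
  exists Gamma, is_log_inverse_coeffs extremal Gamma /\ Cmod (H21 Gamma) = (1 / 81)%R.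
Proof.
  destruct (C1_series (1 / 4) _ _ ltac:(lra) extremal_log_C1) as [b Hb].
  assert (E0 : b 0%nat = 0).
  { rewrite <- (series_on_at_0 (1 / 4) b extremal_log ltac:(lra) Hb).
    apply extremal_log_quotient. }
  exists (fun n => b n / 2).
  assert (HG : is_log_inverse_coeffs extremal (fun n => b n / 2)).
  { exists extremal_inv, extremal_log. split; [apply extremal_is_inverse|].
    split; [apply extremal_log_quotient|].
    intros w Hw. eapply is_pseries_ext; [|exact (Hb w Hw)].
    intros [|n]; [exact E0|]. change (b (S n) = 2 * (b (S n) / 2)). field. }
  split; [exact HG|].
  rewrite (H21_in_coefs extremal extremal_series _ extremal_series_on); [|reflexivity| |exact HG].
  - replace (/ 4 * hankel_coefs _ _ _) with (- RtoC (1 / 81)).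
    + rewrite Cmod_opp, Cmod_R, Rabs_pos_eq; lra.
    + unfold hankel_coefs, extremal_series, extremal_coef, cayley_coef.
      apply C_eq; simpl; field.
  - unfold extremal_series, extremal_coef, cayley_coef. f_equal. simpl. field.
Qed.

Close Scope C_scope.

Theorem theorem5p2 :
  (forall (f : C -> C) (Gamma : nat -> C),
     class_W1 f -> is_log_inverse_coeffs f Gamma ->
     Cmod (H21 Gamma) <= 1 / 81) /\
  (exists (f : C -> C) (Gamma : nat -> C),
     class_W1 f /\ is_log_inverse_coeffs f Gamma /\
     Cmod (H21 Gamma) = 1 / 81).
Proof.
  split; [exact H21_bound|].
  destruct extremal_sharp as [Gamma [HG HE]].
  exists extremal, Gamma. split; [exact extremal_class_W1|]. now split.
Qed.
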